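(* There exist constants $b_1,b_2$ with $0.95<b_1<0.951$ and $0.97<b_2<0.971$ such that the following holds. Let $s=\sigma+\mathrm{i}t$ with $\sigma>1/2$ and $|t|\geq 10^4$, and assume that the Riemann zeta-function satisfies $\zeta(z)\neq 0$ for all $z\in\mathscr{R}(10^3,1,t)$. Then: (a) For $\sigma\in\mathscr{S}(0.5,0.5,1,t)$, $$|\log\zeta(s)|\leq 5.44\left(b_1\log|t|\right)^{2(1-\sigma)}\log\log|t|.$$ (b) For $\sigma\in\mathscr{S}(1.0051,0.3349,1,t)$, $$\left|\frac{\zeta'}{\zeta}(s)\right|\leq 33.281\left(b_2\log|t|\right)^{2(1-\sigma)}\left(\log\log|t|\right)^2.$$
   Context: For $C_3>0$, $c\ge1$, $|t|\ge e$: $$\mathscr{R}(C_3,c,t)=\left\{w\in\mathbb{C}:\Re\{w\}>\tfrac12,\ |\Im\{w\}-t|\le C_3\log\log(c(|t|+1))+3\right\},$$ $$\mathscr{S}(A,B,c,t)=\left[\frac12+\frac{A}{\log\log(c|t|)},\ 1+\frac{B}{\log\log(c|t|)}\right].$$ $\log\zeta(s)$ denotes the branch which for $\sigma>1$ equals $\sum_p\sum_{k\ge1}\frac{1}{kp^{ks}}$, continued holomorphically into the zero-free region under consideration. *)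

(* Defs.v *)
(* Stdlib world: Stdlib's R, with Coquelicot's C.  Complex differentiability
   is [ex_derive] over [C_AbsRing], and [C_derive] is the complex derivative. *)
From Stdlib Require Import Reals ZArith Znumtheory.
From Coquelicot Require Import Coquelicot.

Open Scope R_scope.

Definition Cexp (z : C) : C :=
  (exp (Re z) * cos (Im z), exp (Re z) * sin (Im z)).

(* x^z for real x > 0, with the real logarithm of x. *)
Definition Rcpow (x : R) (z : C) : C := Cexp (z * RtoC (ln x))%C.

Definition holomorphic_on (U : C -> Prop) (f : C -> C) : Prop :=
  forall z : C, U z -> @ex_derive C_AbsRing C_NormedModule f z.

(* The Riemann zeta-function as the analytic continuation of its Dirichlet
   series to C \ {1}.  As C \ {1} is connected, this determines zeta everywhere
   except for its irrelevant value at the pole. *)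
Definition is_riemann_zeta (zeta : C -> C) : Prop :=
  holomorphic_on (fun z => z <> RtoC 1) zeta /\
  forall s : C, 1 < Re s ->
    @is_series C_AbsRing C_NormedModule
      (fun n => (/ Rcpow (INR (S n)) s)%C) (zeta s).

(* l = sum over primes p of sum over k >= 1 of 1 / (k p^(k s)), as an iterated
   sum; [inner p] is the sum over k, and it is 0 for p not prime. *)
Definition is_prime_power_sum (s l : C) : Prop :=
  exists inner : nat -> C,
    (forall p : nat, prime (Z.of_nat p) ->
       @is_series C_AbsRing C_NormedModule
         (fun j => (/ (RtoC (INR (S j)) *
                       Rcpow (INR p) (RtoC (INR (S j)) * s)))%C)
         (inner p)) /\
    (forall p : nat, ~ prime (Z.of_nat p) -> inner p = RtoC 0) /\
    @is_series C_AbsRing C_NormedModule inner l.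

(* L is the branch of log zeta on U that is given by the sum over prime powers
   for Re z > 1.  It is unique when U is open, connected and meets Re z > 1. *)
Definition is_log_zeta_on (zeta : C -> C) (U : C -> Prop) (L : C -> C) : Prop :=
  holomorphic_on U L /\
  (forall z : C, U z -> Cexp (L z) = zeta z) /\
  (forall z : C, U z -> 1 < Re z -> is_prime_power_sum z (L z)).

Definition region_R (C3 c t : R) (w : C) : Prop :=
  1 / 2 < Re w /\
  Rabs (Im w - t) <= C3 * ln (ln (c * (Rabs t + 1))) + 3.

(* [region_R] contains its horizontal edges, so holomorphy is asked for on its
   interior, which contains every sigma + i t with sigma > 1/2. *)
Definition interior_of (U : C -> Prop) (z : C) : Prop :=
  @locally C_UniformSpace z U.

Definition interval_S (A B c t : R) (sigma : R) : Prop :=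
  1 / 2 + A / ln (ln (c * Rabs t)) <= sigma <= 1 + B / ln (ln (c * Rabs t)).

(* Main.v *)
(* log zeta is estimated on two vertical lines and interpolated.  Near the line
   Re s = 1/2 + 0.5 / loglog |t|, the bound |zeta(s)| <= 5.2 |t|^(1/2) and the
   Borel-Caratheodory inequality on a disc centred at 1.2 + i Im s that almost touches
   the critical line give |log zeta| <= 1.86 log |t| loglog |t|; to the right of 1 the
   Euler product gives |log zeta(s)| <= log (sigma / (sigma - 1)).  The maximum principle for
   log zeta(z) (b log |t|)^(2 z) exp (0.02 (z - s)^2 / loglog |t|) on a rectangle of
   height 20 loglog |t| then yields (a), with a range of sigma that is slightly larger on the right.
   (b) is Cauchy's estimate on the circle of radius 0.5 / loglog |t| about s, which costs
   a factor 2 e loglog |t|, and 2 * 5.44 * e < 33.281. *)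
Require Import Defs.
From Stdlib Require Import Reals ZArith Znumtheory Lra Lia Classical ClassicalEpsilon
  FunctionalExtensionality List Ranalysis5.
From Coquelicot Require Import Coquelicot.
Open Scope R_scope.

(** * Complex differentiability and the exponential *)

(** Zeta is given only by its Dirichlet series and holomorphy off 1, so its size left of Re s = 1
    has to be transported from the right. The bound by |t|^(1/2) is proved for the approximants
    sum_{n <= M} n^(-s) + M^(1-s) / (s-1), which converge for Re s >= 1/2, and a three-circles
    argument identifies their limit with zeta.

    The complex analysis rests on Goursat's theorem for rectangles. Its image under exp gives mean
    values on circles, and these give Cauchy's estimate and the maximum principle. Only imaginary
    parts of means are followed, so functions are first turned by a unimodular factor.

    Part (b) mentions no branch of the logarithm, so one is built on a rectangle and normalised to
    the right of 1. The interpolation is proved for any function with the properties that this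
    branch shares with the one given in (a). It holds for every b in [0.95, 1], which leaves b1 and
    b2 free. The right-hand line is 1 + 0.84 / loglog |t| because the circle about s in (b) reaches
    1 + 0.8349 / loglog |t|. *)

Definition Cderiv (f : C -> C) (z l : C) : Prop :=
  forall eps, 0 < eps -> exists d, 0 < d /\
    forall w, Cmod (w - z) < d ->
      Cmod (f w - f z - l * (w - z))%C <= eps * Cmod (w - z).

Lemma Cball_Cmod (z : C) (e : posreal) (w : C) :
  Cmod (w - z) < e -> @ball C_UniformSpace z e w.
Proof. apply C_NormedModule_mixin_compat1. Qed.

Lemma locally_Cmod (P : C -> Prop) (z : C) :
  @locally C_UniformSpace z P <->
  exists d, 0 < d /\ forall w, Cmod (w - z) < d -> P w.
Proof.
  split.
  - intros [e He]. exists e. split. apply cond_pos.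
    intros w Hw. apply He. apply Cball_Cmod. exact Hw.
  - intros [d [Hd H]].
    (* Balls of [C_UniformSpace] are squares; the one of half side d / sqrt 2 lies in the disc of
       radius d. *)
    assert (Hs : 0 < d / sqrt 2) by (apply Rdiv_lt_0_compat; [exact Hd | apply sqrt_lt_R0; lra]).
    exists (mkposreal _ Hs). intros w Hw. apply H.
    assert (H2 := C_NormedModule_mixin_compat2 z w (mkposreal _ Hs) Hw).
    change (Cmod (w - z)%C < sqrt 2 * (d / sqrt 2)) in H2.
    replace (sqrt 2 * (d / sqrt 2)) with d in H2. exact H2.
    field. apply Rgt_not_eq. apply sqrt_lt_R0; lra.
Qed.

Lemma is_derive_Cderiv (f : C -> C) (z l : C) :
  @is_derive C_AbsRing C_NormedModule f z l <-> Cderiv f z l.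
Proof.
  split.
  - intros [_ H] eps He.
    specialize (H z (fun P HP => HP) (mkposreal eps He)).
    destruct H as [d H]. exists d. split; [apply cond_pos|].
    intros w Hw. specialize (H w Hw).
    change (Cmod (f w - f z - (w - z) * l)%C <= eps * Cmod (w - z)) in H.
    replace (f w - f z - l * (w - z))%C with (f w - f z - (w - z) * l)%C by ring.
    exact H.
  - intros H. split.
    apply is_linear_scal_l.
    intros x Hx eps.
    assert (E : z = x).
    { apply (@is_filter_lim_locally_unique C_AbsRing (AbsRing_NormedModule C_AbsRing)).
      exact Hx. }
    subst x.
    destruct (H eps (cond_pos eps)) as [d [Hd H']].
    exists (mkposreal d Hd). intros w Hw.
    specialize (H' w Hw).
    change (Cmod (f w - f z - (w - z) * l)%C <= eps * Cmod (w - z)).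
    replace (f w - f z - (w - z) * l)%C with (f w - f z - l * (w - z))%C by ring.
    exact H'.
Qed.

Lemma Cderiv_const (c z : C) : Cderiv (fun _ => c) z 0.
Proof.
  intros e He. exists 1. split; [lra|]. intros w _.
  replace (c - c - 0 * (w - z))%C with (RtoC 0) by ring.
  rewrite Cmod_0. apply Rmult_le_pos; [lra | apply Cmod_ge_0].
Qed.

Lemma Cderiv_id (z : C) : Cderiv (fun w => w) z 1.
Proof.
  intros e He. exists 1. split; [lra|]. intros w _.
  replace (w - z - 1 * (w - z))%C with (RtoC 0) by ring.
  rewrite Cmod_0. apply Rmult_le_pos; [lra | apply Cmod_ge_0].
Qed.

Lemma Cderiv_eq (f : C -> C) (z l l' : C) : Cderiv f z l -> l = l' -> Cderiv f z l'.
Proof. intros H E. rewrite <- E. exact H. Qed.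

Lemma Cderiv_ext_loc (f g : C -> C) (z l : C) :
  (exists d, 0 < d /\ forall w, Cmod (w - z) < d -> f w = g w) ->
  Cderiv f z l -> Cderiv g z l.
Proof.
  intros [d [Hd E]] H e He. destruct (H e He) as [d' [Hd' H']].
  exists (Rmin d d'). split. apply Rmin_pos; assumption.
  intros w Hw.
  assert (Hw1 : Cmod (w - z) < d) by (apply Rlt_le_trans with (1:=Hw); apply Rmin_l).
  assert (Hw2 : Cmod (w - z) < d') by (apply Rlt_le_trans with (1:=Hw); apply Rmin_r).
  rewrite <- (E w Hw1), <- (E z). apply H'; exact Hw2.
  replace (z - z)%C with (RtoC 0) by ring. rewrite Cmod_0. exact Hd.
Qed.

Lemma Cderiv_ext (f g : C -> C) (z l : C) :
  (forall w, f w = g w) -> Cderiv f z l -> Cderiv g z l.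
Proof.
  intros E. apply Cderiv_ext_loc. exists 1. split; [lra|]. intros; apply E.
Qed.

Lemma Cderiv_plus (f g : C -> C) (z a b : C) :
  Cderiv f z a -> Cderiv g z b -> Cderiv (fun w => f w + g w)%C z (a + b)%C.
Proof.
  intros Hf Hg e He.
  destruct (Hf (e/2) ltac:(lra)) as [d1 [H1 F]].
  destruct (Hg (e/2) ltac:(lra)) as [d2 [H2 G]].
  exists (Rmin d1 d2). split. apply Rmin_pos; assumption.
  intros w Hw.
  assert (Hw1 : Cmod (w - z) < d1) by (apply Rlt_le_trans with (1:=Hw); apply Rmin_l).
  assert (Hw2 : Cmod (w - z) < d2) by (apply Rlt_le_trans with (1:=Hw); apply Rmin_r).
  specialize (F w Hw1). specialize (G w Hw2).
  replace (f w + g w - (f z + g z) - (a + b) * (w - z))%C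
    with ((f w - f z - a * (w - z)) + (g w - g z - b * (w - z)))%C by ring.
  eapply Rle_trans. apply Cmod_triangle. lra.
Qed.

Lemma Cderiv_cont_loc (f : C -> C) (z l : C) : Cderiv f z l ->
  exists d K, 0 < d /\ 0 < K /\ forall w, Cmod (w - z) < d -> Cmod (f w - f z) <= K * Cmod (w - z).
Proof.
  intros H. destruct (H 1 Rlt_0_1) as [d [Hd H']].
  exists d, (Cmod l + 1). split; [exact Hd|].
  assert (H0 := Cmod_ge_0 l). split; [lra|].
  intros w Hw. specialize (H' w Hw).
  replace (f w - f z)%C with ((f w - f z - l * (w - z)) + l * (w - z))%C by ring.
  eapply Rle_trans. apply Cmod_triangle. rewrite (Cmod_mult l). lra.
Qed.

Lemma Cderiv_comp (f g : C -> C) (z a b : C) :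
  Cderiv g z a -> Cderiv f (g z) b -> Cderiv (fun w => f (g w)) z (b * a)%C.
Proof.
  intros Hg Hf e He.
  destruct (Cderiv_cont_loc g z a Hg) as [d0 [K [Hd0 [HK Hc]]]].
  assert (Hb := Cmod_ge_0 b).
  assert (HeK : 0 < e / (2 * K)) by (apply Rdiv_lt_0_compat; lra).
  assert (Heb : 0 < e / (2 * (Cmod b + 1))) by (apply Rdiv_lt_0_compat; lra).
  destruct (Hf _ HeK) as [d1 [Hd1 F]].
  destruct (Hg _ Heb) as [d2 [Hd2 G]].
  exists (Rmin d0 (Rmin d2 (d1 / K))).
  assert (Hd1K : 0 < d1 / K) by (apply Rdiv_lt_0_compat; lra).
  split. repeat apply Rmin_pos; assumption.
  intros w Hw.
  assert (M1 := Rmin_l d0 (Rmin d2 (d1 / K))).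
  assert (M2 := Rmin_r d0 (Rmin d2 (d1 / K))).
  assert (M3 := Rmin_l d2 (d1 / K)). assert (M4 := Rmin_r d2 (d1 / K)).
  specialize (Hc w ltac:(lra)). specialize (G w ltac:(lra)).
  assert (Hgw : Cmod (g w - g z) < d1).
  { apply Rle_lt_trans with (1 := Hc).
    replace d1 with (K * (d1 / K)) by (field; lra).
    apply Rmult_lt_compat_l; lra. }
  specialize (F _ Hgw).
  replace (f (g w) - f (g z) - b * a * (w - z))%C
    with ((f (g w) - f (g z) - b * (g w - g z)) + b * (g w - g z - a * (w - z)))%C by ring.
  eapply Rle_trans. apply Cmod_triangle. rewrite Cmod_mult.
  assert (Hn := Cmod_ge_0 (w - z)).
  assert (P1 : e / (2 * K) * Cmod (g w - g z) <= e / 2 * Cmod (w - z)).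
  { apply Rle_trans with (e / (2 * K) * (K * Cmod (w - z))).
    apply Rmult_le_compat_l; lra. right. field. lra. }
  assert (P2 : Cmod b * Cmod (g w - g z - a * (w - z)) <= e / 2 * Cmod (w - z)).
  { apply Rle_trans with ((Cmod b + 1) * (e / (2 * (Cmod b + 1)) * Cmod (w - z))).
    apply Rmult_le_compat; try lra. apply Cmod_ge_0. right. field. lra. }
  lra.
Qed.

Lemma Cderiv_mult (f g : C -> C) (z a b : C) :
  Cderiv f z a -> Cderiv g z b -> Cderiv (fun w => f w * g w)%C z (a * g z + f z * b)%C.
Proof.
  intros Hf Hg e He.
  destruct (Cderiv_cont_loc g z b Hg) as [d0 [K [Hd0 [HK Hc]]]].
  assert (Ha := Cmod_ge_0 a). assert (Hz := Cmod_ge_0 (f z)). assert (Hgz := Cmod_ge_0 (g z)).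
  assert (E1 : 0 < e / 3 / (Cmod (g z) + 1)) by (apply Rdiv_lt_0_compat; lra).
  assert (E2 : 0 < e / 3 / (Cmod (f z) + 1)) by (apply Rdiv_lt_0_compat; lra).
  destruct (Cderiv_cont_loc f z a Hf) as [d3 [K' [Hd3 [HK' Hc']]]].
  destruct (Hf _ E1) as [d1 [Hd1 F]].
  destruct (Hg _ E2) as [d2 [Hd2 G]].
  assert (E3 : 0 < e / 3 / (K * K')).
  { apply Rdiv_lt_0_compat; [lra|]. apply Rmult_lt_0_compat; lra. }
  exists (Rmin (Rmin d0 d3) (Rmin (e / 3 / (K * K')) (Rmin d1 d2))).
  split. repeat apply Rmin_pos; assumption.
  intros w Hw.
  assert (M1 := Rmin_l (Rmin d0 d3) (Rmin (e / 3 / (K * K')) (Rmin d1 d2))).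
  assert (M2 := Rmin_r (Rmin d0 d3) (Rmin (e / 3 / (K * K')) (Rmin d1 d2))).
  assert (M3 := Rmin_l d0 d3). assert (M4 := Rmin_r d0 d3).
  assert (M5 := Rmin_l (e / 3 / (K * K')) (Rmin d1 d2)).
  assert (M6 := Rmin_r (e / 3 / (K * K')) (Rmin d1 d2)).
  assert (M7 := Rmin_l d1 d2). assert (M8 := Rmin_r d1 d2).
  specialize (Hc w ltac:(lra)). specialize (Hc' w ltac:(lra)).
  specialize (F w ltac:(lra)). specialize (G w ltac:(lra)).
  replace (f w * g w - f z * g z - (a * g z + f z * b) * (w - z))%C
    with (((f w - f z - a * (w - z)) * g z + f z * (g w - g z - b * (w - z)))
          + (f w - f z) * (g w - g z))%C by ring.
  eapply Rle_trans. apply Cmod_triangle.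
  assert (T := Cmod_triangle ((f w - f z - a * (w - z)) * g z) (f z * (g w - g z - b * (w - z)))).
  rewrite !Cmod_mult in T. rewrite Cmod_mult.
  assert (Hn := Cmod_ge_0 (w - z)).
  assert (P1 : Cmod (f w - f z - a * (w - z)) * Cmod (g z) <= e / 3 * Cmod (w - z)).
  { apply Rle_trans with ((e / 3 / (Cmod (g z) + 1) * Cmod (w - z)) * (Cmod (g z) + 1)).
    apply Rmult_le_compat; try lra. apply Cmod_ge_0. right; field; lra. }
  assert (P2 : Cmod (f z) * Cmod (g w - g z - b * (w - z)) <= e / 3 * Cmod (w - z)).
  { apply Rle_trans with ((Cmod (f z) + 1) * (e / 3 / (Cmod (f z) + 1) * Cmod (w - z))).
    apply Rmult_le_compat; try lra. apply Cmod_ge_0. right; field; lra. }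
  assert (P3 : Cmod (f w - f z) * Cmod (g w - g z) <= e / 3 * Cmod (w - z)).
  { apply Rle_trans with ((K' * Cmod (w - z)) * (K * Cmod (w - z))).
    apply Rmult_le_compat; try lra; apply Cmod_ge_0.
    replace (K' * Cmod (w - z) * (K * Cmod (w - z)))
      with ((K * K' * Cmod (w - z)) * Cmod (w - z)) by ring.
    apply Rmult_le_compat_r; [lra|].
    apply Rle_trans with (K * K' * (e / 3 / (K * K'))).
    apply Rmult_le_compat_l; [|lra]. apply Rmult_le_pos; lra.
    right; field; lra. }
  lra.
Qed.

Lemma Cderiv_opp (f : C -> C) (z a : C) :
  Cderiv f z a -> Cderiv (fun w => - f w)%C z (- a)%C.
Proof.
  intros H. apply Cderiv_ext with (fun w => (- (1)) * f w)%C. intros; ring.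
  eapply Cderiv_eq. apply (Cderiv_mult (fun _ => - (1))%C f). apply Cderiv_const. exact H. ring.
Qed.

Lemma Cderiv_minus (f g : C -> C) (z a b : C) :
  Cderiv f z a -> Cderiv g z b -> Cderiv (fun w => f w - g w)%C z (a - b)%C.
Proof. intros Hf Hg. apply (Cderiv_plus f (fun w => - g w)%C). exact Hf. apply Cderiv_opp, Hg. Qed.

Lemma Cderiv_scal (c : C) (f : C -> C) (z a : C) :
  Cderiv f z a -> Cderiv (fun w => c * f w)%C z (c * a)%C.
Proof.
  intros H. eapply Cderiv_eq. apply (Cderiv_mult (fun _ => c) f). apply Cderiv_const. exact H. ring.
Qed.

Lemma Cmod_minus_le (a b : C) : Cmod a - Cmod b <= Cmod (a - b).
Proof.
  assert (H := Cmod_triangle (a - b) b).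
  replace (a - b + b)%C with a in H by ring. lra.
Qed.

Lemma Cmod_neq_0 (z : C) : 0 < Cmod z -> z <> 0.
Proof. intros H E. rewrite E, Cmod_0 in H. lra. Qed.

Lemma Cderiv_inv_id (z : C) : z <> 0 -> Cderiv (fun w => / w)%C z (- / (z * z))%C.
Proof.
  intros Hz e He. assert (Hm : 0 < Cmod z) by (apply Cmod_gt_0; exact Hz).
  set (m := Cmod z) in *.
  exists (Rmin (m / 2) (e * (m * m * m) / 2)).
  assert (Hm3 : 0 < m * m * m) by (repeat apply Rmult_lt_0_compat; lra).
  split. apply Rmin_pos; [lra|]. apply Rdiv_lt_0_compat; [|lra]. apply Rmult_lt_0_compat; lra.
  intros w Hw.
  assert (M1 := Rmin_l (m / 2) (e * (m * m * m) / 2)).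
  assert (M2 := Rmin_r (m / 2) (e * (m * m * m) / 2)).
  assert (Hmw : m / 2 < Cmod w).
  { assert (H := Cmod_minus_le z w). fold m in H.
    replace (z - w)%C with (- (w - z))%C in H by ring. rewrite Cmod_opp in H. lra. }
  assert (Hw0 : w <> 0) by (apply Cmod_neq_0; lra).
  replace (/ w - / z - - / (z * z) * (w - z))%C with ((w - z) * (w - z) * (/ (w * (z * z))))%C
    by (field; split; assumption).
  rewrite !Cmod_mult, Cmod_inv, !Cmod_mult. fold m.
  2:{ apply Cmult_neq_0. exact Hw0. apply Cmult_neq_0; exact Hz. }
  assert (Hn := Cmod_ge_0 (w - z)).
  replace (Cmod (w - z) * Cmod (w - z) * / (Cmod w * (m * m)))
    with ((Cmod (w - z) * / (Cmod w * (m * m))) * Cmod (w - z)) by ring.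
  apply Rmult_le_compat_r; [exact Hn|].
  apply (Rmult_le_reg_r (Cmod w * (m * m))).
  apply Rmult_lt_0_compat; nra.
  rewrite Rmult_assoc, Rinv_l. 2:{ apply Rgt_not_eq. apply Rmult_lt_0_compat; nra. }
  assert (e * (m * m * m) / 2 <= e * (Cmod w * (m * m))). 
  { replace (e * (m * m * m) / 2) with (e * ((m/2) * (m * m))) by field.
    apply Rmult_le_compat_l; [lra|]. apply Rmult_le_compat_r; nra. }
  lra.
Qed.

Lemma Cderiv_inv (f : C -> C) (z a : C) : f z <> 0 -> Cderiv f z a ->
  Cderiv (fun w => / f w)%C z (- a / (f z * f z))%C.
Proof.
  intros Hz Hf. eapply Cderiv_eq.
  apply (Cderiv_comp (fun w => / w)%C f). exact Hf. apply Cderiv_inv_id, Hz.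
  field. exact Hz.
Qed.

Lemma Cderiv_div (f g : C -> C) (z a b : C) : g z <> 0 -> Cderiv f z a -> Cderiv g z b ->
  Cderiv (fun w => f w / g w)%C z ((a * g z - f z * b) / (g z * g z))%C.
Proof.
  intros Hz Hf Hg. eapply Cderiv_eq.
  apply (Cderiv_mult f (fun w => / g w)%C). exact Hf. apply Cderiv_inv. exact Hz. exact Hg.
  field. exact Hz.
Qed.

Lemma Cderiv_pow (f : C -> C) (z a : C) (n : nat) : Cderiv f z a ->
  exists l, Cderiv (fun w => f w ^ n)%C z l.
Proof.
  intros Hf. induction n as [|n [l IH]].
  - exists 0. apply (Cderiv_const 1).
  - eexists. apply (Cderiv_mult f (fun w => f w ^ n)%C). exact Hf. exact IH.
Qed.

Definition Chol (f : C -> C) (z : C) : Prop := exists l, Cderiv f z l.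

Lemma ex_derive_Chol (f : C -> C) (z : C) :
  @ex_derive C_AbsRing C_NormedModule f z <-> Chol f z.
Proof.
  split; intros [l H]; exists l; apply is_derive_Cderiv; exact H.
Qed.

Definition Ccont (f : C -> C) (z : C) : Prop :=
  forall e, 0 < e -> exists d, 0 < d /\ forall w, Cmod (w - z) < d -> Cmod (f w - f z) < e.

Lemma Chol_cont (f : C -> C) (z : C) : Chol f z -> Ccont f z.
Proof.
  intros [l H] e He. destruct (Cderiv_cont_loc f z l H) as [d [K [Hd [HK Hc]]]].
  exists (Rmin d (e / K)). assert (0 < e / K) by (apply Rdiv_lt_0_compat; lra).
  split. apply Rmin_pos; lra. intros w Hw.
  assert (M1 := Rmin_l d (e/K)). assert (M2 := Rmin_r d (e/K)).
  apply Rle_lt_trans with (K * Cmod (w - z)). apply Hc; lra.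
  replace e with (K * (e / K)) by (field; lra). apply Rmult_lt_compat_l; lra.
Qed.

Lemma Cmod_le_abs (x y : R) : Cmod (x, y) <= Rabs x + Rabs y.
Proof.
  replace (x, y) with (RtoC x + Ci * RtoC y)%C.
  eapply Rle_trans. apply Cmod_triangle. rewrite Cmod_mult, Cmod_Ci, !Cmod_R. lra.
  unfold RtoC, Ci, Cplus, Cmult; simpl. f_equal; ring.
Qed.

Lemma Im_le_Cmod (c : C) : Rabs (Im c) <= Cmod c.
Proof. eapply Rle_trans. 2: apply Rmax_Cmod. apply Rmax_r. Qed.

Lemma Cexp_plus (a b : C) : Cexp (a + b) = (Cexp a * Cexp b)%C.
Proof.
  unfold Cexp, Cmult. destruct a as [a1 a2], b as [b1 b2]. simpl.
  rewrite exp_plus, cos_plus, sin_plus. f_equal; ring.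
Qed.

Lemma Cexp_0 : Cexp 0 = 1.
Proof. unfold Cexp. simpl. rewrite exp_0, cos_0, sin_0. unfold RtoC. f_equal; ring. Qed.

Lemma Cmod_Cexp (z : C) : Cmod (Cexp z) = exp (Re z).
Proof.
  unfold Cexp, Cmod. simpl.
  replace (exp (Re z) * cos (Im z) * (exp (Re z) * cos (Im z) * 1) +
   exp (Re z) * sin (Im z) * (exp (Re z) * sin (Im z) * 1))
   with (Rsqr (exp (Re z)) * (Rsqr (sin (Im z)) + Rsqr (cos (Im z)))) by (unfold Rsqr; ring).
  rewrite sin2_cos2, Rmult_1_r. apply sqrt_Rsqr. left. apply exp_pos.
Qed.

Lemma Cexp_neq_0 (z : C) : Cexp z <> 0.
Proof. apply Cmod_neq_0. rewrite Cmod_Cexp. apply exp_pos. Qed.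

Lemma Cexp_opp (z : C) : Cexp (- z) = (/ Cexp z)%C.
Proof.
  assert (H := Cexp_plus z (- z)). replace (z + - z)%C with (RtoC 0) in H by ring.
  rewrite Cexp_0 in H.
  rewrite <- (Cmult_1_l (/ Cexp z)), H. field. apply Cexp_neq_0.
Qed.

(** The error splits into the real first-order errors of exp, cos and sin at 0 and the products of
    small factors. With exp x <= 3 the five pieces add up to 9 e / 24. *)
Lemma Cderiv_Cexp_0 : Cderiv Cexp 0 1.
Proof.
  intros e He.
  assert (Dexp := derivable_pt_lim_exp 0). assert (Dcos := derivable_pt_lim_cos 0).
  assert (Dsin := derivable_pt_lim_sin 0).
  rewrite exp_0 in Dexp. rewrite cos_0 in Dsin. rewrite sin_0 in Dcos.
  destruct (Dexp (e/24) ltac:(lra)) as [d1 H1].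
  destruct (Dcos (e/24) ltac:(lra)) as [d2 H2].
  destruct (Dsin (e/24) ltac:(lra)) as [d3 H3].
  set (m := Rmin (Rmin (Rmin d1 d2) d3) (Rmin 1 (e/24))).
  assert (Hm1 : m <= d1) by (unfold m; eapply Rle_trans; [apply Rmin_l|]; eapply Rle_trans; [apply Rmin_l|]; apply Rmin_l).
  assert (Hm2 : m <= d2) by (unfold m; eapply Rle_trans; [apply Rmin_l|]; eapply Rle_trans; [apply Rmin_l|]; apply Rmin_r).
  assert (Hm3 : m <= d3) by (unfold m; eapply Rle_trans; [apply Rmin_l|]; apply Rmin_r).
  assert (Hm4 : m <= 1) by (unfold m; eapply Rle_trans; [apply Rmin_r|]; apply Rmin_l).
  assert (Hm5 : m <= e/24) by (unfold m; eapply Rle_trans; [apply Rmin_r|]; apply Rmin_r).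
  assert (Hm : 0 < m).
  { unfold m. repeat apply Rmin_pos; try apply cond_pos; lra. }
  exists m. split; [exact Hm|]. intros w Hw.
  replace (w - 0)%C with w in * by ring. rewrite Cexp_0.
  destruct w as [x y]. set (n := Cmod (x, y)) in *.
  assert (Hx : Rabs x <= n) by apply (re_le_Cmod (x, y)).
  assert (Hy : Rabs y <= n) by apply (Im_le_Cmod (x, y)).
  assert (Hn : 0 <= n) by apply Cmod_ge_0.
  assert (E : Rabs (exp x - 1 - x) <= e / 24 * Rabs x).
  { destruct (Req_dec x 0) as [->|Hx0]. rewrite exp_0. replace (1 - 1 - 0) with 0 by ring.
    rewrite Rabs_R0. lra.
    specialize (H1 x Hx0 ltac:(lra)). rewrite Rplus_0_l, exp_0 in H1.
    replace (exp x - 1 - x) with (((exp x - 1) / x - 1) * x) by (field; exact Hx0).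
    rewrite Rabs_mult. apply Rmult_le_compat_r. apply Rabs_pos. lra. }
  assert (Cc : Rabs (cos y - 1) <= e / 24 * Rabs y).
  { destruct (Req_dec y 0) as [->|Hx0]. rewrite cos_0. replace (1 - 1) with 0 by ring.
    rewrite Rabs_R0. lra.
    specialize (H2 y Hx0 ltac:(lra)). rewrite Rplus_0_l, cos_0 in H2.
    replace (cos y - 1) with (((cos y - 1) / y - - 0) * y) by (field; exact Hx0).
    rewrite Rabs_mult. apply Rmult_le_compat_r. apply Rabs_pos. lra. }
  assert (S : Rabs (sin y - y) <= e / 24 * Rabs y).
  { destruct (Req_dec y 0) as [->|Hx0]. rewrite sin_0. replace (0 - 0) with 0 by ring.
    rewrite Rabs_R0. lra.
    specialize (H3 y Hx0 ltac:(lra)). rewrite Rplus_0_l, sin_0 in H3.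
    replace (sin y - y) with (((sin y - 0) / y - 1) * y) by (field; exact Hx0).
    rewrite Rabs_mult. apply Rmult_le_compat_r. apply Rabs_pos. lra. }
  assert (Ex : exp x <= 3).
  { apply Rle_trans with (exp 1). 2: apply exp_le_3.
    assert (x <= 1) by (apply Rle_trans with (1 := Rle_abs x); lra).
    destruct H; [left; apply exp_increasing; exact H | rewrite H; lra]. }
  assert (Ep := exp_pos x).
  replace (Cexp (x, y) - 1 - 1 * (x, y))%C
    with (exp x * (cos y - 1) + (exp x - 1 - x), exp x * (sin y - y) + (exp x - 1 - x) * y + x * y)%R.
  2:{ unfold Cexp, Cminus, Cplus, Copp, Cmult, RtoC; simpl. f_equal; ring. }
  eapply Rle_trans. apply Cmod_le_abs.
  assert (T1 := Rabs_triang (exp x * (cos y - 1)) (exp x - 1 - x)).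
  assert (T2 := Rabs_triang (exp x * (sin y - y) + (exp x - 1 - x) * y) (x * y)).
  assert (T3 := Rabs_triang (exp x * (sin y - y)) ((exp x - 1 - x) * y)).
  rewrite !Rabs_mult in *. rewrite (Rabs_pos_eq (exp x)) in * by lra.
  assert (Q1 := Rabs_pos x). assert (Q2 := Rabs_pos y).
  assert (Q3 := Rabs_pos (cos y - 1)). assert (Q4 := Rabs_pos (sin y - y)).
  assert (Q5 := Rabs_pos (exp x - 1 - x)).
  assert (U1 : exp x * Rabs (cos y - 1) <= 3 * (e / 24 * n)).
  { apply Rmult_le_compat; try lra. apply Rle_trans with (1 := Cc). apply Rmult_le_compat_l; lra. }
  assert (U2 : exp x * Rabs (sin y - y) <= 3 * (e / 24 * n)).
  { apply Rmult_le_compat; try lra. apply Rle_trans with (1 := S). apply Rmult_le_compat_l; lra. }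
  assert (U3 : Rabs (exp x - 1 - x) <= e / 24 * n).
  { apply Rle_trans with (1 := E). apply Rmult_le_compat_l; lra. }
  assert (U4 : Rabs (exp x - 1 - x) * Rabs y <= e / 24 * n * 1).
  { apply Rmult_le_compat; lra. }
  assert (U5 : Rabs x * Rabs y <= e / 24 * n). 
  { rewrite Rmult_comm. apply Rmult_le_compat; lra. }
  lra.
Qed.

Lemma Cderiv_Cexp (z : C) : Cderiv Cexp z (Cexp z).
Proof.
  apply Cderiv_ext with (fun w => Cexp z * Cexp (w - z))%C.
  { intros w. rewrite <- Cexp_plus. f_equal. ring. }
  eapply Cderiv_eq. apply Cderiv_scal.
  apply (Cderiv_comp Cexp (fun w => w - z)%C z 1 1).
  eapply Cderiv_eq. apply Cderiv_minus. apply Cderiv_id. apply (Cderiv_const z). ring.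
  replace (z - z)%C with (RtoC 0) by ring. apply Cderiv_Cexp_0. ring.
Qed.

Lemma Cderiv_exp (f : C -> C) (z a : C) : Cderiv f z a ->
  Cderiv (fun w => Cexp (f w)) z (Cexp (f z) * a)%C.
Proof. intros H. apply (Cderiv_comp Cexp f). exact H. apply Cderiv_Cexp. Qed.

Lemma Chol_const (c z : C) : Chol (fun _ => c) z.
Proof. eexists; apply Cderiv_const. Qed.
Lemma Chol_id (z : C) : Chol (fun w => w) z.
Proof. eexists; apply Cderiv_id. Qed.
Lemma Chol_plus (f g : C -> C) (z : C) : Chol f z -> Chol g z -> Chol (fun w => f w + g w)%C z.
Proof. intros [a H] [b K]; eexists; apply Cderiv_plus; eassumption. Qed.
Lemma Chol_minus (f g : C -> C) (z : C) : Chol f z -> Chol g z -> Chol (fun w => f w - g w)%C z.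
Proof. intros [a H] [b K]; eexists; apply Cderiv_minus; eassumption. Qed.
Lemma Chol_opp (f : C -> C) (z : C) : Chol f z -> Chol (fun w => - f w)%C z.
Proof. intros [a H]; eexists; apply Cderiv_opp; eassumption. Qed.
Lemma Chol_mult (f g : C -> C) (z : C) : Chol f z -> Chol g z -> Chol (fun w => f w * g w)%C z.
Proof. intros [a H] [b K]; eexists; apply Cderiv_mult; eassumption. Qed.
Lemma Chol_div (f g : C -> C) (z : C) : g z <> 0 -> Chol f z -> Chol g z -> Chol (fun w => f w / g w)%C z.
Proof. intros N [a H] [b K]. eexists. exact (Cderiv_div f g z a b N H K). Qed.
Lemma Chol_pow (f : C -> C) (n : nat) (z : C) : Chol f z -> Chol (fun w => f w ^ n)%C z.
Proof. intros [a H]. destruct (Cderiv_pow f z a n H) as [l Hl]. exists l. exact Hl. Qed.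
Lemma Chol_comp (f g : C -> C) (z : C) : Chol g z -> Chol f (g z) -> Chol (fun w => f (g w)) z.
Proof. intros [a H] [b K]. eexists. exact (Cderiv_comp f g z _ _ H K). Qed.
Lemma Chol_Cexp (z : C) : Chol Cexp z.
Proof. eexists; apply Cderiv_Cexp. Qed.
Lemma Chol_exp (f : C -> C) (z : C) : Chol f z -> Chol (fun w => Cexp (f w)) z.
Proof. intros H. apply (Chol_comp Cexp f). exact H. apply Chol_Cexp. Qed.

Lemma exp_le (x y : R) : x <= y -> exp x <= exp y.
Proof. intros [H| ->]. left; apply exp_increasing; exact H. right; reflexivity. Qed.

(** * Goursat's theorem on rectangles *)

Lemma Ccont_line (f : C -> C) (g : R -> C) (x : R) :
  (forall y, Cmod (g y - g x) <= Rabs (y - x)) -> Ccont f (g x) ->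
  continuous (fun y => Re (f (g y))) x /\ continuous (fun y => Im (f (g y))) x.
Proof.
  intros Hg Hf.
  split; apply (proj2 (filterlim_locally _ _)); intros e;
  destruct (Hf e (cond_pos e)) as [d [Hd H]];
  exists (mkposreal d Hd); intros y Hy;
  change (Rabs (y - x) < d) in Hy;
  (assert (K : Cmod (g y - g x) < d) by (eapply Rle_lt_trans; [apply Hg | exact Hy]));
  specialize (H _ K).
  - change (Rabs (Re (f (g y)) - Re (f (g x))) < e).
    eapply Rle_lt_trans. 2: exact H. apply (re_le_Cmod (f (g y) - f (g x))).
  - change (Rabs (Im (f (g y)) - Im (f (g x))) < e).
    eapply Rle_lt_trans. 2: exact H. apply (Im_le_Cmod (f (g y) - f (g x))).
Qed.

Lemma Cmod_hor (x x' y : R) : Cmod ((x', y) - (x, y))%C <= Rabs (x' - x).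
Proof.
  replace ((x', y) - (x, y))%C with (RtoC (x' - x)). rewrite Cmod_R; lra.
  unfold RtoC, Cminus, Cplus, Copp; simpl; f_equal; ring.
Qed.

Lemma Cmod_ver (x y y' : R) : Cmod ((x, y') - (x, y))%C <= Rabs (y' - y).
Proof.
  replace ((x, y') - (x, y))%C with (Ci * RtoC (y' - y))%C.
  rewrite Cmod_mult, Cmod_Ci, Cmod_R; lra.
  unfold RtoC, Ci, Cmult, Cminus, Cplus, Copp; simpl; f_equal; ring.
Qed.

(** On a horizontal side dz = dx and on a vertical side dz = i dy, so the real part of f dz is Re f
    dx on the former and - Im f dy on the latter. *)
Definition Hor (f : C -> C) (a b y : R) := RInt (fun x => Re (f (x, y))) a b.
Definition Ver (f : C -> C) (c d x : R) := RInt (fun y => Im (f (x, y))) c d.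

Definition box (a b c d : R) (z : C) : Prop := a <= Re z <= b /\ c <= Im z <= d.

Lemma ex_Hor (f : C -> C) (a b y : R) : a <= b ->
  (forall x, a <= x <= b -> Ccont f (x, y)) -> ex_RInt (fun x => Re (f (x, y))) a b.
Proof.
  intros Hab H. apply (@ex_RInt_continuous R_CompleteNormedModule).
  rewrite Rmin_left, Rmax_right by exact Hab. intros x Hx.
  apply (Ccont_line f (fun x => (x, y))). intros; apply Cmod_hor. apply H, Hx.
Qed.

Lemma ex_Ver (f : C -> C) (c d x : R) : c <= d ->
  (forall y, c <= y <= d -> Ccont f (x, y)) -> ex_RInt (fun y => Im (f (x, y))) c d.
Proof.
  intros Hab H. apply (@ex_RInt_continuous R_CompleteNormedModule).
  rewrite Rmin_left, Rmax_right by exact Hab. intros y Hy.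
  apply (Ccont_line f (fun y => (x, y))). intros; apply Cmod_ver. apply H, Hy.
Qed.

(* The real part of the contour integral of f around the rectangle. *)
Definition bdry (f : C -> C) (a b c d : R) : R :=
  Hor f a b c - Hor f a b d - Ver f c d b + Ver f c d a.

Lemma bdry_quarter (f : C -> C) (a b c d m n : R) :
  a <= m <= b -> c <= n <= d -> (forall z, box a b c d z -> Ccont f z) ->
  bdry f a b c d = bdry f a m c n + bdry f m b c n + bdry f a m n d + bdry f m b n d.
Proof.
  intros Hm Hn Hf.
  assert (EH : forall y, c <= y <= d -> Hor f a b y = Hor f a m y + Hor f m b y).
  { intros y Hy. unfold Hor. symmetry. apply (@RInt_Chasles R_CompleteNormedModule);
    (apply ex_Hor; [lra|]; intros x Hx; apply Hf; split; simpl; lra). }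
  assert (EV : forall x, a <= x <= b -> Ver f c d x = Ver f c n x + Ver f n d x).
  { intros x Hx. unfold Ver. symmetry. apply (@RInt_Chasles R_CompleteNormedModule);
    (apply ex_Ver; [lra|]; intros y Hy; apply Hf; split; simpl; lra). }
  unfold bdry. rewrite !EH, !EV by lra. ring.
Qed.

Lemma RInt_near_const (f : R -> R) (a b k e : R) : a <= b -> ex_RInt f a b ->
  (forall x, a <= x <= b -> Rabs (f x - k) <= e) -> Rabs (RInt f a b - k * (b - a)) <= e * (b - a).
Proof.
  intros Hab Hf H.
  assert (E : RInt (fun x => f x - k) a b = RInt f a b - k * (b - a)).
  { transitivity (RInt f a b - RInt (fun _ => k) a b).
    apply (@RInt_minus R_CompleteNormedModule). exact Hf. apply ex_RInt_const.
    rewrite RInt_const. unfold scal; simpl; unfold mult; simpl. ring. }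
  rewrite <- E. rewrite (Rmult_comm e). apply abs_RInt_le_const; try assumption.
  apply (@ex_RInt_minus R_NormedModule). exact Hf. apply ex_RInt_const.
Qed.

(** The affine function f z + l (w - z) has boundary integral 0: each pair of opposite sides
    contributes q (b - a) (d - c) with q = Im l, and the two contributions have opposite signs. Only
    the remainder, at most e times the half perimeter, is left on the four sides. *)
Lemma bdry_small (f : C -> C) (a b c d e : R) (z l : C) :
  0 <= e -> box a b c d z -> (forall w, box a b c d w -> Ccont f w) ->
  (forall w, box a b c d w -> Cmod (f w - f z - l * (w - z))%C <= e * Cmod (w - z)) ->
  Rabs (bdry f a b c d) <= 2 * e * (b - a + (d - c)) ^ 2.
Proof.
  intros He Hz Hc H.
  destruct z as [x0 y0]. destruct l as [p q]. destruct Hz as [Hz1 Hz2]. simpl in Hz1, Hz2.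
  set (s := b - a + (d - c)).
  assert (Hs : forall w, box a b c d w -> e * Cmod (w - (x0, y0)) <= e * s).
  { intros [x y] [Hx Hy]. simpl in Hx, Hy. apply Rmult_le_compat_l. exact He.
    change ((x, y) - (x0, y0))%C with (x - x0, y - y0).
    eapply Rle_trans. apply Cmod_le_abs. unfold s.
    assert (Rabs (x - x0) <= b - a) by (apply Rabs_le; lra).
    assert (Rabs (y - y0) <= d - c) by (apply Rabs_le; lra). lra. }
  assert (H1 : Rabs (Hor f a b c - Hor f a b d - q * (d - c) * (b - a)) <= 2 * e * s * (b - a)).
  { unfold Hor.
    assert (E1 : ex_RInt (fun x => Re (f (x, c))) a b).
    { apply ex_Hor. lra. intros x Hx. apply Hc. split; simpl; lra. }
    assert (E2 : ex_RInt (fun x => Re (f (x, d))) a b).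
    { apply ex_Hor. lra. intros x Hx. apply Hc. split; simpl; lra. }
    assert (E := @RInt_minus R_CompleteNormedModule _ _ a b E1 E2).
    change (minus (RInt (fun x => Re (f (x, c))) a b) (RInt (fun x => Re (f (x, d))) a b)) with
      (RInt (fun x => Re (f (x, c))) a b - RInt (fun x => Re (f (x, d))) a b) in E.
    rewrite <- E. apply RInt_near_const. lra.
    apply (@ex_RInt_minus R_NormedModule); assumption.
    intros x Hx.
    assert (B1 : box a b c d (x, c)) by (split; simpl; lra).
    assert (B2 : box a b c d (x, d)) by (split; simpl; lra).
    assert (G1 := Rle_trans _ _ _ (re_le_Cmod _) (Rle_trans _ _ _ (H _ B1) (Hs _ B1))).
    assert (G2 := Rle_trans _ _ _ (re_le_Cmod _) (Rle_trans _ _ _ (H _ B2) (Hs _ B2))).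
    change (Rabs (Re (f (x, c)) - Re (f (x, d)) - q * (d - c)) <= 2 * e * s).
    unfold Cminus, Cmult, Cplus, Copp, Re in G1, G2. simpl in G1, G2.
    unfold Re. 
    apply Rabs_le_between in G1. apply Rabs_le_between in G2. apply Rabs_le. lra. }
  assert (H2 : Rabs (Ver f c d b - Ver f c d a - q * (b - a) * (d - c)) <= 2 * e * s * (d - c)).
  { unfold Ver.
    assert (E1 : ex_RInt (fun x => Im (f (b, x))) c d).
    { apply ex_Ver. lra. intros x Hx. apply Hc. split; simpl; lra. }
    assert (E2 : ex_RInt (fun x => Im (f (a, x))) c d).
    { apply ex_Ver. lra. intros x Hx. apply Hc. split; simpl; lra. }
    assert (E := @RInt_minus R_CompleteNormedModule _ _ c d E1 E2).
    change (minus (RInt (fun x => Im (f (b, x))) c d) (RInt (fun x => Im (f (a, x))) c d)) with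
      (RInt (fun x => Im (f (b, x))) c d - RInt (fun x => Im (f (a, x))) c d) in E.
    rewrite <- E. apply RInt_near_const. lra.
    apply (@ex_RInt_minus R_NormedModule); assumption.
    intros x Hx.
    assert (B1 : box a b c d (b, x)) by (split; simpl; lra).
    assert (B2 : box a b c d (a, x)) by (split; simpl; lra).
    assert (G1 := Rle_trans _ _ _ (Im_le_Cmod _) (Rle_trans _ _ _ (H _ B1) (Hs _ B1))).
    assert (G2 := Rle_trans _ _ _ (Im_le_Cmod _) (Rle_trans _ _ _ (H _ B2) (Hs _ B2))).
    change (Rabs (Im (f (b, x)) - Im (f (a, x)) - q * (b - a)) <= 2 * e * s).
    unfold Cminus, Cmult, Cplus, Copp, Im in G1, G2. simpl in G1, G2.
    unfold Im. 
    apply Rabs_le_between in G1. apply Rabs_le_between in G2. apply Rabs_le. lra. }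
  unfold bdry. apply Rabs_le_between in H1. apply Rabs_le_between in H2.
  assert (K : 2 * e * s ^ 2 = 2 * e * s * (b - a) + 2 * e * s * (d - c)) by (unfold s; ring).
  rewrite K. apply Rabs_le. lra.
Qed.

Lemma nested_point (a b : nat -> R) :
  (forall n, a n <= a (S n)) -> (forall n, b (S n) <= b n) -> (forall n, a n <= b n) ->
  exists x, forall n, a n <= x <= b n.
Proof.
  intros Ha Hb Hab.
  assert (Ma : forall n k, a n <= a (n + k)%nat).
  { intros n k. induction k. rewrite Nat.add_0_r; lra. rewrite Nat.add_succ_r. eapply Rle_trans; [exact IHk | apply Ha]. }
  assert (Mb : forall n k, b (n + k)%nat <= b n).
  { intros n k. induction k. rewrite Nat.add_0_r; lra. rewrite Nat.add_succ_r. eapply Rle_trans; [apply Hb | exact IHk]. }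
  assert (U : forall n m, a n <= b m).
  { intros n m. apply Rle_trans with (a (n + m)%nat). apply Ma.
    apply Rle_trans with (b (n + m)%nat). apply Hab. rewrite Nat.add_comm. apply Mb. }
  destruct (completeness (fun x => exists n, x = a n)) as [x [Hx1 Hx2]].
  - exists (b 0%nat). intros y [n ->]. apply U.
  - exists (a 0%nat), 0%nat. reflexivity.
  - exists x. intros n. split. apply Hx1. exists n; reflexivity.
    apply Hx2. intros y [m ->]. apply U.
Qed.

Section Bisection.
Variable f : C -> C.

(** The last quarter is taken without a test: if the other three each carry less than a quarter of
    the modulus, the triangle inequality gives it at least that much. *)
Definition qstep (B : (R * R) * (R * R)) : (R * R) * (R * R) :=
  let '((a, b), (c, d)) := B in
  let m := (a + b) / 2 in let n := (c + d) / 2 in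
  let k := Rabs (bdry f a b c d) / 4 in
  if Rle_dec k (Rabs (bdry f a m c n)) then ((a, m), (c, n)) else
  if Rle_dec k (Rabs (bdry f m b c n)) then ((m, b), (c, n)) else
  if Rle_dec k (Rabs (bdry f a m n d)) then ((a, m), (n, d)) else ((m, b), (n, d)).

Definition bJ (B : (R * R) * (R * R)) := bdry f (fst (fst B)) (snd (fst B)) (fst (snd B)) (snd (snd B)).

Definition inbox (B : (R * R) * (R * R)) := box (fst (fst B)) (snd (fst B)) (fst (snd B)) (snd (snd B)).

Definition wf (B : (R * R) * (R * R)) := fst (fst B) <= snd (fst B) /\ fst (snd B) <= snd (snd B).

Lemma qstep_spec (B : (R * R) * (R * R)) : wf B -> (forall z, inbox B z -> Ccont f z) ->
  let B' := qstep B in wf B' /\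
  fst (fst B) <= fst (fst B') /\ snd (fst B') <= snd (fst B) /\
  fst (snd B) <= fst (snd B') /\ snd (snd B') <= snd (snd B) /\
  snd (fst B') - fst (fst B') = (snd (fst B) - fst (fst B)) / 2 /\
  snd (snd B') - fst (snd B') = (snd (snd B) - fst (snd B)) / 2 /\
  Rabs (bJ B) / 4 <= Rabs (bJ B').
Proof.
  destruct B as [[a b] [c d]]. unfold wf, inbox, bJ. simpl. intros [H1 H2] Hf.
  assert (Q := bdry_quarter f a b c d ((a+b)/2) ((c+d)/2) ltac:(lra) ltac:(lra) Hf).
  destruct (Rle_dec _ _) as [K1|K1]; [simpl; repeat split; lra|].
  destruct (Rle_dec _ _) as [K2|K2]; [simpl; repeat split; lra|].
  destruct (Rle_dec _ _) as [K3|K3]; [simpl; repeat split; lra|].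
  simpl. repeat split; try lra.
  rewrite Q in K1, K2, K3 |- *.
  set (u1 := bdry f a ((a + b) / 2) c ((c + d) / 2)) in *.
  set (u2 := bdry f ((a + b) / 2) b c ((c + d) / 2)) in *.
  set (u3 := bdry f a ((a + b) / 2) ((c + d) / 2) d) in *.
  set (u4 := bdry f ((a + b) / 2) b ((c + d) / 2) d) in *.
  assert (T1 := Rabs_triang (u1 + u2 + u3) u4). assert (T2 := Rabs_triang (u1 + u2) u3).
  assert (T3 := Rabs_triang u1 u2). lra.
Qed.

Lemma Goursat (a b c d : R) : a <= b -> c <= d ->
  (forall z, box a b c d z -> Chol f z) -> bdry f a b c d = 0.
Proof.
  intros Hab Hcd Hf.
  assert (Hc : forall z, box a b c d z -> Ccont f z) by (intros z Hz; apply Chol_cont, Hf, Hz).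
  set (B := fix B (n : nat) := match n with O => ((a, b), (c, d)) | S n => qstep (B n) end).
  assert (I : forall n, wf (B n) /\ a <= fst (fst (B n)) /\ snd (fst (B n)) <= b /\
     c <= fst (snd (B n)) /\ snd (snd (B n)) <= d /\
     snd (fst (B n)) - fst (fst (B n)) = (b - a) / 2 ^ n /\
     snd (snd (B n)) - fst (snd (B n)) = (d - c) / 2 ^ n /\
     Rabs (bdry f a b c d) / 4 ^ n <= Rabs (bJ (B n))).
  { induction n as [|n IH].
    - unfold wf, bJ; simpl. repeat split; try lra.
    - destruct IH as [W [A1 [A2 [A3 [A4 [A5 [A6 A7]]]]]]].
      assert (Sp := qstep_spec (B n) W).
      assert (Hn : forall z, inbox (B n) z -> Ccont f z).
      { intros z [Z1 Z2]. apply Hc. split; lra. }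
      specialize (Sp Hn). cbv zeta in Sp. change (qstep (B n)) with (B (S n)) in Sp.
      destruct Sp as [W' [S1 [S2 [S3 [S4 [S5 [S6 S7]]]]]]].
      assert (P2 := pow_lt 2 n ltac:(lra)). assert (P4 := pow_lt 4 n ltac:(lra)).
      split; [exact W'|]. repeat split; try lra.
      rewrite S5, A5. simpl. field. lra.
      rewrite S6, A6. simpl. field. lra.
      replace (Rabs (bdry f a b c d) / 4 ^ S n) with (Rabs (bdry f a b c d) / 4 ^ n / 4).
      lra. simpl; field; lra. }
  assert (St : forall n, fst (fst (B n)) <= fst (fst (B (S n))) /\ snd (fst (B (S n))) <= snd (fst (B n)) /\
     fst (snd (B n)) <= fst (snd (B (S n))) /\ snd (snd (B (S n))) <= snd (snd (B n))).
  { intros n. destruct (I n) as [W [A1 [A2 [A3 [A4 _]]]]].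
    assert (Sp := qstep_spec (B n) W).
    assert (Hn : forall z, inbox (B n) z -> Ccont f z).
    { intros z [Z1 Z2]. apply Hc. split; lra. }
    specialize (Sp Hn). cbv zeta in Sp. change (qstep (B n)) with (B (S n)) in Sp. tauto. }
  destruct (nested_point (fun n => fst (fst (B n))) (fun n => snd (fst (B n)))) as [x Hx];
    try (intros n; apply (St n)). { intros n; apply (I n). }
  destruct (nested_point (fun n => fst (snd (B n))) (fun n => snd (snd (B n)))) as [y Hy];
    try (intros n; apply (St n)). { intros n; apply (I n). }
  destruct (Req_dec (bdry f a b c d) 0) as [E|E]; [exact E|exfalso].
  assert (P : 0 < Rabs (bdry f a b c d)) by (apply Rabs_pos_lt, E).
  destruct (Hf (x, y)) as [l Hl].
  { specialize (Hx 0%nat). specialize (Hy 0%nat). simpl in Hx, Hy. split; assumption. }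
  set (s := b - a + (d - c)).
  assert (Hs : 0 <= s) by (unfold s; lra).
  (* This choice makes 2 e s^2 at most half of the modulus of the boundary integral, while bisection
     forces it to be at least the whole. The added 1 keeps the denominator positive for a degenerate
     rectangle. *)
  set (e := Rabs (bdry f a b c d) / (4 * (s ^ 2 + 1))).
  assert (Hs2 : 0 <= s ^ 2) by (apply pow2_ge_0).
  assert (He : 0 < e) by (apply Rdiv_lt_0_compat; lra).
  destruct (Hl e He) as [dl [Hdl Hd]].
  destruct (pow_lt_1_zero (1/2) ltac:(rewrite Rabs_pos_eq; lra) (dl / (s + 1))) as [n Hn].
  { apply Rdiv_lt_0_compat; lra. }
  specialize (Hn n (Nat.le_refl n)).
  destruct (I n) as [W [A1 [A2 [A3 [A4 [A5 [A6 A7]]]]]]].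
  assert (P2 := pow_lt 2 n ltac:(lra)).
  assert (Q : (1 / 2) ^ n = / 2 ^ n) by (unfold Rdiv; rewrite Rmult_1_l; apply pow_inv).
  rewrite Q in Hn. rewrite Rabs_pos_eq in Hn by (left; apply Rinv_0_lt_compat; exact P2).
  assert (Hsn : s / 2 ^ n < dl).
  { apply Rle_lt_trans with ((s + 1) * / 2 ^ n). 
    unfold Rdiv. apply Rmult_le_compat_r; [left; apply Rinv_0_lt_compat; exact P2|lra].
    apply (Rmult_lt_compat_l (s+1)) in Hn; [|lra].
    replace ((s + 1) * (dl / (s + 1))) with dl in Hn by (field; lra). exact Hn. }
  assert (K := bdry_small f _ _ _ _ e (x, y) l (Rlt_le _ _ He)
     (conj (Hx n) (Hy n) : box (fst (fst (B n))) (snd (fst (B n))) (fst (snd (B n))) (snd (snd (B n))) (x, y))).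
  assert (K' : Rabs (bJ (B n)) <= 2 * e * (s / 2 ^ n) ^ 2).
  { replace (s / 2 ^ n) with (snd (fst (B n)) - fst (fst (B n)) + (snd (snd (B n)) - fst (snd (B n)))).
    apply K.
    - intros w [W1 W2]. apply Hc. split; lra.
    - intros [u v] [W1 W2]. simpl in W1, W2. apply Hd.
      change ((u, v) - (x, y))%C with (u - x, v - y).
      eapply Rle_lt_trans. apply Cmod_le_abs.
      specialize (Hx n). specialize (Hy n).
      assert (R1 : Rabs (u - x) <= (b - a) / 2 ^ n) by (rewrite <- A5; apply Rabs_le; lra).
      assert (R2 : Rabs (v - y) <= (d - c) / 2 ^ n) by (rewrite <- A6; apply Rabs_le; lra).
      eapply Rle_lt_trans. 2: exact Hsn. unfold s. unfold Rdiv in *. lra.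
    - rewrite A5, A6. unfold s, Rdiv. ring. }
  assert (Z : Rabs (bdry f a b c d) / 4 ^ n <= 2 * e * s ^ 2 / 4 ^ n).
  { eapply Rle_trans. exact A7. eapply Rle_trans. exact K'. right.
    replace 4 with (2 * 2) by ring. rewrite Rpow_mult_distr. field. lra. }
  assert (P4 := pow_lt 4 n ltac:(lra)).
  apply (Rmult_le_compat_r (4 ^ n)) in Z; [|lra].
  unfold Rdiv in Z. rewrite !Rmult_assoc, Rinv_l, !Rmult_1_r in Z by lra.
  assert (Z2 : 2 * (e * s ^ 2) <= Rabs (bdry f a b c d) / 2).
  { apply Rle_trans with (2 * (e * (s ^ 2 + 1))). 
    apply Rmult_le_compat_l; [lra|]. apply Rmult_le_compat_l; lra.
    right. unfold e. field. lra. }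
  lra.
Qed.
End Bisection.

(** * Circle means, Cauchy's estimate and the maximum principle *)

(* The circle has radius exp a: in the variable log (z - z0), annuli become rectangles and
   the integrals over their horizontal sides cancel by periodicity. *)
Definition circ (f : C -> C) (z0 : C) (a : R) : R :=
  RInt (fun y => Im (f (z0 + Cexp (a, y))%C)) 0 (2 * PI).

Lemma Cexp_2PI (x : R) : Cexp (x, 2 * PI) = Cexp (x, 0).
Proof. unfold Cexp. simpl. rewrite cos_2PI, sin_2PI, cos_0, sin_0. reflexivity. Qed.

Lemma Cmod_circ (z0 : C) (a y : R) : Cmod (z0 + Cexp (a, y) - z0)%C = exp a.
Proof. replace (z0 + Cexp (a, y) - z0)%C with (Cexp (a, y)) by ring. apply Cmod_Cexp. Qed.

Lemma Chol_circ (f : C -> C) (z0 w : C) : Chol f (z0 + Cexp w)%C -> Chol (fun w => f (z0 + Cexp w)%C) w.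
Proof.
  intros H. apply (Chol_comp f (fun w => z0 + Cexp w)%C). 2: exact H.
  apply Chol_plus. apply Chol_const. apply Chol_Cexp.
Qed.

Lemma circ_annulus (f : C -> C) (z0 : C) (a b : R) : a <= b ->
  (forall z, exp a <= Cmod (z - z0) <= exp b -> Chol f z) -> circ f z0 a = circ f z0 b.
Proof.
  intros Hab Hf.
  assert (HP := PI_RGT_0).
  assert (G := Goursat (fun w => f (z0 + Cexp w)%C) a b 0 (2 * PI) Hab ltac:(lra)).
  assert (G' : forall z, box a b 0 (2 * PI) z -> Chol (fun w => f (z0 + Cexp w)%C) z).
  { intros [x y] [Hx Hy]. simpl in Hx, Hy. apply Chol_circ. apply Hf. rewrite Cmod_circ.
    split; apply exp_le; lra. }
  specialize (G G'). unfold bdry in G.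
  assert (E : Hor (fun w => f (z0 + Cexp w)%C) a b 0 = Hor (fun w => f (z0 + Cexp w)%C) a b (2 * PI)).
  { unfold Hor. apply RInt_ext. intros x _. rewrite Cexp_2PI. reflexivity. }
  rewrite E in G. unfold circ. change (Ver (fun w => f (z0 + Cexp w)%C) 0 (2 * PI) a = Ver (fun w => f (z0 + Cexp w)%C) 0 (2 * PI) b).
  lra.
Qed.

Lemma ex_circ (f : C -> C) (z0 : C) (a : R) :
  (forall z, Cmod (z - z0) = exp a -> Chol f z) ->
  ex_RInt (fun y => Im (f (z0 + Cexp (a, y))%C)) 0 (2 * PI).
Proof.
  intros H. assert (HP := PI_RGT_0).
  apply (ex_Ver (fun w => f (z0 + Cexp w)%C) 0 (2 * PI) a). lra.
  intros y _. apply Chol_cont, Chol_circ, H, Cmod_circ.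
Qed.

Lemma circ_le (f : C -> C) (z0 : C) (a K : R) :
  (forall z, Cmod (z - z0) = exp a -> Chol f z) ->
  (forall z, Cmod (z - z0) = exp a -> Im (f z) <= K) -> circ f z0 a <= 2 * PI * K.
Proof.
  intros H HK. assert (HP := PI_RGT_0).
  replace (2 * PI * K) with (RInt (fun _ => K) 0 (2 * PI)).
  2:{ rewrite RInt_const. unfold scal; simpl; unfold mult; simpl. ring. }
  apply RInt_le. lra. apply ex_circ, H. apply ex_RInt_const.
  intros y _. apply HK, Cmod_circ.
Qed.

(** The circle is shrunk into the neighbourhood where f is close to l. Holomorphy is asked for off
    the centre only, so that difference quotients are covered. *)
Lemma circ_limit (f : C -> C) (z0 l : C) (b : R) :
  (forall z, 0 < Cmod (z - z0) <= exp b -> Chol f z) ->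
  (forall e, 0 < e -> exists d, 0 < d /\ forall z, 0 < Cmod (z - z0) < d -> Cmod (f z - l) <= e) ->
  circ f z0 b = 2 * PI * Im l.
Proof.
  intros Hf Hl. assert (HP := PI_RGT_0).
  apply Rminus_diag_uniq. apply cond_eq. intros e He. rewrite Rminus_0_r.
  destruct (Hl (e / (4 * PI))) as [d [Hd H]]. apply Rdiv_lt_0_compat; lra.
  set (a := Rmin b (ln (d / 2))).
  assert (Hab : a <= b) by apply Rmin_l.
  assert (Had : exp a < d).
  { apply Rle_lt_trans with (exp (ln (d / 2))). apply exp_le. apply Rmin_r.
    rewrite exp_ln by lra. lra. }
  rewrite <- (circ_annulus f z0 a b Hab).
  2:{ intros z Hz. apply Hf. assert (Q := exp_pos a). lra. }
  unfold circ.
  assert (N := RInt_near_const (fun y => Im (f (z0 + Cexp (a, y))%C)) 0 (2 * PI) (Im l) (e / (4 * PI))).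
  assert (Q := exp_pos a).
  assert (Ex : ex_RInt (fun y => Im (f (z0 + Cexp (a, y))%C)) 0 (2 * PI)).
  { apply ex_circ. intros z Hz. apply Hf. rewrite Hz. split. exact Q. apply exp_le, Hab. }
  specialize (N ltac:(lra) Ex).
  apply Rle_lt_trans with (e / (4 * PI) * (2 * PI - 0)).
  replace (2 * PI * Im l) with (Im l * (2 * PI - 0)) by ring. apply N.
  intros y _. eapply Rle_trans. apply (Im_le_Cmod (f (z0 + Cexp (a, y)) - l)%C).
  apply H. rewrite Cmod_circ. lra.
  replace (e / (4 * PI) * (2 * PI - 0)) with (e / 2) by (field; lra). lra.
Qed.

Lemma mean_value (f : C -> C) (z0 : C) (b : R) :
  (forall z, Cmod (z - z0) <= exp b -> Chol f z) -> circ f z0 b = 2 * PI * Im (f z0).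
Proof.
  intros Hf. apply circ_limit.
  intros z Hz. apply Hf; lra.
  intros e He.
  assert (H0 : Chol f z0). { apply Hf. replace (z0 - z0)%C with (RtoC 0) by ring. rewrite Cmod_0. left; apply exp_pos. }
  destruct (Chol_cont f z0 H0 e He) as [d [Hd H]].
  exists d. split; [exact Hd|]. intros z Hz. left. apply H. lra.
Qed.

(** Circle means control imaginary parts only; turning z onto the positive imaginary axis recovers
    its modulus from them. *)
Lemma unit_Im (z : C) : exists u, Cmod u = 1 /\ (u * z)%C = (Ci * RtoC (Cmod z))%C.
Proof.
  destruct (Req_dec (Cmod z) 0) as [E|E].
  - exists 1. split. apply Cmod_1. rewrite E. apply Cmod_eq_0 in E. rewrite E. ring.
  - assert (Hz : z <> 0). { intros H. apply E. rewrite H. apply Cmod_0. }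
    exists (Ci * RtoC (Cmod z) / z)%C. split.
    + rewrite Cmod_div by exact Hz. rewrite Cmod_mult, Cmod_Ci, Cmod_R, Rabs_pos_eq by apply Cmod_ge_0.
      field. exact E.
    + field. exact Hz.
Qed.

Lemma Cconj_unit (q : C) : (Cconj q * q)%C = RtoC (Cmod q ^ 2).
Proof. rewrite Cmult_comm, <- Cmod2_conj. reflexivity. Qed.

(** The mean of u (f(w) - f(z0)) / (w - z0) is u l, but bounding it directly would charge for f(z0)
    too. With q = w - z0 and c = u f(z0), the subtracted term conj(c) q / r^2 equals conj(c / q) on
    the circle, so that c / q together with it is real. The imaginary part there is that of u f(w) /
    q, and at the centre the subtracted term vanishes. *)
Lemma Cauchy_deriv_bound (f : C -> C) (z0 l : C) (r M : R) : 0 < r ->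
  (forall z, Cmod (z - z0) <= r -> Chol f z) ->
  (forall z, Cmod (z - z0) = r -> Cmod (f z) <= M) ->
  Cderiv f z0 l -> Cmod l <= M / r.
Proof.
  intros Hr Hf HM Hl. assert (HP := PI_RGT_0).
  destruct (unit_Im l) as [u [Hu Hul]].
  set (c := (u * f z0)%C).
  set (H := fun w => (u * (f w - f z0) / (w - z0) - Cconj c / RtoC (r ^ 2) * (w - z0))%C).
  assert (Hr2 : RtoC (r ^ 2) <> 0).
  { intros E. apply RtoC_inj in E. assert (0 < r ^ 2) by (apply pow_lt; lra). lra. }
  assert (Hc : circ H z0 (ln r) = 2 * PI * Im (u * l)%C).
  { apply circ_limit.
    - rewrite exp_ln by exact Hr. intros z [Hz1 Hz2]. unfold H.
      apply (Chol_minus (fun w => u * (f w - f z0) / (w - z0))%C (fun w => Cconj c / RtoC (r ^ 2) * (w - z0))%C).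
      apply (Chol_div (fun w => u * (f w - f z0))%C (fun w => w - z0)%C).
      apply Cmod_neq_0. exact Hz1.
      apply (Chol_mult (fun _ => u)). apply Chol_const. apply (Chol_minus f). apply Hf, Hz2. apply Chol_const.
      apply (Chol_minus (fun w => w)). apply Chol_id. apply Chol_const.
      apply (Chol_mult (fun _ => Cconj c / RtoC (r ^ 2))%C). apply Chol_const.
      apply (Chol_minus (fun w => w)). apply Chol_id. apply Chol_const.
    - intros e He. 
      destruct (Hl (e / 2) ltac:(lra)) as [d1 [Hd1 H1]].
      set (k := Cmod (Cconj c / RtoC (r ^ 2))%C).
      assert (Hk : 0 <= k) by apply Cmod_ge_0.
      exists (Rmin d1 (e / 2 / (k + 1))).
      assert (Hek : 0 < e / 2 / (k + 1)) by (apply Rdiv_lt_0_compat; lra).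
      split. apply Rmin_pos; lra.
      intros z [Hz1 Hz2].
      assert (M1 := Rmin_l d1 (e / 2 / (k + 1))). assert (M2 := Rmin_r d1 (e / 2 / (k + 1))).
      specialize (H1 z ltac:(lra)).
      assert (Hzz : (z - z0)%C <> 0) by (apply Cmod_neq_0; exact Hz1).
      unfold H.
      replace (u * (f z - f z0) / (z - z0) - Cconj c / RtoC (r ^ 2) * (z - z0) - u * l)%C
        with (u * ((f z - f z0 - l * (z - z0)) / (z - z0)) - Cconj c / RtoC (r ^ 2) * (z - z0))%C
        by (field; split; assumption).
      unfold Cminus at 1. eapply Rle_trans. apply Cmod_triangle. rewrite Cmod_opp, !Cmod_mult, Hu. fold k.
      rewrite Cmod_div by exact Hzz.
      assert (P1 : Cmod (f z - f z0 - l * (z - z0)) / Cmod (z - z0) <= e / 2).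
      { apply (Rmult_le_reg_r (Cmod (z - z0))). exact Hz1. unfold Rdiv at 1. 
        rewrite Rmult_assoc, Rinv_l by lra. lra. }
      assert (P2 : k * Cmod (z - z0) <= e / 2).
      { apply Rle_trans with ((k + 1) * (e / 2 / (k + 1))). apply Rmult_le_compat; lra. right; field; lra. }
      lra. }
  assert (Hle : circ H z0 (ln r) <= 2 * PI * (M / r)).
  { apply circ_le; rewrite exp_ln by exact Hr; intros z Hz.
    - unfold H.
      apply (Chol_minus (fun w => u * (f w - f z0) / (w - z0))%C (fun w => Cconj c / RtoC (r ^ 2) * (w - z0))%C).
      apply (Chol_div (fun w => u * (f w - f z0))%C (fun w => w - z0)%C).
      apply Cmod_neq_0. rewrite Hz; exact Hr.
      apply (Chol_mult (fun _ => u)). apply Chol_const. apply (Chol_minus f). apply Hf; lra. apply Chol_const.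
      apply (Chol_minus (fun w => w)). apply Chol_id. apply Chol_const.
      apply (Chol_mult (fun _ => Cconj c / RtoC (r ^ 2))%C). apply Chol_const.
      apply (Chol_minus (fun w => w)). apply Chol_id. apply Chol_const.
    - assert (Hzz : (z - z0)%C <> 0) by (apply Cmod_neq_0; rewrite Hz; exact Hr).
      assert (E : Im (H z) = Im (u * f z / (z - z0))%C).
      { unfold H. set (q := (z - z0)%C) in *.
        assert (Eq : (RtoC (r ^ 2)) = (Cconj q * q)%C).
        { rewrite Cconj_unit, Hz. reflexivity. }
        assert (Hq : Cconj q <> 0). { intros E. apply Hzz. rewrite <- (Cconj_conj q), E. unfold Cconj, RtoC; simpl. f_equal; ring. }
        replace (u * (f z - f z0) / q - Cconj c / RtoC (r ^ 2) * q)%C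
          with (u * f z / q - (c / q + Cconj (c / q)))%C.
        2:{ rewrite Eq. unfold Cdiv. rewrite Cmult_conj, Cinv_conj by exact Hzz. unfold c. field. split; assumption. }
        unfold Cconj, Im, Cminus, Cplus, Copp; simpl. ring. }
      rewrite E. eapply Rle_trans. apply Rle_abs. eapply Rle_trans. apply Im_le_Cmod.
      rewrite Cmod_div by exact Hzz. rewrite Cmod_mult, Hu, Hz, Rmult_1_l.
      unfold Rdiv. apply Rmult_le_compat_r. left; apply Rinv_0_lt_compat; exact Hr. apply HM, Hz. }
  rewrite Hc, Hul in Hle.
  replace (Im (Ci * RtoC (Cmod l))%C) with (Cmod l) in Hle.
  2:{ unfold Ci, RtoC, Cmult, Im; simpl. ring. }
  apply (Rmult_le_reg_l (2 * PI)). lra. exact Hle.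
Qed.

(** * Compactness in the plane and the maximum principle *)

Definition Cclosed (K : C -> Prop) : Prop :=
  forall z, ~ K z -> exists d, 0 < d /\ forall w, Cmod (w - z) < d -> ~ K w.

Definition cont_on (K : C -> Prop) (h : C -> R) : Prop :=
  forall z, K z -> forall e, 0 < e -> exists d, 0 < d /\
    forall w, K w -> Cmod (w - z) < d -> Rabs (h w - h z) < e.

(** A gauge is put on the whole box: near a point of K, h exceeds its value there by at most 1; near
    any other point there is nothing of K. A finite subcover bounds h by a maximum over its centres.
    The factor 2 in the gauge passes from squares to discs. *)
Lemma compact_bounded (K : C -> Prop) (h : C -> R) (a b c d : R) :
  Cclosed K -> (forall z, K z -> box a b c d z) -> cont_on K h ->
  exists M, forall z, K z -> h z <= M.
Proof.
  intros Hcl Hb Hh.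
  assert (G : forall u : C, exists dl : posreal,
    forall w, K w -> Cmod (w - u) < 2 * dl -> K u /\ h w <= h u + 1).
  { intros u. destruct (classic (K u)) as [Ku|Ku].
    - destruct (Hh u Ku 1 Rlt_0_1) as [e [He H]].
      exists (mkposreal (e / 2) ltac:(lra)). intros w Kw Hw. simpl in Hw. split. exact Ku.
      specialize (H w Kw ltac:(lra)). apply Rabs_def2 in H. lra.
    - destruct (Hcl u Ku) as [e [He H]].
      exists (mkposreal (e / 2) ltac:(lra)). intros w Kw Hw. simpl in Hw. exfalso.
      apply (H w). lra. exact Kw. }
  set (g := fun u => proj1_sig (constructive_indefinite_description _ (G u))).
  assert (Hg : forall u w, K w -> Cmod (w - u) < 2 * g u -> K u /\ h w <= h u + 1).
  { intros u. unfold g. exact (proj2_sig (constructive_indefinite_description _ (G u))). }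
  set (dl := fun t : Compactness.Tn 2 R => g (fst t, fst (snd t))).
  apply NNPP. intros N. apply (compactness_list 2 (a, (c, tt)) (b, (d, tt)) dl).
  intros [l Hl]. apply N.
  exists (fold_right (fun t m => Rmax (h (fst t, fst (snd t)) + 1) m) 0 l).
  intros [x y] Kz. destruct (Hb _ Kz) as [Hx Hy]. simpl in Hx, Hy.
  destruct (Hl (x, (y, tt))) as [[u [v []]] [Hin [_ [H1 [H2 _]]]]].
  { simpl. tauto. }
  assert (Hw : h (x, y) <= h (u, v) + 1).
  { apply Hg. exact Kz. change ((x, y) - (u, v))%C with (x - u, y - v).
    eapply Rle_lt_trans. apply Cmod_le_abs. unfold dl in H1, H2; simpl in H1, H2. lra. }
  apply Rle_trans with (1 := Hw).
  clear - Hin. induction l as [|t l IH]. destruct Hin.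
  simpl. destruct Hin as [->|Hin]. simpl. apply Rmax_l. eapply Rle_trans. apply IH, Hin. apply Rmax_r.
Qed.

(** If the supremum M were not attained, 1 / (M - h) would be continuous on K, hence bounded, and M
    could be lowered. *)
Lemma compact_max (K : C -> Prop) (h : C -> R) (a b c d : R) :
  Cclosed K -> (forall z, K z -> box a b c d z) -> cont_on K h -> (exists z, K z) ->
  exists z, K z /\ forall w, K w -> h w <= h z.
Proof.
  intros Hcl Hb Hh [z0 Hz0].
  destruct (compact_bounded K h a b c d Hcl Hb Hh) as [B HB].
  destruct (completeness (fun x => exists z, K z /\ x = h z)) as [M [M1 M2]].
  - exists B. intros x [z [Kz ->]]. apply HB, Kz.
  - exists (h z0), z0. split; [exact Hz0|reflexivity].
  - apply NNPP. intros N.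
    assert (Hlt : forall z, K z -> h z < M).
    { intros z Kz. destruct (M1 (h z)) as [H|H]. exists z; split; [exact Kz|reflexivity]. exact H.
      exfalso. apply N. exists z. split; [exact Kz|]. intros w Kw. rewrite H. apply M1. exists w; split; [exact Kw|reflexivity]. }
    destruct (compact_bounded K (fun z => / (M - h z)) a b c d Hcl Hb) as [B' HB'].
    { intros z Kz e He. assert (Hz := Hlt z Kz).
      assert (Hm : 0 < M - h z) by lra. set (m := M - h z) in *.
      destruct (Hh z Kz (Rmin (m / 2) (e * (m * m) / 2))) as [dl [Hdl H]].
      { apply Rmin_pos. lra. apply Rdiv_lt_0_compat; [|lra]. repeat apply Rmult_lt_0_compat; lra. }
      exists dl. split; [exact Hdl|]. intros w Kw Hw. specialize (H w Kw Hw).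
      assert (Q1 := Rmin_l (m / 2) (e * (m * m) / 2)). assert (Q2 := Rmin_r (m / 2) (e * (m * m) / 2)).
      assert (Hw2 : m / 2 < M - h w).
      { assert (Rabs (h w - h z) < m / 2) by lra. apply Rabs_def2 in H0. unfold m in *. lra. }
      replace (/ (M - h w) - / m) with ((h w - h z) / ((M - h w) * m)).
      2:{ unfold m. field. unfold m in *. lra. }
      unfold Rdiv. rewrite Rabs_mult. rewrite (Rabs_pos_eq (/ _)).
      2:{ left. apply Rinv_0_lt_compat. apply Rmult_lt_0_compat; lra. }
      apply (Rmult_lt_reg_r ((M - h w) * m)). apply Rmult_lt_0_compat; lra.
      rewrite Rmult_assoc, Rinv_l, Rmult_1_r. 2:{ apply Rgt_not_eq. apply Rmult_lt_0_compat; lra. }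
      apply Rlt_le_trans with (e * (m * m) / 2). lra.
      replace (e * (m * m) / 2) with (e * ((m / 2) * m)) by field.
      apply Rmult_le_compat_l; [lra|]. apply Rmult_le_compat_r; lra. }
    assert (B0 : 0 < B').
    { apply Rlt_le_trans with (/ (M - h z0)). apply Rinv_0_lt_compat. assert (Q := Hlt z0 Hz0); lra. apply HB', Hz0. }
    assert (M <= M - / B').
    { apply M2. intros x [z [Kz ->]]. assert (Q := Hlt z Kz). specialize (HB' z Kz).
      assert (/ B' <= M - h z). { rewrite <- (Rinv_inv (M - h z)). apply Rinv_le_contravar. apply Rinv_0_lt_compat; lra. exact HB'. }
      lra. }
    assert (0 < / B') by (apply Rinv_0_lt_compat; exact B0). lra.
Qed.

Lemma Cmod_sqr (x y : R) : Cmod (x, y) ^ 2 = x ^ 2 + y ^ 2.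
Proof. rewrite Cmod2_alt. reflexivity. Qed.

(* If |f| + e |z|^2 had a maximum at an interior point z, the mean value property for
   u f(w) + 2 e i conj(z) (w - z), with u unimodular and u f(z) = i |f(z)|, would fail. *)
Lemma max_modulus (K : C -> Prop) (f : C -> C) (a b c d B : R) :
  Cclosed K -> (forall z, K z -> box a b c d z) ->
  (forall z, K z -> Chol f z) ->
  (forall z, K z -> (forall r, 0 < r -> exists w, Cmod (w - z) <= r /\ ~ K w) -> Cmod (f z) <= B) ->
  forall z, K z -> Cmod (f z) <= B.
Proof.
  intros Hcl Hb Hf Hbd z1 Kz1.
  set (R2 := 2 * (Rabs a + Rabs b) ^ 2 + 2 * (Rabs c + Rabs d) ^ 2).
  assert (HR2 : 0 <= R2). { unfold R2. assert (Q1 := pow2_ge_0 (Rabs a + Rabs b)). assert (Q2 := pow2_ge_0 (Rabs c + Rabs d)). lra. }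
  assert (HR : forall z, K z -> 0 <= Cmod z ^ 2 <= R2).
  { intros [x y] Kz. destruct (Hb _ Kz) as [Hx Hy]. simpl in Hx, Hy. rewrite Cmod_sqr.
    assert (Rabs x <= Rabs a + Rabs b). { unfold Rabs; repeat destruct (Rcase_abs _); lra. }
    assert (Rabs y <= Rabs c + Rabs d). { unfold Rabs; repeat destruct (Rcase_abs _); lra. }
    assert (x ^ 2 <= (Rabs a + Rabs b) ^ 2). { rewrite <- (pow2_abs x). apply pow_incr. split; [apply Rabs_pos|assumption]. }
    assert (y ^ 2 <= (Rabs c + Rabs d) ^ 2). { rewrite <- (pow2_abs y). apply pow_incr. split; [apply Rabs_pos|assumption]. }
    assert (P1 := pow2_ge_0 x). assert (P2 := pow2_ge_0 y). unfold R2. lra. }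
  apply le_epsilon. intros e0 He0.
  (* The perturbation e |z|^2 then stays below e0 on all of K. *)
  set (e := e0 / (R2 + 1)).
  assert (He : 0 < e) by (apply Rdiv_lt_0_compat; lra).
  assert (HeR : e * R2 <= e0).
  { apply Rle_trans with (e * (R2 + 1)). apply Rmult_le_compat_l; lra. right. unfold e. field. lra. }
  set (h := fun z => Cmod (f z) + e * Cmod z ^ 2).
  destruct (compact_max K h a b c d Hcl Hb) as [z [Kz Hmax]].
  { intros z Kz e1 He1. unfold h.
    destruct (Chol_cont f z (Hf z Kz) (e1 / 2) ltac:(lra)) as [d1 [Hd1 H1]].
    assert (Hcz : Chol (fun w => e * (w * w))%C z).
    { apply (Chol_mult (fun _ => RtoC e)). apply Chol_const. apply (Chol_mult (fun w => w)); apply Chol_id. }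
    destruct (Chol_cont _ z Hcz (e1 / 2) ltac:(lra)) as [d2 [Hd2 H2]].
    exists (Rmin d1 d2). split. apply Rmin_pos; lra. intros w Kw Hw.
    assert (Q1 := Rmin_l d1 d2). assert (Q2 := Rmin_r d1 d2).
    specialize (H1 w ltac:(lra)). specialize (H2 w ltac:(lra)).
    assert (T1 := Cmod_minus_le (f w) (f z)). assert (T2 := Cmod_minus_le (f z) (f w)).
    assert (T3 := Cmod_minus_le (e * (w * w)) (e * (z * z))). assert (T4 := Cmod_minus_le (e * (z * z)) (e * (w * w))).
    assert (S1 : Cmod (f z - f w) = Cmod (f w - f z)). { rewrite <- Cmod_opp. f_equal. ring. }
    assert (S2 : Cmod (e * (z * z) - e * (w * w)) = Cmod (e * (w * w) - e * (z * z))). { rewrite <- Cmod_opp. f_equal. ring. }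
    rewrite S1 in T2. rewrite S2 in T4.
    rewrite !(Cmod_mult e), !Cmod_mult, Cmod_R, Rabs_pos_eq in T3, T4 by lra.
    apply Rabs_def1; simpl; lra. }
  { exists z1; exact Kz1. }
  assert (Hz1 := Hmax z1 Kz1). unfold h in Hz1.
  assert (R0 := HR z1 Kz1). assert (R1 := HR z Kz).
  assert (S0 : 0 <= e * Cmod z1 ^ 2) by (apply Rmult_le_pos; lra).
  assert (S1 : e * Cmod z ^ 2 <= e * R2) by (apply Rmult_le_compat_l; lra).
  enough (Cmod (f z) <= B) by lra.
  apply Hbd. exact Kz. intros r Hr. apply NNPP. intros N.
  assert (Hin : forall w, Cmod (w - z) <= r -> K w).
  { intros w Hw. apply NNPP. intros Nw. apply N. exists w. split; assumption. }
  destruct (unit_Im (f z)) as [u [Hu Huf]].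
  set (F := fun w => (u * f w + 2 * e * Ci * Cconj z * (w - z))%C).
  assert (HF : forall w, Cmod (w - z) <= r -> Chol F w).
  { intros w Hw. unfold F. apply (Chol_plus (fun w => u * f w)%C).
    apply (Chol_mult (fun _ => u)). apply Chol_const. apply Hf, Hin, Hw.
    apply (Chol_mult (fun _ => 2 * e * Ci * Cconj z)%C). apply Chol_const. apply (Chol_minus (fun w => w)). apply Chol_id. apply Chol_const. }
  assert (HP := PI_RGT_0).
  assert (Q1 : circ F z (ln r) = 2 * PI * Im (F z)).
  { apply mean_value. rewrite exp_ln by exact Hr. exact HF. }
  assert (Q2 : circ F z (ln r) <= 2 * PI * (Cmod (f z) - e * r ^ 2)).
  { apply circ_le; rewrite exp_ln by exact Hr; intros w Hw. apply HF; lra.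
    assert (Hw' := Hmax w (Hin w ltac:(lra))). unfold h in Hw'.
    (* This is the expansion |w|^2 = |z|^2 + 2 Re (conj(z) (w - z)) + |w - z|^2. Maximality of z
       bounds |f(w)| + e (|w|^2 - |z|^2) by |f(z)|, which leaves a gain of e r^2 on the circle. *)
    assert (E1 : Im (F w) = Im (u * f w)%C + e * (Cmod w ^ 2 - Cmod z ^ 2 - Cmod (w - z) ^ 2)).
    { rewrite !Cmod2_alt. unfold F.
      set (q := (u * f w)%C). destruct w as [w1 w2]. destruct z as [x y]. destruct q as [q1 q2].
      unfold Cconj, Ci, RtoC, Cminus, Cplus, Copp, Cmult, Re, Im; simpl. ring. }
    assert (E2 : Im (u * f w)%C <= Cmod (f w)).
    { eapply Rle_trans. apply Rle_abs. eapply Rle_trans. apply Im_le_Cmod. rewrite Cmod_mult, Hu. lra. }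
    rewrite E1, Hw. lra. }
  assert (Q3 : Im (F z) = Cmod (f z)).
  { unfold F. rewrite Huf. replace (2 * e * Ci * Cconj z * (z - z))%C with (RtoC 0) by ring.
    unfold Ci, RtoC, Cplus, Cmult, Im; simpl. ring. }
  rewrite Q1, Q3 in Q2.
  apply (Rmult_le_reg_l (2 * PI)) in Q2; [|lra].
  assert (0 < r ^ 2) by (apply pow_lt; exact Hr). assert (0 < e * r ^ 2) by (apply Rmult_lt_0_compat; lra). lra.
Qed.

(** * Schwarz, Borel-Caratheodory and three circles *)

Lemma Cmod_sym (z w : C) : Cmod (z - w) = Cmod (w - z).
Proof. rewrite <- Cmod_opp. f_equal. ring. Qed.

Lemma Cclosed_le (h : C -> R) (k : R) :
  (forall z w, h z - h w <= Cmod (z - w)) -> Cclosed (fun z => h z <= k).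
Proof.
  intros H z Hz. apply Rnot_le_lt in Hz. exists (h z - k). split. lra.
  intros w Hw Hk. assert (Q := H z w). rewrite (Cmod_sym z w) in Q. lra.
Qed.

Lemma Cclosed_and (K1 K2 : C -> Prop) : Cclosed K1 -> Cclosed K2 -> Cclosed (fun z => K1 z /\ K2 z).
Proof.
  intros H1 H2 z Hz. destruct (classic (K1 z)) as [k1|k1].
  - destruct (H2 z) as [d [Hd H]]. tauto. exists d. split; [exact Hd|]. intros w Hw [_ Q]. apply (H w Hw Q).
  - destruct (H1 z) as [d [Hd H]]. tauto. exists d. split; [exact Hd|]. intros w Hw [Q _]. apply (H w Hw Q).
Qed.

Lemma Cmod_lip (c z w : C) : Cmod (z - c) - Cmod (w - c) <= Cmod (z - w).
Proof. replace (z - w)%C with ((z - c) - (w - c))%C by ring. apply Cmod_minus_le. Qed.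

Lemma in_box_disc (c z : C) (r : R) : Cmod (z - c) <= r ->
  box (Re c - r) (Re c + r) (Im c - r) (Im c + r) z.
Proof.
  intros H. assert (H1 := re_le_Cmod (z - c)). assert (H2 := Im_le_Cmod (z - c)).
  assert (E1 : Re (z - c)%C = Re z - Re c) by reflexivity.
  assert (E2 : Im (z - c)%C = Im z - Im c) by reflexivity.
  rewrite E1 in H1. rewrite E2 in H2. 
  assert (Rabs (Re z - Re c) <= r) by lra. assert (Rabs (Im z - Im c) <= r) by lra.
  apply Rabs_le_between in H0. apply Rabs_le_between in H3. split; lra.
Qed.

Lemma annulus_max (f : C -> C) (c : C) (r1 r2 B : R) :
  (forall z, r1 <= Cmod (z - c) <= r2 -> Chol f z) ->
  (forall z, Cmod (z - c) = r1 \/ Cmod (z - c) = r2 -> Cmod (f z) <= B) ->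
  forall z, r1 <= Cmod (z - c) <= r2 -> Cmod (f z) <= B.
Proof.
  intros Hf HB z Hz.
  apply (max_modulus (fun z => - Cmod (z - c) <= - r1 /\ Cmod (z - c) <= r2) f
    (Re c - r2) (Re c + r2) (Im c - r2) (Im c + r2)).
  - apply Cclosed_and; apply Cclosed_le.
    intros u w. assert (Q := Cmod_lip c w u). rewrite (Cmod_sym w u) in Q. lra.
    intros u w. apply Cmod_lip.
  - intros w [_ Hw]. apply in_box_disc, Hw.
  - intros w Hw. apply Hf. lra.
  - intros w [H1 H2] Hw. apply HB.
    destruct (Req_dec (Cmod (w - c)) r1) as [E|N1]. left; exact E.
    destruct (Req_dec (Cmod (w - c)) r2) as [E|N2]. right; exact E.
    exfalso. destruct (Hw (Rmin (Cmod (w - c) - r1) (r2 - Cmod (w - c)))) as [u [Hu Nu]].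
    apply Rmin_pos; lra. apply Nu.
    assert (Q1 := Rmin_l (Cmod (w - c) - r1) (r2 - Cmod (w - c))).
    assert (Q2 := Rmin_r (Cmod (w - c) - r1) (r2 - Cmod (w - c))).
    assert (L1 := Cmod_lip c u w). assert (L2 := Cmod_lip c w u). rewrite (Cmod_sym w u) in L2. lra.
  - lra.
Qed.

Lemma rect_max (f : C -> C) (a b c d B : R) :
  (forall z, box a b c d z -> Chol f z) ->
  (forall z, box a b c d z -> Re z = a \/ Re z = b \/ Im z = c \/ Im z = d -> Cmod (f z) <= B) ->
  forall z, box a b c d z -> Cmod (f z) <= B.
Proof.
  intros Hf HB z Hz.
  assert (LR : forall u w : C, Rabs (Re u - Re w) <= Cmod (u - w)) by (intros u w; apply (re_le_Cmod (u - w))).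
  assert (LI : forall u w : C, Rabs (Im u - Im w) <= Cmod (u - w)) by (intros u w; apply (Im_le_Cmod (u - w))).
  apply (max_modulus (fun z => (- Re z <= - a /\ Re z <= b) /\ (- Im z <= - c /\ Im z <= d)) f a b c d).
  - repeat apply Cclosed_and; apply Cclosed_le; intros u w.
    assert (Q := LR u w). apply Rabs_le_between in Q. lra.
    assert (Q := LR u w). apply Rabs_le_between in Q. lra.
    assert (Q := LI u w). apply Rabs_le_between in Q. lra.
    assert (Q := LI u w). apply Rabs_le_between in Q. lra.
  - intros w Hw. unfold box. lra.
  - intros w Hw. apply Hf. unfold box. lra.
  - intros w Hw Ho.
    destruct (classic (Re w = a \/ Re w = b \/ Im w = c \/ Im w = d)) as [E|N].
    apply HB; [unfold box; lra | exact E].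
    exfalso. 
    set (m := Rmin (Rmin (Re w - a) (b - Re w)) (Rmin (Im w - c) (d - Im w))).
    assert (M1 := Rmin_l (Rmin (Re w - a) (b - Re w)) (Rmin (Im w - c) (d - Im w))).
    assert (M2 := Rmin_r (Rmin (Re w - a) (b - Re w)) (Rmin (Im w - c) (d - Im w))).
    assert (M3 := Rmin_l (Re w - a) (b - Re w)). assert (M4 := Rmin_r (Re w - a) (b - Re w)).
    assert (M5 := Rmin_l (Im w - c) (d - Im w)). assert (M6 := Rmin_r (Im w - c) (d - Im w)).
    destruct (Ho m) as [u [Hu Nu]].
    { unfold m. repeat apply Rmin_pos.
      assert (Re w <> a) by tauto. lra. assert (Re w <> b) by tauto. lra.
      assert (Im w <> c) by tauto. lra. assert (Im w <> d) by tauto. lra. }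
    apply Nu. fold m in M1, M2.
    assert (Q1 := LR u w). assert (Q2 := LI u w). apply Rabs_le_between in Q1. apply Rabs_le_between in Q2.
    lra.
  - unfold box in Hz. lra.
Qed.

Lemma Chol_sub_pow (c : C) (n : nat) (z : C) : Chol (fun w => (w - c) ^ n)%C z.
Proof. apply (Chol_pow (fun w => w - c)%C). apply (Chol_minus (fun w => w)). apply Chol_id. apply Chol_const. Qed.

(** Otherwise (y / q)^n would grow beyond 1 / y. This removes the extra factor that the (n+1)-st
    power leaves in Schwarz's lemma. *)
Lemma pow_ratio_le (y q : R) : 0 < q -> 0 <= y -> (forall n, y ^ (S n) <= q ^ n) -> y <= q.
Proof.
  intros Hq Hy H. apply Rnot_lt_le. intros Hlt.
  assert (Hr : 0 < y / q - 1).
  { apply Rlt_0_minus. apply (Rmult_lt_reg_r q). exact Hq. unfold Rdiv. rewrite Rmult_assoc, Rinv_l; lra. }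
  assert (Hy0 : 0 < y) by lra.
  destruct (Pow_x_infinity (y / q) ltac:(rewrite Rabs_pos_eq; lra) (/ y + 1)) as [n Hn].
  specialize (Hn n (Nat.le_refl n)). specialize (H n).
  assert (Qn := pow_lt q n Hq). assert (Yn := pow_lt y n Hy0).
  rewrite Rabs_pos_eq in Hn by (apply pow_le; lra).
  assert (E : (y / q) ^ n = y ^ n / q ^ n) by (unfold Rdiv; rewrite Rpow_mult_distr, pow_inv; reflexivity).
  rewrite E in Hn. simpl in H.
  assert (y ^ n / q ^ n <= / y).
  { apply (Rmult_le_reg_r (y * q ^ n)). apply Rmult_lt_0_compat; lra.
    replace (y ^ n / q ^ n * (y * q ^ n)) with (y * y ^ n) by (field; lra).
    replace (/ y * (y * q ^ n)) with (q ^ n) by (field; lra). exact H. }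
  lra.
Qed.

(* The maximum principle for f^(n+1) / (z-c)^n, which tends to 0 at c, as n -> oo. *)
Lemma Schwarz (f : C -> C) (c : C) (r : R) : 0 < r ->
  (forall z, Cmod (z - c) <= r -> Chol f z) ->
  (forall z, Cmod (z - c) <= r -> Cmod (f z) <= 1) -> f c = 0 ->
  forall z, Cmod (z - c) <= r -> Cmod (f z) <= Cmod (z - c) / r.
Proof.
  intros Hr Hf H1 Hfc z Hz.
  destruct (Req_dec (Cmod (z - c)) 0) as [E|E].
  { assert (z = c). { apply Cmod_eq_0 in E. replace z with ((z - c) + c)%C by ring. rewrite E. ring. }
    rewrite E. subst z. rewrite Hfc, Cmod_0. lra. }
  assert (Hzc : 0 < Cmod (z - c)) by (assert (Q := Cmod_ge_0 (z - c)); lra).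
  destruct (Hf c) as [l Hl]. { replace (c - c)%C with (RtoC 0) by ring. rewrite Cmod_0. lra. }
  destruct (Cderiv_cont_loc f c l Hl) as [d [K [Hd [HK Hc]]]].
  apply pow_ratio_le. apply Rdiv_lt_0_compat; lra. apply Cmod_ge_0.
  intros n.
  assert (Hrn := pow_lt r n Hr). assert (HKn := pow_lt K (S n) HK).
  (* On the inner circle |f| <= K ep, so the quotient is at most K^(n+1) ep, and the last entry
     makes this at most r^(-n), the bound on the outer circle. The other entries keep the inner
     circle where the Lipschitz bound holds and z in the annulus. *)
  set (ep := Rmin (Rmin (d / 2) (Cmod (z - c))) (/ r ^ n / K ^ S n)).
  assert (E1 : 0 < / r ^ n) by (apply Rinv_0_lt_compat; exact Hrn).
  assert (Hep : 0 < ep).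
  { unfold ep. apply Rmin_pos. apply Rmin_pos; lra. apply Rdiv_lt_0_compat; lra. }
  assert (A := annulus_max (fun w => f w ^ S n / (w - c) ^ n)%C c ep r (/ r ^ n)).
  assert (Hepz : ep <= Cmod (z - c)).
  { unfold ep. eapply Rle_trans. apply Rmin_l. apply Rmin_r. }
  assert (Hepd : ep <= d / 2).
  { unfold ep. eapply Rle_trans. apply Rmin_l. apply Rmin_l. }
  assert (Hep3 : ep <= / r ^ n / K ^ S n) by apply Rmin_r.
  assert (A' : Cmod (f z ^ S n / (z - c) ^ n)%C <= / r ^ n).
  { apply A. 3: lra.
    - intros w Hw. assert (w - c <> 0)%C by (apply Cmod_neq_0; lra).
      apply (Chol_div (fun w => f w ^ S n)%C (fun w => (w - c) ^ n)%C).
      apply Cpow_nz; assumption. apply Chol_pow. apply Hf; lra. apply Chol_sub_pow.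
    - intros w Hw.
      assert (Hw0 : 0 < Cmod (w - c)) by (destruct Hw as [-> | ->]; lra).
      assert (w - c <> 0)%C by (apply Cmod_neq_0; lra).
      rewrite Cmod_div by (apply Cpow_nz; assumption).
      rewrite !Cmod_pow.
      destruct Hw as [Hw|Hw].
      + assert (Q : Cmod (f w) <= K * ep).
        { specialize (Hc w ltac:(lra)). rewrite Hfc, Hw in Hc. replace (f w - 0)%C with (f w) in Hc by ring. exact Hc. }
        rewrite Hw. assert (Hepn := pow_lt ep n Hep).
        apply Rle_trans with ((K * ep) ^ S n / ep ^ n).
        unfold Rdiv. apply Rmult_le_compat_r. left; apply Rinv_0_lt_compat; lra.
        apply pow_incr. split; [apply Cmod_ge_0 | exact Q].
        rewrite Rpow_mult_distr. replace (K ^ S n * ep ^ S n / ep ^ n) with (K ^ S n * ep) by (simpl; field; lra).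
        apply Rle_trans with (K ^ S n * (/ r ^ n / K ^ S n)). apply Rmult_le_compat_l; lra.
        right. field. split; lra.
      + rewrite Hw. unfold Rdiv. rewrite <- (Rmult_1_l (/ r ^ n)) at 2. apply Rmult_le_compat_r. lra.
        rewrite <- (pow1 (S n)). apply pow_incr. split. apply Cmod_ge_0. apply H1. lra. }
  assert (z - c <> 0)%C by (apply Cmod_neq_0; lra).
  rewrite Cmod_div in A' by (apply Cpow_nz; assumption). rewrite !Cmod_pow in A'.
  assert (Hzn := pow_lt _ n Hzc).
  unfold Rdiv. rewrite Rpow_mult_distr, pow_inv.
  apply (Rmult_le_compat_r (Cmod (z - c) ^ n)) in A'; [|lra].
  unfold Rdiv in A'. rewrite Rmult_assoc, Rinv_l, Rmult_1_r in A' by lra. lra.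
Qed.

(** With g = f - f(c) and k = A - Re f(c), the half-plane Re g <= k is mapped into the unit disc by
    g / (2k - g), which vanishes at c. Schwarz's lemma gives R0 |g| <= r (2k + |g|), and this is
    solved for |g|. *)
Lemma Borel_Caratheodory (f : C -> C) (c : C) (r R0 A : R) : 0 < r < R0 ->
  (forall z, Cmod (z - c) <= R0 -> Chol f z) ->
  (forall z, Cmod (z - c) <= R0 -> Re (f z) <= A) -> Re (f c) < A ->
  forall z, Cmod (z - c) <= r -> Cmod (f z - f c) <= 2 * r / (R0 - r) * (A - Re (f c)).
Proof.
  intros Hr Hf HA HcA z Hz.
  set (k := A - Re (f c)). assert (Hk : 0 < k) by (unfold k; lra).
  set (g := fun w => (f w - f c)%C).
  assert (Hre : forall w, Cmod (w - c) <= R0 -> Re (g w) <= k).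
  { intros w Hw. unfold g, k. change (Re (f w - f c)%C) with (Re (f w) - Re (f c)). specialize (HA w Hw). lra. }
  assert (Hden : forall w, Cmod (w - c) <= R0 -> Cmod (g w) <= Cmod (2 * k - g w)).
  { intros w Hw. specialize (Hre w Hw). apply Rsqr_incr_0; try apply Cmod_ge_0.
    rewrite !Rsqr_pow2, !Cmod2_alt. destruct (g w) as [x y]. unfold Re in Hre. simpl in Hre.
    unfold Re, Im, Cminus, Cplus, Copp, Cmult, RtoC. simpl. nra. }
  assert (Hnz : forall w, Cmod (w - c) <= R0 -> 0 < Cmod (2 * k - g w)).
  { intros w Hw. specialize (Hre w Hw). assert (Q := re_le_Cmod (2 * k - g w)).
    assert (E : Re (2 * k - g w)%C = 2 * k - Re (g w)). { destruct (g w); unfold Re, Cminus, Cplus, Copp, Cmult, RtoC. simpl. ring. }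
    rewrite E in Q. apply Rabs_le_between in Q. lra. }
  assert (HF : forall w, Cmod (w - c) <= R0 -> Chol (fun w => g w / (2 * k - g w))%C w).
  { intros w Hw. assert (Chol g w). { apply (Chol_minus f). apply Hf, Hw. apply Chol_const. }
    apply (Chol_div g (fun w => 2 * k - g w)%C). apply Cmod_neq_0, Hnz, Hw. assumption.
    apply (Chol_minus (fun _ => 2 * k)%C). apply Chol_const. assumption. }
  assert (S := Schwarz (fun w => g w / (2 * k - g w))%C c R0 ltac:(lra) HF).
  assert (Sz : Cmod (g z / (2 * k - g z)) <= Cmod (z - c) / R0).
  { apply S. 3: lra.
    - intros w Hw. assert (Q := Hnz w Hw). rewrite Cmod_div by (apply Cmod_neq_0; exact Q).
      apply (Rmult_le_reg_r (Cmod (2 * k - g w))). exact Q. unfold Rdiv. rewrite Rmult_assoc, Rinv_l by lra.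
      specialize (Hden w Hw). lra.
    - unfold g. replace (f c - f c)%C with (RtoC 0) by ring. unfold Cdiv. ring. }
  assert (Q := Hnz z ltac:(lra)).
  rewrite Cmod_div in Sz by (apply Cmod_neq_0; exact Q).
  set (G := Cmod (g z)) in *. change (G <= 2 * r / (R0 - r) * k).
  assert (T : Cmod (2 * k - g z) <= 2 * k + G).
  { unfold Cminus. eapply Rle_trans. apply Cmod_triangle. rewrite Cmod_opp.
    rewrite <- RtoC_mult, Cmod_R, Rabs_pos_eq by lra. unfold G. lra. }
  set (D := Cmod (2 * k - g z)) in *.
  assert (S1 : G * R0 <= Cmod (z - c) * D).
  { apply (Rmult_le_compat_r (D * R0)) in Sz. 2: apply Rmult_le_pos; lra.
    replace (G / D * (D * R0)) with (G * R0) in Sz by (field; lra).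
    replace (Cmod (z - c) / R0 * (D * R0)) with (Cmod (z - c) * D) in Sz by (field; lra). exact Sz. }
  assert (S2 : Cmod (z - c) * D <= r * (2 * k + G)).
  { apply Rmult_le_compat; try lra. apply Cmod_ge_0. }
  apply (Rmult_le_reg_r (R0 - r)). lra.
  replace (2 * r / (R0 - r) * k * (R0 - r)) with (2 * r * k) by (field; lra). lra.
Qed.

(* Three circles: (z-c)^(-m) g n on an annulus, with m chosen before n. *)
Lemma vanishing_sequence (g : nat -> C -> C) (c : C) (r R0 B : R) (eps : nat -> R) : 0 < r < R0 ->
  (forall n z, Cmod (z - c) <= R0 -> Chol (g n) z) ->
  (forall n z, Cmod (z - c) <= R0 -> Cmod (g n z) <= B) ->
  (forall n z, Cmod (z - c) <= r -> Cmod (g n z) <= eps n) ->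
  (forall e, 0 < e -> exists N, forall n, (N <= n)%nat -> eps n <= e) ->
  forall z, Cmod (z - c) < R0 -> forall e, 0 < e -> exists N, forall n, (N <= n)%nat -> Cmod (g n z) <= e.
Proof.
  intros Hr Hg HB Hs He z Hz e Hep.
  destruct (Rle_lt_dec (Cmod (z - c)) r) as [H|H].
  { destruct (He e Hep) as [N HN]. exists N. intros n Hn. eapply Rle_trans. apply Hs, H. apply HN, Hn. }
  set (y := Cmod (z - c)) in *.
  assert (HB0 : 0 <= B).
  { eapply Rle_trans. apply (Cmod_ge_0 (g 0%nat z)). apply HB. fold y. lra. }
  (* As y < R0, a large m makes B / R0^m at most e / y^m on the outer circle. For this fixed m,
     large n does the same on the inner circle. *)
  destruct (pow_lt_1_zero (y / R0)) with (y := e / (B + 1)) as [m Hm].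
  { assert (0 < y / R0) by (apply Rdiv_lt_0_compat; lra). rewrite Rabs_pos_eq by lra. apply (Rmult_lt_reg_r R0). lra. unfold Rdiv. rewrite Rmult_assoc, Rinv_l; lra. }
  { apply Rdiv_lt_0_compat; lra. }
  specialize (Hm m (Nat.le_refl m)).
  assert (Hy0 : 0 < y) by lra.
  rewrite Rabs_pos_eq in Hm by (apply pow_le; left; apply Rdiv_lt_0_compat; lra).
  assert (Ym := pow_lt y m Hy0). assert (Rm := pow_lt R0 m ltac:(lra)). assert (rm := pow_lt r m ltac:(lra)).
  destruct (He (e * r ^ m / y ^ m)) as [N HN].
  { apply Rdiv_lt_0_compat; [|lra]. apply Rmult_lt_0_compat; lra. }
  exists N. intros n Hn. specialize (HN n Hn).
  assert (Em : 0 < e / y ^ m) by (apply Rdiv_lt_0_compat; lra).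
  assert (A : Cmod (g n z / (z - c) ^ m)%C <= e / y ^ m).
  { apply (annulus_max (fun w => g n w / (w - c) ^ m)%C c r R0). 3: fold y; lra.
    - intros w Hw. assert (w - c <> 0)%C by (apply Cmod_neq_0; lra).
      apply (Chol_div (g n) (fun w => (w - c) ^ m)%C).
      apply Cpow_nz; assumption. apply Hg; lra. apply Chol_sub_pow.
    - intros w Hw. assert (w - c <> 0)%C by (apply Cmod_neq_0; lra).
      rewrite Cmod_div by (apply Cpow_nz; assumption). rewrite Cmod_pow.
      destruct Hw as [Hw|Hw]; rewrite Hw.
      + apply (Rmult_le_reg_r (r ^ m)). exact rm. unfold Rdiv at 1. rewrite Rmult_assoc, Rinv_l, Rmult_1_r by lra.
        eapply Rle_trans. apply Hs. lra. eapply Rle_trans. exact HN. right. field. lra.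
      + apply (Rmult_le_reg_r (R0 ^ m)). exact Rm. unfold Rdiv at 1. rewrite Rmult_assoc, Rinv_l, Rmult_1_r by lra.
        eapply Rle_trans. apply HB. lra.
        assert (E : (y / R0) ^ m = y ^ m / R0 ^ m) by (unfold Rdiv; rewrite Rpow_mult_distr, pow_inv; reflexivity).
        rewrite E in Hm.
        apply Rlt_le in Hm. apply (Rmult_le_compat_r ((B + 1) * R0 ^ m / y ^ m)) in Hm.
        2:{ left. apply Rdiv_lt_0_compat; [|lra]. apply Rmult_lt_0_compat; lra. }
        replace (y ^ m / R0 ^ m * ((B + 1) * R0 ^ m / y ^ m)) with (B + 1) in Hm by (field; lra).
        replace (e / (B + 1) * ((B + 1) * R0 ^ m / y ^ m)) with (e / y ^ m * R0 ^ m) in Hm by (field; lra).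
        lra. }
  assert (z - c <> 0)%C by (apply Cmod_neq_0; exact Hy0).
  rewrite Cmod_div in A by (apply Cpow_nz; assumption). rewrite Cmod_pow in A. fold y in A.
  apply (Rmult_le_compat_r (y ^ m)) in A; [|lra]. unfold Rdiv in A.
  rewrite !Rmult_assoc, Rinv_l, !Rmult_1_r in A by lra. exact A.
Qed.

(** * Logarithms *)

Definition Rcont (h : C -> R) (z : C) : Prop :=
  forall e, 0 < e -> exists d, 0 < d /\ forall w, Cmod (w - z) < d -> Rabs (h w - h z) < e.

Lemma Rcont_continuous (h : C -> R) (z : C) : Rcont h z <-> @continuous C_UniformSpace R_UniformSpace h z.
Proof.
  split.
  - intros H. apply filterlim_locally. intros e. destruct (H e (cond_pos e)) as [d [Hd Hh]].
    refine (proj2 (locally_Cmod (fun w => Rabs (h w - h z) < e) z) _). exists d. split; [exact Hd|]. exact Hh.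
  - intros H e He. apply filterlim_locally with (eps := mkposreal e He) in H.
    apply (proj1 (locally_Cmod _ _)) in H. exact H.
Qed.

(** The arctangent gives the argument only in the right half-plane, so this is the principal
    logarithm for Re w > 0 and is used only there. *)
Definition Clog (w : C) : C := (ln (Cmod w), atan (Im w / Re w)).

Lemma Cexp_Clog (w : C) : 0 < Re w -> Cexp (Clog w) = w.
Proof.
  intros Hw. destruct w as [x y]. unfold Re in Hw; simpl in Hw.
  unfold Cexp, Clog, Re, Im; simpl.
  assert (Hm : 0 < Cmod (x, y)).
  { apply Rlt_le_trans with x. exact Hw. eapply Rle_trans. apply Rle_abs. apply (re_le_Cmod (x, y)). }
  rewrite exp_ln by exact Hm.
  rewrite cos_atan, sin_atan.
  assert (E : Cmod (x, y) = x * sqrt (1 + Rsqr (y / x))).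
  { unfold Cmod; simpl. rewrite <- (sqrt_Rsqr x) at 3 by lra.
    rewrite <- sqrt_mult_alt by apply Rle_0_sqr. f_equal. unfold Rsqr. field. lra. }
  assert (P : 0 < sqrt (1 + (y / x)²)).
  { apply sqrt_lt_R0. assert (Q := Rle_0_sqr (y / x)). lra. }
  rewrite E. f_equal; field; lra.
Qed.

Lemma Rcont_Clog (w : C) : 0 < Re w -> Rcont (fun w => ln (Cmod w)) w /\ Rcont (fun w => atan (Im w / Re w)) w.
Proof.
  intros Hw.
  assert (HR : Rcont Re w).
  { intros e He. exists e. split; [exact He|]. intros w' H. eapply Rle_lt_trans. apply (re_le_Cmod (w' - w)). exact H. }
  assert (HI : Rcont Im w).
  { intros e He. exists e. split; [exact He|]. intros w' H. eapply Rle_lt_trans. apply (Im_le_Cmod (w' - w)). exact H. }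
  assert (HM : Rcont Cmod w).
  { intros e He. exists e. split; [exact He|]. intros w' H. eapply Rle_lt_trans. 2: exact H.
    assert (Q1 := Cmod_minus_le w' w). assert (Q2 := Cmod_minus_le w w'). rewrite (Cmod_sym w w') in Q2. apply Rabs_le; lra. }
  assert (Hm : 0 < Cmod w).
  { apply Rlt_le_trans with (Re w). exact Hw. eapply Rle_trans. apply Rle_abs. apply re_le_Cmod. }
  apply Rcont_continuous in HR. apply Rcont_continuous in HI. apply Rcont_continuous in HM.
  split; apply Rcont_continuous.
  - apply (continuous_comp Cmod ln). exact HM. apply continuity_pt_filterlim.
    apply derivable_continuous_pt. exists (/ Cmod w). apply derivable_pt_lim_ln, Hm.
  - apply (continuous_comp (fun w : C => Im w / Re w) atan).
    apply (@continuous_mult C_UniformSpace R_AbsRing Im (fun w => / Re w)). exact HI.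
    apply (continuous_comp Re Rinv). exact HR. apply continuous_Rinv. lra.
    apply continuity_pt_filterlim. apply derivable_continuous_pt. apply derivable_pt_atan.
Qed.

(* Inverse function argument: w' - w = exp a' - exp a = w (a' - a) + o(a' - a). *)
Lemma Cderiv_Clog (w : C) : 0 < Re w -> Cderiv Clog w (/ w)%C.
Proof.
  intros Hw e He.
  assert (Hm : 0 < Cmod w).
  { apply Rlt_le_trans with (Re w). exact Hw. eapply Rle_trans. apply Rle_abs. apply re_le_Cmod. }
  set (m := Cmod w) in *.
  assert (Hw0 : w <> 0) by (apply Cmod_neq_0; exact Hm).
  set (e1 := Rmin (m / 2) (e * (m * m) / 2)).
  assert (He1 : 0 < e1).
  { unfold e1. apply Rmin_pos. lra. apply Rdiv_lt_0_compat; [|lra]. repeat apply Rmult_lt_0_compat; lra. }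
  assert (Q1 : e1 <= m / 2) by apply Rmin_l. assert (Q2 : e1 <= e * (m * m) / 2) by apply Rmin_r.
  destruct (Cderiv_Cexp (Clog w) e1 He1) as [d1 [Hd1 H1]].
  rewrite Cexp_Clog in H1 by exact Hw.
  destruct (Rcont_Clog w Hw) as [C1 C2].
  destruct (C1 (d1 / 2) ltac:(lra)) as [d2 [Hd2 H2]].
  destruct (C2 (d1 / 2) ltac:(lra)) as [d3 [Hd3 H3]].
  exists (Rmin (Re w) (Rmin d2 d3)). split. repeat apply Rmin_pos; lra.
  intros w' Hw'.
  assert (R1 := Rmin_l (Re w) (Rmin d2 d3)). assert (R2 := Rmin_r (Re w) (Rmin d2 d3)).
  assert (R3 := Rmin_l d2 d3). assert (R4 := Rmin_r d2 d3).
  assert (Hw'0 : 0 < Re w').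
  { assert (Q := re_le_Cmod (w' - w)). change (Re (w' - w)%C) with (Re w' - Re w) in Q. apply Rabs_le_between in Q. lra. }
  specialize (H2 w' ltac:(lra)). specialize (H3 w' ltac:(lra)).
  assert (Hd : Cmod (Clog w' - Clog w) < d1).
  { unfold Clog at 1 2. 
    change (Cmod (ln (Cmod w') - ln (Cmod w), atan (Im w' / Re w') - atan (Im w / Re w)) < d1).
    eapply Rle_lt_trans. apply Cmod_le_abs. lra. }
  specialize (H1 _ Hd). rewrite Cexp_Clog in H1 by exact Hw'0.
  set (D := (Clog w' - Clog w)%C) in *.
  assert (HD : Cmod D <= 2 / m * Cmod (w' - w)).
  { assert (T := Cmod_minus_le (w * D) (w' - w)). rewrite Cmod_mult in T. fold m in T.
    rewrite (Cmod_sym (w * D)) in T.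
    assert (Q := Cmod_ge_0 D).
    assert (e1 * Cmod D <= m / 2 * Cmod D) by (apply Rmult_le_compat_r; lra).
    apply (Rmult_le_reg_l (m / 2)). lra. replace (m / 2 * (2 / m * Cmod (w' - w))) with (Cmod (w' - w)) by (field; lra). lra. }
  replace (D - / w * (w' - w))%C with (- ((w' - w - w * D) / w))%C by (field; exact Hw0).
  rewrite Cmod_opp, Cmod_div by exact Hw0. fold m.
  apply (Rmult_le_reg_r m). exact Hm. unfold Rdiv. rewrite Rmult_assoc, Rinv_l, Rmult_1_r by lra.
  apply Rle_trans with (1 := H1).
  apply Rle_trans with (e * (m * m) / 2 * (2 / m * Cmod (w' - w))).
  apply Rmult_le_compat; try lra. apply Cmod_ge_0. right. field. lra.
Qed.

Lemma is_derive_line (F : C -> C) (x : R) (l u : C) : Cderiv F (RtoC x) l ->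
  is_derive (fun t : R => Im (u * F (RtoC t))%C) x (Im (u * l)%C).
Proof.
  intros H. apply is_derive_Reals. intros e He.
  set (k := Cmod u + 1). assert (Hk : 0 < k) by (unfold k; assert (Q := Cmod_ge_0 u); lra).
  destruct (H (e / 2 / k)) as [d [Hd Hd']]. apply Rdiv_lt_0_compat; lra.
  exists (mkposreal d Hd). intros h Hh Hhd. simpl in Hhd.
  assert (E : (RtoC (x + h) - RtoC x)%C = RtoC h) by (rewrite <- RtoC_minus; f_equal; ring).
  specialize (Hd' (RtoC (x + h))). rewrite E, !Cmod_R in Hd'. specialize (Hd' Hhd).
  set (A := (F (RtoC (x + h)) - F (RtoC x) - l * RtoC h)%C) in *.
  replace ((Im (u * F (RtoC (x + h))) - Im (u * F (RtoC x))) / h - Im (u * l)) with (Im (u * A)%C / h).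
  2:{ unfold A. set (p := F (RtoC (x + h))). set (q := F (RtoC x)). destruct u, l, p, q.
      unfold Im, Cminus, Cplus, Copp, Cmult, RtoC; simpl. field. exact Hh. }
  unfold Rdiv. rewrite Rabs_mult, Rabs_inv.
  assert (Hp : 0 < Rabs h) by (apply Rabs_pos_lt, Hh).
  apply (Rmult_lt_reg_r (Rabs h)). exact Hp. rewrite Rmult_assoc, Rinv_l, Rmult_1_r by lra.
  eapply Rle_lt_trans. apply Im_le_Cmod. rewrite Cmod_mult.
  apply Rle_lt_trans with (k * (e / 2 / k * Rabs h)).
  apply Rmult_le_compat; try apply Cmod_ge_0. unfold k; lra. exact Hd'.
  replace (k * (e / 2 / k * Rabs h)) with (e / 2 * Rabs h) by (field; lra).
  apply Rmult_lt_compat_r; lra.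
Qed.

(** With u turning F(b) - F(a) onto the positive imaginary axis, h - Im (u F) has nonnegative
    derivative, and the real mean value theorem applies. It replaces integral estimates of F'
    throughout. *)
Lemma mean_value_ineq (F F' : C -> C) (h h' : R -> R) (a b : R) : a <= b ->
  (forall x, a <= x <= b -> Cderiv F (RtoC x) (F' (RtoC x))) ->
  (forall x, a <= x <= b -> is_derive h x (h' x)) ->
  (forall x, a <= x <= b -> Cmod (F' (RtoC x)) <= h' x) ->
  Cmod (F (RtoC b) - F (RtoC a)) <= h b - h a.
Proof.
  intros Hab HF Hh Hle.
  destruct (unit_Im (F (RtoC b) - F (RtoC a))%C) as [u [Hu Huf]].
  set (phi := fun x : R => h x - Im (u * F (RtoC x))%C).
  assert (D : forall x, a <= x <= b -> is_derive phi x (h' x - Im (u * F' (RtoC x))%C)).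
  { intros x Hx. apply (@is_derive_minus R_AbsRing R_NormedModule). apply Hh, Hx. apply is_derive_line, HF, Hx. }
  destruct (MVT_gen phi a b (fun x => h' x - Im (u * F' (RtoC x))%C)) as [c [Hc Ec]].
  - intros x. rewrite Rmin_left, Rmax_right by exact Hab. intros Hx. apply D; lra.
  - intros x. rewrite Rmin_left, Rmax_right by exact Hab. intros Hx.
    apply continuity_pt_filterlim. apply (@ex_derive_continuous R_AbsRing R_NormedModule). eexists. apply D, Hx.
  - rewrite Rmin_left, Rmax_right in Hc by exact Hab.
    assert (0 <= h' c - Im (u * F' (RtoC c))%C).
    { assert (Q := Hle c Hc). assert (Q2 := Im_le_Cmod (u * F' (RtoC c))). rewrite Cmod_mult, Hu in Q2.
      apply Rabs_le_between in Q2. lra. }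
    assert (0 <= phi b - phi a). { rewrite Ec. apply Rmult_le_pos; lra. }
    unfold phi in H0.
    assert (E : Im (u * (F (RtoC b) - F (RtoC a)))%C = Im (u * F (RtoC b))%C - Im (u * F (RtoC a))%C).
    { set (p := F (RtoC b)). set (q := F (RtoC a)). destruct u, p, q.
      unfold Im, Cminus, Cplus, Copp, Cmult; simpl. ring. }
    rewrite Huf in E.
    replace (Im (Ci * RtoC (Cmod (F b - F a)%C))%C) with (Cmod (F b - F a)%C) in E.
    2:{ unfold Ci, RtoC, Cmult, Im; simpl. ring. }
    lra.
Qed.

Lemma Clog_1 : Clog 1 = 0.
Proof. unfold Clog. rewrite Cmod_1, ln_1. unfold Re, Im, RtoC; simpl. rewrite Rdiv_0_l, atan_0. reflexivity. Qed.

Lemma Re_ge_1_minus (x : R) (u : C) : 0 <= x <= 1 -> Cmod u < 1 -> 0 < Re (1 - x * u)%C.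
Proof.
  intros Hx Hu. assert (Q := re_le_Cmod u). apply Rabs_le_between in Q.
  replace (Re (1 - x * u)%C) with (1 - x * Re u) by (destruct u; unfold Re, Cminus, Cplus, Copp, Cmult, RtoC; simpl; ring).
  nra.
Qed.

(** Along x u the derivative - u / (1 - x u) is dominated by |u| / (1 - x |u|), the derivative of -
    ln (1 - x |u|). It is used for the Euler factors and for values near 1. *)
Lemma Clog_1_minus (u : C) : Cmod u < 1 -> Cmod (Clog (1 - u)) <= - ln (1 - Cmod u).
Proof.
  intros Hu. assert (H0 := Cmod_ge_0 u).
  assert (H := mean_value_ineq (fun x => Clog (1 - x * u))%C (fun x => / (1 - x * u) * - u)%C
    (fun x => - ln (1 - x * Cmod u)) (fun x => / (1 - x * Cmod u) * Cmod u) 0 1 ltac:(lra)).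
  cbv beta in H. replace (1 - 1 * u)%C with (1 - u)%C in H by ring.
  replace (1 - 0 * u)%C with (RtoC 1) in H by ring.
  rewrite Clog_1 in H. replace (Clog (1 - u) - 0)%C with (Clog (1 - u)) in H by ring.
  rewrite Rmult_1_l, Rmult_0_l, Rminus_0_r, ln_1, Ropp_0, Rminus_0_r in H.
  apply H; intros x Hx.
  - apply (Cderiv_comp Clog (fun x => 1 - x * u)%C).
    eapply Cderiv_eq. apply Cderiv_minus. apply (Cderiv_const 1). apply (Cderiv_mult (fun x => x) (fun _ => u)).
    apply Cderiv_id. apply Cderiv_const. ring.
    apply Cderiv_Clog. apply Re_ge_1_minus; assumption.
  - auto_derive. nra. field. nra.
  - assert (Hne : (1 - x * u)%C <> 0).
    { assert (Q := Re_ge_1_minus x u Hx Hu). intros E. rewrite E in Q. unfold Re, RtoC in Q; simpl in Q. lra. }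
    rewrite Cmod_mult, Cmod_opp, Cmod_inv by exact Hne.
    apply Rmult_le_compat_r. exact H0. apply Rinv_le_contravar. nra.
    assert (Q := Cmod_minus_le 1 (x * u)). rewrite Cmod_1, Cmod_mult, Cmod_R, Rabs_pos_eq in Q by lra. exact Q.
Qed.

(** Here |a - b| < |c| / 2 and |b| > 3 |c| / 4, so a / b is within distance 1 of 1. *)
Lemma Re_ratio (a b c : C) : Cmod (a - c) < Cmod c / 4 -> Cmod (b - c) < Cmod c / 4 -> 0 < Re (a / b)%C.
Proof.
  intros Ha Hb.
  assert (Hc : 0 < Cmod c) by (assert (Q := Cmod_ge_0 (a - c)); lra).
  assert (B : 3 / 4 * Cmod c < Cmod b). { assert (Q := Cmod_minus_le c b). rewrite (Cmod_sym c b) in Q. lra. }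
  assert (Hb0 : b <> 0) by (apply Cmod_neq_0; lra).
  assert (T := Cmod_triangle (a - c) (c - b)). replace (a - c + (c - b))%C with (a - b)%C in T by ring.
  rewrite (Cmod_sym c b) in T.
  assert (Hab : Cmod ((a - b) / b) < 1).
  { rewrite Cmod_div by exact Hb0. apply (Rmult_lt_reg_r (Cmod b)). lra. unfold Rdiv. rewrite Rmult_assoc, Rinv_l; lra. }
  assert (Q := re_le_Cmod ((a - b) / b)). apply Rabs_le_between in Q.
  replace (a / b)%C with (1 + (a - b) / b)%C by (field; exact Hb0).
  change (0 < 1 + Re ((a - b) / b)%C). lra.
Qed.

(** Multiplication by -1, i or -i brings w into the right half-plane, where [Clog] applies. *)
Lemma Clog_exists (w : C) : w <> 0 -> exists l, Cexp l = w.
Proof.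
  intros Hw.
  assert (E1 : Cexp (0, PI) = (- (1))%C).
  { unfold Cexp, Re, Im; simpl. rewrite exp_0, cos_PI, sin_PI. unfold Copp, RtoC; simpl. f_equal; ring. }
  assert (E2 : Cexp (0, PI / 2) = Ci).
  { unfold Cexp, Re, Im; simpl. rewrite exp_0, cos_PI2, sin_PI2. unfold Ci; simpl. f_equal; ring. }
  assert (Ci2 : (Ci * Ci = - (1))%C) by (unfold Ci, Cmult, Copp, RtoC; simpl; f_equal; ring).
  destruct (Rtotal_order (Re w) 0) as [H|[H|H]].
  - exists (Clog (- w) + (0, PI))%C. rewrite Cexp_plus, E1, Cexp_Clog. ring.
    change (0 < - Re w). lra.
  - destruct (Rtotal_order (Im w) 0) as [I|[I|I]].
    + exists (Clog (Ci * w) + ((0, (PI / 2)%R) + (0, PI)))%C. rewrite !Cexp_plus, E1, E2, Cexp_Clog.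
      replace (Ci * w * (Ci * - (1)))%C with ((Ci * Ci) * - w)%C by ring. rewrite Ci2. ring.
      destruct w as [x y]. unfold Re, Im, Ci, Cmult in *; simpl in *. lra.
    + exfalso. apply Hw. destruct w as [x y]. unfold Re, Im, RtoC in *; simpl in *. subst; reflexivity.
    + exists (Clog (- (Ci * w)) + (0, (PI / 2)%R))%C. rewrite !Cexp_plus, E2, Cexp_Clog.
      replace (- (Ci * w) * Ci)%C with ((Ci * Ci) * - w)%C by ring. rewrite Ci2. ring.
      destruct w as [x y]. unfold Re, Im, Ci, Cmult, Copp in *; simpl in *. lra.
  - exists (Clog w). apply Cexp_Clog, H.
Qed.

Fixpoint Csum (f : nat -> C) (n : nat) : C :=
  match n with O => RtoC 0 | S n => (Csum f n + f n)%C end.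

Lemma Chol_Csum (f : nat -> C -> C) (z : C) (n : nat) : (forall k, (k < n)%nat -> Chol (f k) z) ->
  Chol (fun w => Csum (fun k => f k w) n) z.
Proof.
  induction n as [|n IH]; intros H. apply (Chol_const 0).
  simpl. apply (Chol_plus (fun w => Csum (fun k => f k w) n)). apply IH. intros; apply H; lia. apply H; lia.
Qed.

(* L is a sum of principal logarithms of quotients of values of f along the segment from a
   base point to z, with a mesh so fine that each quotient has positive real part. *)
Lemma log_on_box (f : C -> C) (a b c d : R) : a <= b -> c <= d ->
  (forall z, box a b c d z -> Chol f z /\ f z <> 0) ->
  exists L, forall z, box a b c d z -> Chol L z /\ Cexp (L z) = f z.
Proof.
  intros Hab Hcd Hf.
  assert (G : forall u v : R, exists dl : posreal, box a b c d (u, v) ->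
    forall w, Cmod (w - (u, v)) < 4 * dl -> Cmod (f w - f (u, v)) < Cmod (f (u, v)) / 4).
  { intros u v. destruct (classic (box a b c d (u, v))) as [H|H].
    - destruct (Hf _ H) as [H1 H2]. apply Cmod_gt_0 in H2.
      destruct (Chol_cont f _ H1 (Cmod (f (u, v)) / 4) ltac:(lra)) as [e [He H3]].
      exists (mkposreal (e / 4) ltac:(lra)). intros _ w Hw. simpl in Hw. apply H3. lra.
    - exists (mkposreal 1 Rlt_0_1). intros; contradiction. }
  set (g := fun u v => proj1_sig (constructive_indefinite_description _ (G u v))).
  assert (Hg : forall u v, box a b c d (u, v) ->
    forall w, Cmod (w - (u, v)) < 4 * g u v -> Cmod (f w - f (u, v)) < Cmod (f (u, v)) / 4).
  { intros u v. unfold g. exact (proj2_sig (constructive_indefinite_description _ (G u v))). }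
  (* A Lebesgue number for the gauge: z is within 2 g of some (u, v) and w within g of z, so both
     lie in the disc of radius 4 g on which f varies by less than a quarter of |f(u, v)|. *)
  destruct (compactness_value_2d a b c d g) as [dl Hdl].
  assert (Hr : forall z w, box a b c d z -> Cmod (w - z) < dl -> 0 < Re (f w / f z)%C).
  { intros [x y] w [Hx Hy] Hw. simpl in Hx, Hy. apply NNPP. intros N.
    apply (Hdl x y Hx Hy). intros [u [v [Hu [Hv [H1 [H2 H3]]]]]]. apply N.
    assert (Hz : Cmod ((x, y) - (u, v)) < 2 * g u v).
    { change ((x, y) - (u, v))%C with (x - u, y - v). eapply Rle_lt_trans. apply Cmod_le_abs. lra. }
    assert (Hgp := cond_pos (g u v)).
    apply (Re_ratio _ _ (f (u, v))); apply Hg; try (split; assumption).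
    - assert (T := Cmod_triangle (w - (x, y)) ((x, y) - (u, v))).
      replace (w - (x, y) + ((x, y) - (u, v)))%C with (w - (u, v))%C in T by ring. lra.
    - lra. }
  set (z0 := (a, c) : C).
  assert (Hz0 : box a b c d z0) by (split; simpl; lra).
  set (M := b - a + (d - c)).
  assert (HM : forall z, box a b c d z -> Cmod (z - z0) <= M).
  { intros [x y] [Hx Hy]. simpl in Hx, Hy. unfold z0. change ((x, y) - (a, c))%C with (x - a, y - c).
    eapply Rle_trans. apply Cmod_le_abs. rewrite !Rabs_pos_eq by lra. unfold M. lra. }
  destruct (nfloor_ex (M / dl)) as [N [_ HN]].
  { apply Rmult_le_pos. unfold M; lra. left; apply Rinv_0_lt_compat, cond_pos. }
  rewrite <- S_INR in HN. set (n := S N) in *.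
  assert (Hn : 0 < INR n) by (apply lt_0_INR; unfold n; lia).
  set (p := fun (k : nat) (z : C) => (z0 + RtoC (INR k / INR n) * (z - z0))%C).
  assert (Hp : forall k z, (k <= n)%nat -> box a b c d z -> box a b c d (p k z)).
  { intros k [x y] Hk [Hx Hy]. simpl in Hx, Hy. unfold p, z0.
    assert (0 <= INR k / INR n <= 1).
    { split. apply Rmult_le_pos. apply pos_INR. left; apply Rinv_0_lt_compat, Hn.
      apply (Rmult_le_reg_r (INR n)). exact Hn. unfold Rdiv. rewrite Rmult_assoc, Rinv_l by lra.
      assert (Q := le_INR _ _ Hk). lra. }
    set (q := INR k / INR n) in *.
    replace ((a, c) + q * ((x, y) - (a, c)))%C with (a + q * (x - a), c + q * (y - c)).
    2:{ unfold Cminus, Cplus, Copp, Cmult, RtoC; simpl; f_equal; ring. }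
    split; simpl; nra. }
  assert (Hstep : forall k z, (k < n)%nat -> box a b c d z -> 0 < Re (f (p (S k) z) / f (p k z))%C).
  { intros k z Hk Hz. apply Hr. apply Hp; [lia | exact Hz].
    replace (p (S k) z - p k z)%C with (RtoC (/ INR n) * (z - z0))%C.
    2:{ unfold p. rewrite S_INR.
        replace ((INR k + 1) / INR n) with (INR k / INR n + / INR n) by (field; lra). rewrite RtoC_plus. ring. }
    rewrite Cmod_mult, Cmod_R, Rabs_pos_eq by (left; apply Rinv_0_lt_compat, Hn).
    apply (Rmult_lt_reg_l (INR n)). exact Hn. rewrite <- Rmult_assoc, Rinv_r, Rmult_1_l by lra.
    apply Rle_lt_trans with M. apply HM, Hz. 
    apply (Rmult_lt_compat_r dl) in HN. 2: apply cond_pos.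
    unfold Rdiv in HN. rewrite Rmult_assoc, Rinv_l, Rmult_1_r in HN. exact HN. apply Rgt_not_eq, cond_pos. }
  destruct (Hf z0 Hz0) as [_ Hfz0].
  destruct (Clog_exists (f z0) Hfz0) as [l0 Hl0].
  exists (fun z => l0 + Csum (fun k => Clog (f (p (S k) z) / f (p k z))) n)%C.
  intros z Hz. split.
  - apply (Chol_plus (fun _ => l0)). apply Chol_const.
    apply (Chol_Csum (fun k z => Clog (f (p (S k) z) / f (p k z))%C)). intros k Hk.
    assert (Hpk : forall j, Chol (p j) z).
    { intros j. unfold p. apply (Chol_plus (fun _ => z0)). apply Chol_const.
      apply (Chol_mult (fun _ => RtoC (INR j / INR n))). apply Chol_const.
      apply (Chol_minus (fun w => w)). apply Chol_id. apply Chol_const. }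
    apply (Chol_comp Clog (fun z => f (p (S k) z) / f (p k z))%C).
    apply (Chol_div (fun z => f (p (S k) z)) (fun z => f (p k z))).
    apply Hf, Hp; [lia | exact Hz].
    apply (Chol_comp f (p (S k))). apply Hpk. apply Hf, Hp; [lia | exact Hz].
    apply (Chol_comp f (p k)). apply Hpk. apply Hf, Hp; [lia | exact Hz].
    eexists. apply Cderiv_Clog. apply Hstep; assumption.
  (* The quotients telescope, so the sum of the first m logarithms is a logarithm of f at the m-th
     point of the segment. *)
  - assert (T : forall m, (m <= n)%nat -> Cexp (l0 + Csum (fun k => Clog (f (p (S k) z) / f (p k z))) m)%C = f (p m z)).
    { induction m as [|m IH]; intros Hm.
      - simpl. replace (l0 + 0)%C with l0 by ring. rewrite Hl0. f_equal. unfold p. simpl INR. rewrite Rdiv_0_l. ring.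
      - simpl Csum. rewrite Cplus_assoc, Cexp_plus, IH by lia. rewrite Cexp_Clog by (apply Hstep; [lia|exact Hz]).
        field. apply Hf, Hp; [lia | exact Hz]. }
    rewrite T by lia. f_equal. unfold p. replace (INR n / INR n) with 1 by (field; lra). ring.
Qed.

Lemma Cexp_eq_1_small (z : C) : Cexp z = 1 -> Rabs (Im z) < PI -> z = 0.
Proof.
  intros H Hi. assert (HP := PI_RGT_0).
  assert (E : Cmod (Cexp z) = 1) by (rewrite H; apply Cmod_1).
  rewrite Cmod_Cexp in E.
  assert (Er : Re z = 0) by (rewrite <- (ln_exp (Re z)), E; apply ln_1).
  destruct z as [x y]. unfold Re, Im in *. simpl in *. subst x.
  unfold Cexp in H. unfold Re, Im in H; simpl in H. rewrite exp_0, !Rmult_1_l in H.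
  assert (Hc := f_equal fst H). assert (Hs := f_equal snd H). simpl in Hc, Hs.
  assert (y = 0). 2: { subst y; reflexivity. }
  apply Rabs_def2 in Hi. destruct (Rtotal_order y 0) as [L|[E0|L]]. 2: exact E0.
  - assert (0 < sin (- y)) by (apply sin_gt_0; lra). rewrite sin_neg in H0. lra.
  - assert (0 < sin y) by (apply sin_gt_0; lra). lra.
Qed.

(** Along the segment D takes values in 2 pi i Z. If |Im D| reached pi at the end, it would equal pi
    / 2 somewhere by continuity, which no such value allows. *)
Lemma log_unique_on_segment (D : C -> C) (z0 z1 : C) :
  (forall x, 0 <= x <= 1 -> Chol D (z0 + RtoC x * (z1 - z0))%C) ->
  (forall x, 0 <= x <= 1 -> Cexp (D (z0 + RtoC x * (z1 - z0))%C) = 1) ->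
  D z0 = 0 -> D z1 = 0.
Proof.
  intros HD HE H0.
  set (g := fun x : R => Im (1 * D (z0 + RtoC x * (z1 - z0)))%C).
  assert (Hz : D z1 = D (z0 + RtoC 1 * (z1 - z0))%C) by (f_equal; ring).
  assert (HP := PI_RGT_0).
  assert (Hg : forall x, 0 <= x <= 1 -> continuity_pt g x).
  { intros x Hx. destruct (HD x Hx) as [l Hl].
    apply continuity_pt_filterlim. apply (@ex_derive_continuous R_AbsRing R_NormedModule). eexists.
    apply (is_derive_line (fun w => D (z0 + w * (z1 - z0))%C)).
    apply (Cderiv_comp D (fun w => z0 + w * (z1 - z0))%C). 2: exact Hl.
    apply Cderiv_plus. apply (Cderiv_const z0). apply (Cderiv_mult (fun w => w) (fun _ => (z1 - z0)%C)).
    apply Cderiv_id. apply Cderiv_const. }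
  assert (G0 : g 0 = 0).
  { unfold g. replace (z0 + 0 * (z1 - z0))%C with z0 by ring. rewrite H0. unfold Im, Cmult, RtoC; simpl; ring. }
  assert (Eg : forall x, g x = Im (D (z0 + RtoC x * (z1 - z0))%C)).
  { intros x. unfold g. rewrite Cmult_1_l. reflexivity. }
  destruct (Rlt_le_dec (Rabs (g 1)) PI) as [L|L].
  - rewrite Hz. apply Cexp_eq_1_small. apply HE; lra. rewrite <- Eg. exact L.
  - exfalso.
    set (h := fun x => Rsqr (g x) - Rsqr (PI / 2)).
    destruct (IVT_interv h 0 1) as [x [Hx Ex]].
    + intros x Hx. unfold h. apply (continuity_pt_minus (fun x => Rsqr (g x)) (fun _ => Rsqr (PI / 2))).
      apply (continuity_pt_mult g g); apply Hg, Hx. apply continuity_pt_const. intros ? ?; reflexivity.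
    + lra.
    + unfold h. rewrite G0. unfold Rsqr. nra.
    + unfold h. rewrite (Rsqr_abs (g 1)). unfold Rsqr. nra.
    + assert (Q : Rabs (g x) = PI / 2).
      { unfold h in Ex. apply Rminus_diag_uniq in Ex. apply Rsqr_eq_abs_0 in Ex. rewrite Ex. apply Rabs_pos_eq; lra. }
      assert (Z : D (z0 + RtoC x * (z1 - z0))%C = 0).
      { apply Cexp_eq_1_small. apply HE, Hx. rewrite <- Eg, Q. lra. }
      rewrite Eg, Z in Q. unfold Im, RtoC in Q; simpl in Q. rewrite Rabs_R0 in Q. lra.
Qed.

(** * Zeta to the right of the critical line *)

Lemma Csum_sum_n (a : nat -> C) (n : nat) : @sum_n C_NormedModule a n = Csum a (S n).
Proof.
  induction n as [|n IH].
  - rewrite sum_O. simpl. ring.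
  - rewrite sum_Sn, IH. reflexivity.
Qed.

Lemma is_series_Csum (a : nat -> C) (l : C) : @is_series C_AbsRing C_NormedModule a l ->
  forall e, 0 < e -> exists N, forall n, (N <= n)%nat -> Cmod (Csum a n - l) < e.
Proof.
  intros H e He. unfold is_series in H.
  apply (proj1 (filterlim_locally_ball_norm _ _)) with (eps := mkposreal e He) in H.
  destruct H as [N HN]. exists (S N). intros [|n] Hn. lia.
  rewrite <- Csum_sum_n. apply HN. lia.
Qed.

(** The Dirichlet monomial n^(-s), in the form that the series in [is_riemann_zeta] has. *)
Definition npow (n : nat) (s : C) : C := (/ Rcpow (INR n) s)%C.

Lemma npow_Cexp (n : nat) (s : C) : npow n s = Cexp (- s * RtoC (ln (INR n))).
Proof. unfold npow, Rcpow. rewrite <- Cexp_opp. f_equal. ring. Qed.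

Lemma Cmod_npow (n : nat) (s : C) : Cmod (npow n s) = exp (- Re s * ln (INR n)).
Proof. rewrite npow_Cexp, Cmod_Cexp, re_scal_r. reflexivity. Qed.

(** The lowest-order Euler-Maclaurin approximant: the added M^(1-s) / (s-1) is the continuation of
    the integral of x^(-s) over x >= M, and makes the sequence converge left of 1. *)
Definition zeta_approx (M : nat) (s : C) : C :=
  (Csum (fun k => npow (S k) s) M + Cexp ((1 - s) * RtoC (ln (INR M))) / (s - 1))%C.

Lemma Chol_npow (n : nat) (z : C) : Chol (npow n) z.
Proof.
  destruct (Chol_exp (fun s => - s * RtoC (ln (INR n)))%C z) as [l Hl].
  - apply (Chol_mult (fun s => - s)%C (fun _ => RtoC (ln (INR n)))). apply (Chol_opp (fun s => s)), Chol_id. apply Chol_const.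
  - exists l. eapply Cderiv_ext. 2: exact Hl. intros w. symmetry. apply npow_Cexp.
Qed.

Lemma Chol_zeta_approx (M : nat) (z : C) : z <> 1 -> Chol (zeta_approx M) z.
Proof.
  intros Hz. unfold zeta_approx.
  apply (Chol_plus (fun s => Csum (fun k => npow (S k) s) M) (fun s => Cexp ((1 - s) * RtoC (ln (INR M))) / (s - 1))%C).
  - apply (Chol_Csum (fun k s => npow (S k) s)). intros k _. apply Chol_npow.
  - apply (Chol_div (fun s => Cexp ((1 - s) * RtoC (ln (INR M))))%C (fun s => s - 1)%C).
    + intros E. apply Hz. replace z with ((z - 1) + 1)%C by ring. rewrite E. ring.
    + apply (Chol_exp (fun s => (1 - s) * RtoC (ln (INR M)))%C).
      apply (Chol_mult (fun s => 1 - s)%C (fun _ => RtoC (ln (INR M)))).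
      apply (Chol_minus (fun _ => RtoC 1) (fun s => s)). apply Chol_const. apply Chol_id. apply Chol_const.
    + apply (Chol_minus (fun s => s)). apply Chol_id. apply Chol_const.
Qed.

Lemma exp_lin_lip (s : C) (a b : R) : a <= b -> 0 <= Re s ->
  Cmod (Cexp (- s * RtoC b) - Cexp (- s * RtoC a)) <= Cmod s * exp (- Re s * a) * (b - a).
Proof.
  intros Hab Hs.
  replace (Cmod s * exp (- Re s * a) * (b - a)) with
    (Cmod s * exp (- Re s * a) * b - Cmod s * exp (- Re s * a) * a) by ring.
  apply (mean_value_ineq (fun y => Cexp (- s * y)) (fun y => Cexp (- s * y) * - s)%C
     (fun y => Cmod s * exp (- Re s * a) * y) (fun _ => Cmod s * exp (- Re s * a))).
  - exact Hab.
  - intros x _. apply (Cderiv_exp (fun y => - s * y)%C).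
    eapply Cderiv_eq. apply Cderiv_scal. apply Cderiv_id. ring.
  - intros x _. auto_derive. exact I. ring.
  - intros x Hx. rewrite Cmod_mult, Cmod_opp, Cmod_Cexp, re_scal_r. change (Re (- s)%C) with (- Re s).
    rewrite Rmult_comm. apply Rmult_le_compat_l. apply Cmod_ge_0. apply exp_le. nra.
Qed.

(** The difference is minus the integral of x^(-s) - (M+1)^(-s) over [M, M+1]. In the variable y =
    ln x the integrand has the primitive [F], and the bound is the length of the interval times the
    variation of x^(-s), at most |s| / (M sqrt M). *)
Lemma zeta_approx_step (M : nat) (s : C) : (1 <= M)%nat -> 1 / 2 <= Re s -> s <> 1 ->
  Cmod (zeta_approx (S M) s - zeta_approx M s) <= Cmod s / (INR M * sqrt (INR M)).
Proof.
  intros HM Hs Hs1.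
  assert (HM1 : 1 <= INR M) by (apply (le_INR 1); exact HM).
  set (a := ln (INR M)). set (b := ln (INR (S M))).
  assert (Ea : exp a = INR M) by (apply exp_ln; lra).
  assert (Eb : exp b = INR M + 1) by (unfold b; rewrite S_INR; apply exp_ln; lra).
  assert (Hab : a <= b). { unfold a, b. left. apply ln_increasing; rewrite ?S_INR; lra. }
  assert (Hba : b - a <= / INR M).
  { unfold a, b. rewrite <- ln_div by (rewrite ?S_INR; lra).
    assert (Q := exp_ineq1_le (/ INR M)). rewrite <- (ln_exp (/ INR M)). apply ln_le.
    apply Rdiv_lt_0_compat; rewrite ?S_INR; lra.
    rewrite S_INR. replace ((INR M + 1) / INR M) with (1 + / INR M) by (field; lra). exact Q. }
  assert (Hs10 : (s - 1)%C <> 0).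
  { intros E. apply Hs1. replace s with ((s - 1) + 1)%C by ring. rewrite E. ring. }
  assert (H1s0 : (1 - s)%C <> 0).
  { intros E. apply Hs10. replace (s - 1)%C with (- (1 - s))%C by ring. rewrite E. ring. }
  set (c := npow (S M) s).
  set (F := fun y : C => (Cexp ((1 - s) * y) / (1 - s) - Cexp y * c)%C).
  assert (E : (zeta_approx (S M) s - zeta_approx M s = - (F (RtoC b) - F (RtoC a)))%C).
  { unfold zeta_approx, F. simpl Csum. fold a b c.
    assert (X1 : Cexp (RtoC b) = RtoC (INR M + 1)).
    { unfold Cexp. rewrite re_RtoC, im_RtoC, cos_0, sin_0, Eb. unfold RtoC. f_equal; ring. }
    assert (X2 : Cexp (RtoC a) = RtoC (INR M)).
    { unfold Cexp. rewrite re_RtoC, im_RtoC, cos_0, sin_0, Ea. unfold RtoC. f_equal; ring. }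
    rewrite X1, X2, RtoC_plus. field. split; assumption. }
  rewrite E, Cmod_opp.
  assert (S0 : 0 <= Cmod s) by apply Cmod_ge_0.
  set (k := Cmod s * exp (- Re s * a) * (b - a)).
  assert (Hk : Cmod (F (RtoC b) - F (RtoC a)) <= k * exp b - k * exp a).
  { apply (mean_value_ineq F (fun y => Cexp y * (Cexp (- s * y) - c))%C (fun y => k * exp y) (fun y => k * exp y)).
    - exact Hab.
    - intros x _. unfold F.
      eapply Cderiv_eq. apply (Cderiv_minus (fun y => Cexp ((1 - s) * y) / (1 - s))%C (fun y => Cexp y * c)%C).
      apply (Cderiv_mult (fun y => Cexp ((1 - s) * y)) (fun _ => / (1 - s)))%C.
      apply (Cderiv_exp (fun y => (1 - s) * y)%C). apply Cderiv_scal. apply Cderiv_id. apply Cderiv_const.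
      apply (Cderiv_mult Cexp (fun _ => c)). apply Cderiv_Cexp. apply Cderiv_const.
      replace ((1 - s) * RtoC x)%C with (RtoC x + (- s) * RtoC x)%C by ring. rewrite Cexp_plus. field. exact H1s0.
    - intros x _. auto_derive. exact I. ring.
    - intros x Hx. rewrite Cmod_mult, Cmod_Cexp, re_RtoC. rewrite Rmult_comm.
      apply Rmult_le_compat_r. left; apply exp_pos.
      unfold c. rewrite npow_Cexp. fold b. rewrite Cmod_sym.
      eapply Rle_trans. apply exp_lin_lip; lra. unfold k.
      apply Rle_trans with (Cmod s * exp (- Re s * a) * (b - x)).
      apply Rmult_le_compat_r. lra. apply Rmult_le_compat_l. exact S0. apply exp_le. nra.
      apply Rmult_le_compat_l. apply Rmult_le_pos. exact S0. left; apply exp_pos. lra. }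
  eapply Rle_trans. exact Hk. rewrite Ea, Eb.
  assert (Hq : exp (- Re s * a) <= / sqrt (INR M)).
  { rewrite <- Rpower_sqrt by lra. rewrite <- Rpower_Ropp. unfold Rpower. fold a. apply exp_le.
    assert (0 <= a). { unfold a. rewrite <- ln_1. apply ln_le; lra. } nra. }
  assert (Hsq : 0 < sqrt (INR M)) by (apply sqrt_lt_R0; lra).
  unfold k. replace (Cmod s * exp (- Re s * a) * (b - a) * (INR M + 1) - Cmod s * exp (- Re s * a) * (b - a) * INR M)
    with (Cmod s * (exp (- Re s * a) * (b - a))) by ring.
  unfold Rdiv. apply Rmult_le_compat_l. exact S0.
  rewrite Rinv_mult, Rmult_comm. apply Rmult_le_compat; try lra. left; apply exp_pos.
Qed.

(** For M >= 2 one has sqrt (M+1) <= 1.25 sqrt M, and 1.25 * 2.25 < 3. *)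
Lemma inv_sqrt_telescope (M : nat) : (2 <= M)%nat ->
  / (INR M * sqrt (INR M)) <= 3 * (/ sqrt (INR M) - / sqrt (INR (S M))).
Proof.
  intros HM. assert (HM1 : 2 <= INR M) by (apply (le_INR 2); exact HM).
  rewrite S_INR. set (m := INR M) in *.
  set (u := sqrt m). set (v := sqrt (m + 1)).
  assert (Hu : 0 < u) by (apply sqrt_lt_R0; lra). assert (Hv : 0 < v) by (apply sqrt_lt_R0; lra).
  assert (Eu : u * u = m) by (apply sqrt_sqrt; lra). assert (Ev : v * v = m + 1) by (apply sqrt_sqrt; lra).
  rewrite <- Eu. 
  assert (Hvu : v <= 1.25 * u).
  { apply Rsqr_incr_0; try lra. unfold Rsqr. nra. }
  apply (Rmult_le_reg_r (u * u * u * v)). repeat apply Rmult_lt_0_compat; lra.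
  replace (/ (u * u * u) * (u * u * u * v)) with v by (field; lra).
  replace (3 * (/ u - / v) * (u * u * u * v)) with (3 * (u * u) * (v - u)) by (field; lra).
  assert (Hd : v - u = / (v + u)).
  { apply (Rmult_eq_reg_r (v + u)). 2: lra. rewrite Rinv_l by lra. lra. }
  rewrite Hd. apply (Rmult_le_reg_r (v + u)). lra. rewrite Rmult_assoc, Rinv_l by lra. nra.
Qed.

Lemma zeta_approx_tail (M k : nat) (s : C) : (2 <= M)%nat -> 1 / 2 <= Re s -> s <> 1 ->
  Cmod (zeta_approx (M + k) s - zeta_approx M s) <= 3 * Cmod s / sqrt (INR M).
Proof.
  intros HM Hs Hs1.
  assert (S0 := Cmod_ge_0 s).
  apply Rle_trans with (3 * Cmod s * (/ sqrt (INR M) - / sqrt (INR (M + k)))).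
  - induction k as [|k IH].
    + rewrite Nat.add_0_r. replace (zeta_approx M s - zeta_approx M s)%C with (RtoC 0) by ring. rewrite Cmod_0. lra.
    + rewrite Nat.add_succ_r.
      replace (zeta_approx (S (M + k)) s - zeta_approx M s)%C with ((zeta_approx (S (M + k)) s - zeta_approx (M + k) s) + (zeta_approx (M + k) s - zeta_approx M s))%C by ring.
      eapply Rle_trans. apply Cmod_triangle.
      assert (A := zeta_approx_step (M + k) s ltac:(lia) Hs Hs1).
      assert (T := inv_sqrt_telescope (M + k) ltac:(lia)).
      apply (Rmult_le_compat_l (Cmod s)) in T; [|exact S0]. unfold Rdiv in A. lra.
  - assert (0 < INR (M + k)) by (apply lt_0_INR; lia).
    assert (0 < / sqrt (INR (M + k))) by (apply Rinv_0_lt_compat, sqrt_lt_R0; assumption).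
    unfold Rdiv. apply Rmult_le_compat_l; lra.
Qed.

Lemma inv_sqrt_small (K e : R) : 0 <= K -> 0 < e -> exists N, forall n, (N <= n)%nat -> (0 < n)%nat /\ K / sqrt (INR n) <= e.
Proof.
  intros HK He.
  destruct (nfloor_ex (Rsqr (K / e))) as [N [_ HN]]. apply Rle_0_sqr.
  exists (S N). intros n Hn. split. lia.
  assert (Hn' : INR N + 1 <= INR n) by (rewrite <- S_INR; apply le_INR, Hn).
  assert (HN0 := pos_INR N).
  assert (Hs : 0 < sqrt (INR n)) by (apply sqrt_lt_R0; lra).
  apply (Rmult_le_reg_r (sqrt (INR n))). exact Hs. unfold Rdiv. rewrite Rmult_assoc, Rinv_l, Rmult_1_r by lra.
  assert (K / e <= sqrt (INR n)).
  { rewrite <- (sqrt_Rsqr (K / e)). apply sqrt_le_1_alt. lra. apply Rmult_le_pos. exact HK. left; apply Rinv_0_lt_compat, He. }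
  apply (Rmult_le_compat_l e) in H; [|lra]. replace (e * (K / e)) with K in H by (field; lra). exact H.
Qed.

Section Zeta.
Variable zeta : C -> C.
Hypothesis Hzeta : is_riemann_zeta zeta.

Lemma zeta_Chol (z : C) : z <> 1 -> Chol zeta z.
Proof. intros Hz. apply ex_derive_Chol. apply (proj1 Hzeta). exact Hz. Qed.

Lemma zeta_series (s : C) : 1 < Re s -> @is_series C_AbsRing C_NormedModule (fun k => npow (S k) s) (zeta s).
Proof. apply (proj2 Hzeta). Qed.

(** The Dirichlet series converges here and n^(1-s) / (s-1) tends to 0, so the tail estimate passes
    to the limit. *)
Lemma zeta_minus_approx_right (M : nat) (s : C) : (2 <= M)%nat -> 3 / 2 <= Re s ->
  Cmod (zeta s - zeta_approx M s) <= 3 * Cmod s / sqrt (INR M).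
Proof.
  intros HM Hs. apply le_epsilon. intros e He.
  assert (Hs1 : s <> 1). { intros E. rewrite E, re_RtoC in Hs. lra. }
  assert (Hs10 : (s - 1)%C <> 0).
  { intros E. apply Hs1. replace s with ((s - 1) + 1)%C by ring. rewrite E. ring. }
  destruct (is_series_Csum _ _ (zeta_series s ltac:(lra)) (e / 2) ltac:(lra)) as [N1 H1].
  assert (Hq : 0 < / Cmod (s - 1)) by (apply Rinv_0_lt_compat, Cmod_gt_0, Hs10).
  destruct (inv_sqrt_small (/ Cmod (s - 1)) (e / 2) ltac:(lra) ltac:(lra)) as [N2 H2].
  set (k := (N1 + N2)%nat). set (n := (M + k)%nat).
  specialize (H1 n ltac:(unfold n, k; lia)). specialize (H2 n ltac:(unfold n, k; lia)). destruct H2 as [Hn H2].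
  assert (T := zeta_approx_tail M k s HM ltac:(lra) Hs1). fold n in T.
  assert (Hn1 : 1 <= INR n) by (apply (le_INR 1); lia).
  assert (E : Cmod (Cexp ((1 - s) * RtoC (ln (INR n))) / (s - 1)) <= e / 2).
  { eapply Rle_trans. 2: exact H2. rewrite Cmod_div by exact Hs10. unfold Rdiv. rewrite Rmult_comm.
    apply Rmult_le_compat_l. lra. rewrite Cmod_Cexp, re_scal_r. change (Re (1 - s)%C) with (1 - Re s).
    rewrite <- Rpower_sqrt by lra. rewrite <- Rpower_Ropp. unfold Rpower. apply exp_le.
    assert (0 <= ln (INR n)). { rewrite <- ln_1. apply ln_le; lra. } nra. }
  replace (zeta s - zeta_approx M s)%C with ((zeta s - Csum (fun k => npow (S k) s) n)
     + ((zeta_approx n s - zeta_approx M s) + - (Cexp ((1 - s) * RtoC (ln (INR n))) / (s - 1))))%C by (unfold zeta_approx at 1; ring).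
  eapply Rle_trans. apply Cmod_triangle. rewrite Cmod_sym.
  assert (T2 := Cmod_triangle (zeta_approx n s - zeta_approx M s) (- (Cexp ((1 - s) * RtoC (ln (INR n))) / (s - 1)))).
  rewrite Cmod_opp in T2. lra.
Qed.

(** The errors zeta - [zeta_approx] n are holomorphic and uniformly bounded on the disc of radius
    3/2 about 2 + i Im z, which |Im z| >= 3 keeps off the pole, and tend to 0 uniformly on the disc
    of radius 1/2, where Re >= 3/2. [vanishing_sequence] then gives convergence at z without a rate,
    and the tail estimate supplies the rate. *)
Lemma zeta_minus_approx (M : nat) (z : C) : (2 <= M)%nat -> 1 / 2 < Re z <= 2 -> 3 <= Rabs (Im z) ->
  Cmod (zeta z - zeta_approx M z) <= 3 * Cmod z / sqrt (INR M).
Proof.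
  intros HM Hz Him.
  set (c := (2, Im z) : C).
  assert (Hdisc : forall w, Cmod (w - c) <= 3 / 2 -> 1 / 2 <= Re w /\ w <> 1 /\ Cmod w <= Cmod c + 3 / 2).
  { intros w Hw. assert (B := in_box_disc c w _ Hw). destruct B as [B1 B2]. unfold c, Re, Im in B1, B2. simpl in B1, B2.
    split. unfold Re; lra. split.
    intros E. rewrite E in B2. unfold RtoC in B2. simpl in B2. unfold Im in Him. 
    revert Him. apply Rlt_not_le. apply Rabs_def1; lra.
    replace w with ((w - c) + c)%C by ring. eapply Rle_trans. apply Cmod_triangle. lra. }
  assert (Hg : forall w, Cmod (w - c) <= 3 / 2 -> forall n, Chol (fun w => zeta w - zeta_approx n w)%C w).
  { intros w Hw n. apply (Chol_minus zeta (zeta_approx n)). apply zeta_Chol, Hdisc, Hw. apply Chol_zeta_approx, Hdisc, Hw. }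
  assert (Hcl : Cclosed (fun w => Cmod (w - c) <= 3 / 2)).
  { apply Cclosed_le. intros u w. apply Cmod_lip. }
  destruct (compact_bounded (fun w => Cmod (w - c) <= 3 / 2) (fun w => Cmod (zeta w - zeta_approx 2 w)) _ _ _ _ Hcl (fun w => in_box_disc c w _)) as [B HB].
  { intros w Hw e He. destruct (Chol_cont _ _ (Hg w Hw 2%nat) e He) as [d [Hd H]]. exists d. split; [exact Hd|].
    intros w' _ Hw'. eapply Rle_lt_trans. 2: apply (H w' Hw').
    set (p := (zeta w' - zeta_approx 2 w')%C). set (q := (zeta w - zeta_approx 2 w)%C).
    assert (Q1 := Cmod_minus_le p q). assert (Q2 := Cmod_minus_le q p). rewrite (Cmod_sym q p) in Q2. apply Rabs_le; lra. }
  set (K := Cmod c + 3 / 2). assert (HK : 0 <= K) by (unfold K; assert (Q := Cmod_ge_0 c); lra).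
  (* Indices start at 2, where the tail estimate begins. Compactness bounds the error at index 2,
     and the tail estimate extends the bound to all later indices. *)
  assert (V := vanishing_sequence (fun n w => zeta w - zeta_approx (2 + n) w)%C c (1 / 2) (3 / 2) (B + 3 * K / sqrt (INR 2))
     (fun n => 3 * K / sqrt (INR (2 + n))) ltac:(lra)).
  assert (Hlim : forall e, 0 < e -> exists N, forall n, (N <= n)%nat -> Cmod (zeta z - zeta_approx (2 + n) z) <= e).
  { apply V.
    - intros n w Hw. apply Hg, Hw.
    - intros n w Hw. specialize (HB w Hw). destruct (Hdisc w Hw) as [D1 [D2 D3]].
      replace (zeta w - zeta_approx (2 + n) w)%C with ((zeta w - zeta_approx 2 w) + - (zeta_approx (2 + n) w - zeta_approx 2 w))%C by ring.
      eapply Rle_trans. apply Cmod_triangle. rewrite Cmod_opp.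
      assert (T := zeta_approx_tail 2 n w (Nat.le_refl 2) D1 D2).
      assert (3 * Cmod w / sqrt (INR 2) <= 3 * K / sqrt (INR 2)).
      { unfold Rdiv. apply Rmult_le_compat_r. left; apply Rinv_0_lt_compat, sqrt_lt_R0. simpl; lra. fold K in D3. lra. }
      lra.
    - intros n w Hw. assert (Hw' : Cmod (w - c) <= 3 / 2) by lra. destruct (Hdisc w Hw') as [D1 [D2 D3]].
      eapply Rle_trans. apply zeta_minus_approx_right. lia.
      destruct (in_box_disc c w _ Hw) as [B1 _]. unfold c, Re in B1. simpl in B1. unfold Re; lra.
      unfold Rdiv. apply Rmult_le_compat_r. left; apply Rinv_0_lt_compat, sqrt_lt_R0, lt_0_INR. lia. fold K in D3. lra.
    - intros e He. destruct (inv_sqrt_small (3 * K) e ltac:(lra) He) as [N HN]. exists N. intros n Hn. apply HN. lia.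
    - unfold c. destruct z as [x y]. unfold Re, Im in *; simpl in *.
      change ((x, y) - (2, y))%C with (x - 2, y - y). eapply Rle_lt_trans. apply Cmod_le_abs.
      rewrite Rminus_diag, Rabs_R0, Rplus_0_r. apply Rabs_def1; lra. }
  apply le_epsilon. intros e He.
  destruct (Hlim e He) as [N HN].
  assert (Hz1 : z <> 1). { intros E. rewrite E, im_RtoC, Rabs_R0 in Him. lra. }
  assert (T := zeta_approx_tail M N z HM ltac:(lra) Hz1).
  specialize (HN (N + M - 2)%nat ltac:(lia)). replace (2 + (N + M - 2))%nat with (M + N)%nat in HN by lia.
  replace (zeta z - zeta_approx M z)%C with ((zeta z - zeta_approx (M + N) z) + (zeta_approx (M + N) z - zeta_approx M z))%C by ring.
  eapply Rle_trans. apply Cmod_triangle. lra.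
Qed.

Lemma Csum_inv_sqrt (s : C) (N : nat) : 1 / 2 <= Re s -> Cmod (Csum (fun k => npow (S k) s) N) <= 2 * sqrt (INR N).
Proof.
  intros Hs. induction N as [|N IH].
  - simpl. rewrite Cmod_0, sqrt_0. lra.
  - simpl Csum. eapply Rle_trans. apply Cmod_triangle.
    assert (H1 : Cmod (npow (S N) s) <= / sqrt (INR (S N))).
    { rewrite Cmod_npow. assert (1 <= INR (S N)) by (rewrite S_INR; assert (Q := pos_INR N); lra).
      rewrite <- Rpower_sqrt by lra. rewrite <- Rpower_Ropp. unfold Rpower. apply exp_le.
      assert (0 <= ln (INR (S N))). { rewrite <- ln_1. apply ln_le; lra. } nra. }
    rewrite S_INR in *. assert (Hn := pos_INR N). set (n := INR N) in *.
    set (u := sqrt n) in *. set (v := sqrt (n + 1)) in *.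
    assert (Hu : 0 <= u) by apply sqrt_pos. assert (Hv : 0 < v) by (apply sqrt_lt_R0; lra).
    assert (Eu : u * u = n) by (apply sqrt_sqrt; lra). assert (Ev : v * v = n + 1) by (apply sqrt_sqrt; lra).
    assert (/ v <= 2 * (v - u)).
    { apply (Rmult_le_reg_r v). exact Hv. rewrite Rinv_l by lra. nra. }
    lra.
Qed.

(** With about T = |Im z| terms, the partial sum, the added term and the remainder are at most 2.01,
    0.011 and 3.06 times sqrt T. *)
Lemma zeta_bound (z : C) : 1 / 2 < Re z <= 2 -> 100 <= Rabs (Im z) ->
  Cmod (zeta z) <= 5.2 * sqrt (Rabs (Im z)).
Proof.
  intros Hz Him. set (T := Rabs (Im z)) in *.
  destruct (nfloor_ex T) as [N0 [HN1 HN2]]. lra.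
  set (N := S N0). assert (EN : INR N = INR N0 + 1) by apply S_INR.
  assert (HN : (2 <= N)%nat). { apply INR_le. rewrite EN. simpl. lra. }
  assert (A := zeta_minus_approx N z HN Hz ltac:(fold T; lra)).
  assert (S := Csum_inv_sqrt z N ltac:(lra)).
  assert (Hm : T <= Cmod (z - 1)).
  { unfold T. replace (Im z) with (Im (z - 1)%C). apply Im_le_Cmod.
    destruct z; unfold Im, Cminus, Cplus, Copp, RtoC; simpl; ring. }
  assert (Hz10 : (z - 1)%C <> 0) by (apply Cmod_neq_0; lra).
  assert (HzT : Cmod z <= T + 2).
  { destruct z as [x y]. eapply Rle_trans. apply Cmod_le_abs. unfold T, Re, Im in *; simpl in *. rewrite (Rabs_pos_eq x); lra. }
  set (v := sqrt (INR N)) in *. set (u := sqrt T) in *.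
  assert (Hu : 10 <= u). { unfold u. rewrite <- (sqrt_Rsqr 10) by lra. apply sqrt_le_1_alt. unfold Rsqr; lra. }
  assert (Eu : u * u = T) by (apply sqrt_sqrt; lra).
  assert (Ev : v * v = INR N) by (apply sqrt_sqrt; lra).
  assert (Hv0 : 0 <= v) by apply sqrt_pos.
  assert (Huv : u <= v). { apply sqrt_le_1_alt. lra. }
  assert (Hv : v <= 1.005 * u). { apply Rsqr_incr_0; try lra. unfold Rsqr. nra. }
  assert (P : Cmod (Cexp ((1 - z) * RtoC (ln (INR N))) / (z - 1)) <= v / 100).
  { rewrite Cmod_div by exact Hz10. unfold Rdiv. apply Rmult_le_compat.
    apply Cmod_ge_0. left; apply Rinv_0_lt_compat; lra.
    rewrite Cmod_Cexp, re_scal_r. change (Re (1 - z)%C) with (1 - Re z).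
    unfold v. rewrite <- Rpower_sqrt by lra. unfold Rpower. apply exp_le.
    assert (0 <= ln (INR N)). { rewrite <- ln_1. apply ln_le; lra. } nra.
    apply Rinv_le_contravar; lra. }
  assert (Q : 3 * Cmod z / v <= 3.06 * u).
  { apply (Rmult_le_reg_r v). lra. unfold Rdiv. rewrite Rmult_assoc, Rinv_l, Rmult_1_r by lra. nra. }
  replace (zeta z) with ((zeta z - zeta_approx N z) + (Csum (fun k => npow (Datatypes.S k) z) N + Cexp ((1 - z) * RtoC (ln (INR N))) / (z - 1)))%C
    by (unfold zeta_approx; ring).
  eapply Rle_trans. apply Cmod_triangle.
  assert (T2 := Cmod_triangle (Csum (fun k => npow (Datatypes.S k) z) N) (Cexp ((1 - z) * RtoC (ln (INR N))) / (z - 1))).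
  lra.
Qed.
End Zeta.

(** * Three lines for log zeta *)

Lemma nonneg_of_derive (f f' : R -> R) (x : R) : 0 <= x -> f 0 = 0 ->
  (forall y, 0 <= y <= x -> is_derive f y (f' y)) -> (forall y, 0 <= y <= x -> 0 <= f' y) -> 0 <= f x.
Proof.
  intros Hx H0 Hd Hp.
  destruct (MVT_gen f 0 x f') as [c [Hc E]]; rewrite ?Rmin_left, ?Rmax_right in * by exact Hx.
  - intros y Hy. apply Hd; lra.
  - intros y Hy. apply continuity_pt_filterlim. apply (@ex_derive_continuous R_AbsRing R_NormedModule). eexists. apply Hd, Hy.
  - rewrite H0, !Rminus_0_r in E. rewrite E.
    apply Rmult_le_pos; [apply Hp, Hc | exact Hx].
Qed.

Lemma exp_ge_quad (x : R) : 0 <= x -> 1 + x + x ^ 2 / 2 <= exp x.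
Proof.
  intros Hx. assert (0 <= exp x - (1 + x + x ^ 2 / 2)); [|lra].
  apply (nonneg_of_derive (fun x => exp x - (1 + x + x ^ 2 / 2)) (fun x => exp x - (1 + x))). exact Hx.
  rewrite exp_0. lra. intros y _. auto_derive. exact I. field.
  intros y _. assert (Q := exp_ineq1_le y). lra.
Qed.

Lemma exp_neg_ge_cubic (x : R) : 0 <= x -> 1 - x + x ^ 2 / 2 - x ^ 3 / 6 <= exp (- x).
Proof.
  assert (A : forall x, 0 <= x -> 0 <= 1 - x + x ^ 2 / 2 - exp (- x)).
  { intros y Hy. apply (nonneg_of_derive (fun x => 1 - x + x ^ 2 / 2 - exp (- x)) (fun x => - 1 + x + exp (- x))). exact Hy.
    rewrite Ropp_0, exp_0. lra. intros z _. auto_derive. exact I. field.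
    intros z _. assert (Q := exp_ineq1_le (- z)). lra. }
  intros Hx. assert (0 <= exp (- x) - (1 - x + x ^ 2 / 2 - x ^ 3 / 6)); [|lra].
  apply (nonneg_of_derive (fun x => exp (- x) - (1 - x + x ^ 2 / 2 - x ^ 3 / 6)) (fun x => 1 - x + x ^ 2 / 2 - exp (- x))). exact Hx.
  rewrite Ropp_0, exp_0. lra. intros z _. auto_derive. exact I. field.
  intros z Hz. apply A; lra.
Qed.

(** The lower bound is the quadratic Taylor polynomial at 0.1; the upper one inverts the cubic
    Taylor polynomial at -0.1. Powers of these two numbers give most numerical values of exp needed
    below. *)
Lemma exp_tenth : 1.105 <= exp 0.1 <= 1.1052.
Proof.
  split. assert (Q := exp_ge_quad 0.1 ltac:(lra)). lra.
  assert (Q := exp_neg_ge_cubic 0.1 ltac:(lra)). rewrite exp_Ropp in Q.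
  assert (P := exp_pos 0.1).
  apply (Rmult_le_compat_l (exp 0.1)) in Q; [|lra]. rewrite Rinv_r in Q by lra. lra.
Qed.

Lemma exp_INR_tenth (n : nat) : exp (INR n * 0.1) = exp 0.1 ^ n.
Proof. rewrite Rmult_comm. symmetry. rewrite <- Rpower_pow by apply exp_pos. unfold Rpower. rewrite ln_exp. f_equal. ring. Qed.

Lemma exp_tenths (n : nat) (x : R) : x = INR n * 0.1 -> 1.105 ^ n <= exp x <= 1.1052 ^ n.
Proof.
  intros ->. rewrite exp_INR_tenth. assert (Q := exp_tenth). split; apply pow_incr; lra.
Qed.

Lemma exp_1_bounds : 2.7 <= exp 1 <= 2.72.
Proof. assert (Q := exp_tenths 10 1 ltac:(simpl; lra)). simpl in Q. lra. Qed.

Lemma exp_2_le : exp 2 <= 7.5.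
Proof. assert (Q := exp_tenths 20 2 ltac:(simpl; lra)). simpl in Q. lra. Qed.

Lemma ln_ge (x y : R) : exp x <= y -> x <= ln y.
Proof. intros H. rewrite <- (ln_exp x). apply ln_le. apply exp_pos. exact H. Qed.

Lemma ln_le_of (x y : R) : 0 < y -> y <= exp x -> ln y <= x.
Proof. intros Hy H. rewrite <- (ln_exp x). apply ln_le; assumption. Qed.

Lemma ln_tangent (a x : R) : 0 < x -> 0 < a -> ln x <= ln a + x / a - 1.
Proof.
  intros Hx Ha. assert (Q := exp_ineq1_le (ln (x / a))). 
  rewrite exp_ln in Q by (apply Rdiv_lt_0_compat; lra). rewrite ln_div in Q by lra. lra.
Qed.

Lemma ln_sqrt (x : R) : 0 < x -> ln (sqrt x) = ln x / 2.
Proof. intros Hx. rewrite <- Rpower_sqrt by exact Hx. unfold Rpower. rewrite ln_exp. field. Qed.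

(** * Estimates for |t| >= 10^4, with x = log |t| and l = loglog |t| *)

Section Range.
Variable t : R.
Hypothesis Ht : 10 ^ 4 <= Rabs t.
Let x := ln (Rabs t).
Let l := ln x.

Lemma ln_T_ge : 9.1 <= x.
Proof.
  apply ln_ge. assert (Q := exp_tenths 91 9.1 ltac:(simpl; lra)). 
  assert (E : 1.1052 ^ 91 <= 10000).
  (* Powers are taken in groups of ten and rounded, which keeps the rational numerals small. *)
  { assert (1.1052 ^ 10 <= 2.719) by (simpl; lra).
    replace (1.1052 ^ 91) with ((1.1052 ^ 10) ^ 9 * 1.1052) by ring.
    assert ((1.1052 ^ 10) ^ 9 <= 2.719 ^ 9). { apply pow_incr. split; [apply pow_le; lra|lra]. }
    assert (2.719 ^ 9 <= 8200) by (simpl; lra). lra. }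
  lra.
Qed.

(** The tangent of ln at 10^4. It makes 10 l + 2 at most one percent of |t|, so heights in the
    rectangle are comparable to |t|. *)
Lemma ln_T_le : x <= 8.3 + Rabs t / 10000.
Proof.
  assert (Q := ln_tangent 10000 (Rabs t) ltac:(lra) ltac:(lra)).
  assert (ln 10000 <= 9.3).
  { apply ln_le_of. lra. assert (Q2 := exp_tenths 93 9.3 ltac:(simpl; lra)).
    assert (E : 10000 <= 1.105 ^ 93).
    { assert (2.71 <= 1.105 ^ 10) by (simpl; lra).
      replace (1.105 ^ 93) with ((1.105 ^ 10) ^ 9 * 1.105 ^ 3) by ring.
      assert (2.71 ^ 9 <= (1.105 ^ 10) ^ 9). { apply pow_incr. lra. }
      assert (7800 <= 2.71 ^ 9) by (simpl; lra). simpl (1.105 ^ 3). nra. }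
    lra. }
  unfold x. lra.
Qed.

Lemma lnln_T_ge : 2.2 <= l.
Proof.
  apply ln_ge. assert (Q := exp_tenths 22 2.2 ltac:(simpl; lra)). assert (H := ln_T_ge). simpl in Q. lra.
Qed.

Lemma exp_lnln_T : exp l = x.
Proof. apply exp_ln. assert (Q := ln_T_ge). lra. Qed.

Lemma lnln_T_le : l <= x.
Proof. assert (Q := exp_ineq1_le l). rewrite exp_lnln_T in Q. lra. Qed.

(** The tangent of exp at 2.2, with exp 2.2 >= 8.8. This linear relation between x and l is what
    makes the closing inequality of [L_crude] polynomial. *)
Lemma ln_T_convex : 8.8 * (l - 1.2) <= x.
Proof.
  rewrite <- exp_lnln_T. replace l with (2.2 + (l - 2.2)) at 2 by ring. rewrite exp_plus.
  assert (Q := exp_tenths 22 2.2 ltac:(simpl; lra)). simpl in Q.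
  assert (Q2 := exp_ineq1_le (l - 2.2)). assert (H := lnln_T_ge). nra.
Qed.

(** The two hypotheses are what the given branch in (a) and the constructed one in (b) have in
    common; the slack 0.01 is for the latter. The minimum of 0.2 and 0.84 / l admits both the centre
    1.2 of the discs and the right edge of the rectangle. The abscissa 1.9 is 1.2 + 0.7, and 10 l +
    2 leaves room for |Im s - t| <= 1 and the radius of a disc. *)
Variables zeta L : C -> C.
Hypothesis Hzeta : is_riemann_zeta zeta.
Hypothesis HL : forall z, 1 / 2 + 0.01 / l <= Re z <= 1.9 -> Rabs (Im z - t) <= 10 * l + 2 ->
  Chol L z /\ Cexp (L z) = zeta z.
Hypothesis HR : forall z, 1 + Rmin 0.2 (0.84 / l) <= Re z <= 1.9 -> Rabs (Im z - t) <= 10 * l + 2 ->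
  Cmod (L z) <= ln (Re z / (Re z - 1)) + 0.01.

(** Re L = log |zeta|, and |Im w| <= 1.01 |t|; the constant 5.2 * 1.005 is rounded to 5.3, whose
    logarithm is below 1.7. *)
Lemma Re_L_le (w : C) : 1 / 2 + 0.01 / l <= Re w <= 1.9 -> Rabs (Im w - t) <= 10 * l + 2 -> Re (L w) <= x / 2 + 1.7.
Proof.
  intros H1 H2. destruct (HL w H1 H2) as [_ E].
  assert (Hl := lnln_T_ge). assert (Hx := ln_T_le). assert (Hlx := lnln_T_le).
  assert (Hp : 0 < 0.01 / l) by (apply Rdiv_lt_0_compat; lra).
  assert (A1 : Rabs t - Rabs (Im w) <= Rabs (Im w - t)). { assert (Q := Rabs_triang_inv t (Im w)). rewrite (Rabs_minus_sym t) in Q. exact Q. }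
  assert (A2 : Rabs (Im w) - Rabs t <= Rabs (Im w - t)) by apply Rabs_triang_inv.
  assert (Z := zeta_bound zeta Hzeta w ltac:(lra) ltac:(lra)).
  rewrite <- E, Cmod_Cexp in Z.
  rewrite <- (ln_exp (Re (L w))).
  set (T := Rabs t) in *.
  assert (HT : Rabs (Im w) <= 1.01 * T) by lra.
  assert (S : sqrt (Rabs (Im w)) <= 1.005 * sqrt T).
  { replace 1.005 with (sqrt (1.005 * 1.005)) by (apply sqrt_square; lra). rewrite <- sqrt_mult_alt by lra.
    apply sqrt_le_1_alt. lra. }
  assert (HsT : 0 < sqrt T) by (apply sqrt_lt_R0; lra).
  apply Rle_trans with (ln (5.3 * sqrt T)).
  apply ln_le. apply exp_pos. lra.
  rewrite ln_mult, ln_sqrt by lra. fold x.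
  assert (ln 5.3 <= 1.7).
  { apply ln_le_of. lra. assert (Q2 := exp_tenths 17 1.7 ltac:(simpl; lra)). simpl in Q2. lra. }
  unfold x, T in *. lra.
Qed.

Lemma L_crude (z : C) : 1 / 2 + 0.5 / l <= Re z <= 1 + 0.84 / l -> Rabs (Im z - t) <= 10 * l + 1 ->
  Cmod (L z) <= 1.86 * x * l.
Proof.
  intros Hz Hi.
  assert (Hl := lnln_T_ge). assert (Hx := ln_T_ge). assert (Hc := ln_T_convex).
  set (u := / l). assert (Hu : 0 < u) by (apply Rinv_0_lt_compat; lra).
  assert (Hul : u * l = 1) by (apply Rinv_l; lra).
  assert (Hu2 : u <= 0.4546). { apply (Rmult_le_reg_r l). lra. rewrite Hul. lra. }
  unfold Rdiv in Hz. fold u in Hz.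
  set (c := (1.2, Im z) : C).
  assert (Hin : forall w, Cmod (w - c) <= 0.7 - 0.01 * u -> 1 / 2 + 0.01 / l <= Re w <= 1.9 /\ Rabs (Im w - t) <= 10 * l + 2).
  { intros w Hw. destruct (in_box_disc c w _ Hw) as [B1 B2]. unfold c, Re, Im in B1, B2. simpl in B1, B2.
    unfold Rdiv. fold u. split. unfold Re. lra.
    replace (Im w - t) with ((Im z - t) + (Im w - Im z)) by ring.
    eapply Rle_trans. apply Rabs_triang. assert (Rabs (Im w - Im z) <= 0.7). { unfold Im in *. apply Rabs_le. lra. } lra. }
  assert (Hcc : Cmod (c - c) <= 0.7 - 0.01 * u). { replace (c - c)%C with (RtoC 0) by ring. rewrite Cmod_0. lra. }
  assert (Lc : Cmod (L c) <= 1.81).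
  { assert (Q := HR c). unfold c at 1 2 3 in Q. unfold Re, Im in Q; simpl in Q. 
    assert (Qm := Rmin_l 0.2 (0.84 / l)). specialize (Q ltac:(lra)). fold (Im z) in Q. specialize (Q ltac:(unfold Im in *; lra)).
    replace (1.2 / (1.2 - 1)) with 6 in Q by lra.
    assert (ln 6 <= 1.8). { apply ln_le_of. lra. assert (Q2 := exp_tenths 18 1.8 ltac:(simpl; lra)). simpl in Q2. lra. }
    unfold c, Re, Im in *; simpl in *. lra. }
  assert (LcR := re_le_Cmod (L c)). apply Rabs_le_between in LcR.
  assert (BC := Borel_Caratheodory L c (0.7 - 0.5 * u) (0.7 - 0.01 * u) (x / 2 + 1.7)).
  specialize (BC ltac:(lra)).
  assert (B : Cmod (L z - L c) <= 2 * (0.7 - 0.5 * u) / (0.7 - 0.01 * u - (0.7 - 0.5 * u)) * (x / 2 + 1.7 - Re (L c))).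
  { apply BC.
    - intros w Hw. destruct (Hin w Hw). apply HL; assumption.
    - intros w Hw. destruct (Hin w Hw). apply Re_L_le; assumption.
    - lra.
    - unfold c. destruct z as [a b]. unfold Re, Im in *; simpl in *.
      change ((a, b) - (1.2, b))%C with (a - 1.2, b - b). eapply Rle_trans. apply Cmod_le_abs.
      rewrite Rminus_diag, Rabs_R0, Rplus_0_r. apply Rabs_le. lra. }
  (* The gap of the radii is 0.49 / l, the source of the factor loglog |t|. *)
  assert (Ef : 2 * (0.7 - 0.5 * u) / (0.7 - 0.01 * u - (0.7 - 0.5 * u)) = (1.4 * l - 1) / 0.49).
  { replace (0.7 - 0.01 * u - (0.7 - 0.5 * u)) with (49 / 100 * / l) by (fold u; lra).
    replace 0.49 with (49 / 100) by lra. replace (2 * (0.7 - 0.5 * u)) with (7 / 5 - / l) by (fold u; lra).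
    replace (1.4 * l) with (7 / 5 * l) by lra. field. lra. }
  rewrite Ef in B.
  assert (T := Cmod_triangle (L z - L c) (L c)). replace (L z - L c + L c)%C with (L z) in T by ring.
  assert (B2 : (1.4 * l - 1) / 0.49 * (x / 2 + 1.7 - Re (L c)) <= (1.4 * l - 1) / 0.49 * (x / 2 + 3.51)).
  { apply Rmult_le_compat_l; lra. }
  (* The leading coefficient is 1.4 / 0.98 < 1.43; the rest of 1.86 absorbs the lower-order terms
     when |t| is near 10^4. *)
  assert (N : (1.4 * l - 1) / 0.49 * (x / 2 + 3.51) + 1.81 <= 1.86 * x * l).
  { set (m := l - 2.2). assert (Hm : 0 <= m) by (unfold m; lra). replace l with (m + 2.2) in * by (unfold m; ring).
    assert (Hxm : 8.8 * (1 + m) <= x) by lra.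
    assert (0 <= m * (x - 8.8 * (1 + m))) by (apply Rmult_le_pos; lra). nra. }
  lra.
Qed.

(** The point s may be off height t by 1 and reach abscissa 1 + 0.84 / l, since (b) applies this on
    a whole disc about its point. *)
Lemma L_three_lines (b : R) (s : C) : 0.95 <= b <= 1 ->
  1 / 2 + 0.5 / l <= Re s <= 1 + 0.84 / l -> Rabs (Im s - t) <= 1 ->
  Cmod (L s) <= 5.44 * Rpower (b * x) (2 * (1 - Re s)) * l.
Proof.
  intros Hb Hs Hi.
  assert (Hl := lnln_T_ge). assert (Hx := ln_T_ge).
  set (u := / l). assert (Hu : 0 < u) by (apply Rinv_0_lt_compat; lra).
  assert (Hul : u * l = 1) by (apply Rinv_l; lra).
  assert (Hu2 : u <= 0.4546). { apply (Rmult_le_reg_r l). lra. rewrite Hul. lra. }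
  assert (Hcr := L_crude).
  unfold Rdiv in Hs, Hcr. fold u in Hs, Hcr.
  set (B := ln (b * x)).
  assert (HB : B = ln b + l) by (unfold B; rewrite ln_mult by lra; reflexivity).
  assert (HbL : ln b <= 0). { rewrite <- ln_1. apply ln_le; lra. }
  assert (HB0 : 0 < B). { unfold B. rewrite <- ln_1. apply ln_increasing; nra. }
  assert (HBl : B <= l) by lra.
  assert (Ebx : exp B = b * x) by (apply exp_ln; nra).
  assert (Exl := exp_lnln_T).
  set (eta := 0.02 * u).
  (* The exponent is centred at s, so that |G(s)| = |L(s)|. *)
  set (G := fun z => (L z * Cexp (RtoC (2 * B) * (z - s) + RtoC eta * ((z - s) * (z - s))))%C).
  assert (MG : forall z, Cmod (G z) = Cmod (L z) * exp (2 * B * (Re z - Re s) + eta * ((Re z - Re s) ^ 2 - (Im z - Im s) ^ 2))).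
  { intros z. unfold G. rewrite Cmod_mult, Cmod_Cexp. f_equal. f_equal.
    destruct z as [z1 z2]. destruct s as [s1 s2]. unfold Re, Im, Cplus, Cminus, Copp, Cmult, RtoC; simpl. ring. }
  assert (Gs : Cmod (G s) = Cmod (L s)).
  { rewrite MG. replace (2 * B * (Re s - Re s) + eta * ((Re s - Re s) ^ 2 - (Im s - Im s) ^ 2)) with 0 by ring. rewrite exp_0. ring. }
  rewrite <- Gs. unfold Rpower. fold B.
  (* It suffices to compare at abscissa Re z: k bounds |L z|, q is the decay gained from the height,
     and 1.005 absorbs exp (eta (Re z - Re s)^2). The width of the strip is at most 1/2 + 0.34 *
     0.4546 < 0.65457. *)
  assert (Key : forall z, 1 / 2 + 0.5 * u <= Re z <= 1 + 0.84 * u ->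
     forall k q, 0 <= q -> Cmod (L z) <= k -> eta * - (Im z - Im s) ^ 2 <= - q ->
     k * exp (2 * B * (Re z - 1)) * exp (- q) * 1.005 <= 5.44 * l ->
     Cmod (G z) <= 5.44 * exp (2 * (1 - Re s) * B) * l).
  { intros z Hz k q Hq Hk Hd Hfin. rewrite MG.
    assert (Hk0 : 0 <= k) by (eapply Rle_trans; [apply Cmod_ge_0 | exact Hk]).
    assert (Hsq : (Re z - Re s) ^ 2 <= 0.4286).
    { rewrite <- pow2_abs. replace 0.4286 with (0.4286 * 1) by ring.
      apply Rle_trans with (0.65457 ^ 2). apply pow_incr. split. apply Rabs_pos. apply Rabs_le. lra. lra. }
    assert (Heta : 0 < eta <= 0.0091) by (unfold eta; lra).
    assert (Hsq2 := pow2_ge_0 (Re z - Re s)).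
    assert (He : eta * (Re z - Re s) ^ 2 <= 0.004).
    { apply Rle_trans with (0.0091 * 0.4286). apply Rmult_le_compat; lra. lra. }
    assert (E4 : exp 0.004 <= 1.005).
    { assert (Q := exp_ineq1_le (Ropp 0.004)). rewrite exp_Ropp in Q. assert (P := exp_pos 0.004).
      apply (Rmult_le_compat_l (exp 0.004)) in Q; [|lra]. rewrite Rinv_r in Q by lra. lra. }
    apply Rle_trans with (k * (exp (2 * B * (Re z - 1)) * exp (- q) * exp 0.004 * exp (2 * (1 - Re s) * B))).
    { rewrite <- !exp_plus. apply Rmult_le_compat. apply Cmod_ge_0. left; apply exp_pos. exact Hk. apply exp_le. lra. }
    assert (P1 := exp_pos (2 * (1 - Re s) * B)).
    replace (k * (exp (2 * B * (Re z - 1)) * exp (- q) * exp 0.004 * exp (2 * (1 - Re s) * B)))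
      with ((k * exp (2 * B * (Re z - 1)) * exp (- q) * exp 0.004) * exp (2 * (1 - Re s) * B)) by ring.
    replace (5.44 * exp (2 * (1 - Re s) * B) * l) with ((5.44 * l) * exp (2 * (1 - Re s) * B)) by ring.
    apply Rmult_le_compat_r. lra. eapply Rle_trans. 2: exact Hfin.
    apply Rmult_le_compat_l. 2: exact E4. 
    apply Rmult_le_pos. apply Rmult_le_pos. exact Hk0. left; apply exp_pos. left; apply exp_pos. }
  assert (Him : forall z, Im s - 10 * l <= Im z <= Im s + 10 * l -> Rabs (Im z - t) <= 10 * l + 1).
  { intros z Hz. apply Rabs_le_between in Hi. apply Rabs_le. lra. }
  assert (E2 := exp_2_le). assert (E1 := exp_1_bounds).
  apply (rect_max G (1 / 2 + 0.5 * u) (1 + 0.84 * u) (Im s - 10 * l) (Im s + 10 * l)).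
  - intros z [Hz1 Hz2]. apply (Chol_mult L). apply HL. unfold Rdiv. fold u. lra. specialize (Him z Hz2). lra.
    apply (Chol_exp (fun z => RtoC (2 * B) * (z - s) + RtoC eta * ((z - s) * (z - s)))%C).
    assert (Hzs : Chol (fun z => z - s)%C z). { apply (Chol_minus (fun z => z)). apply Chol_id. apply Chol_const. }
    apply (Chol_plus (fun z => RtoC (2 * B) * (z - s))%C (fun z => RtoC eta * ((z - s) * (z - s)))%C).
    apply (Chol_mult (fun _ => RtoC (2 * B))). apply Chol_const. exact Hzs.
    apply (Chol_mult (fun _ => RtoC eta)). apply Chol_const. apply Chol_mult; exact Hzs.
  - intros z [Hz1 Hz2] Hbd.
    assert (Hc := Hcr z Hz1 (Him z Hz2)).
    assert (Hsq0 := pow2_ge_0 (Im z - Im s)).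
    assert (Hxl : 0 < x * l) by (apply Rmult_lt_0_compat; lra).
    (* At distance 10 l from s the Gaussian factor is exp (- 2 l) = x^(-2), which outweighs the
       crude bound 1.86 x l. *)
    assert (Horiz : (Im z - Im s) ^ 2 = (10 * l) ^ 2 -> Cmod (G z) <= 5.44 * exp (2 * (1 - Re s) * B) * l).
    { intros Eq. apply (Key z Hz1 (1.86 * x * l) (2 * l)). lra. exact Hc.
      rewrite Eq. unfold eta. right. replace (0.02 * u * - (10 * l) ^ 2) with (- (2 * (u * l)) * l) by (replace 0.02 with (1 / 50) by lra; field). rewrite Hul. ring.
      assert (H1 : exp (2 * B * (Re z - 1)) <= 7.5).
      { apply Rle_trans with (exp 2). 2: exact E2. apply exp_le.
        apply Rle_trans with (2 * B * (0.84 * u)). apply Rmult_le_compat_l; lra.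
        apply Rle_trans with (2 * l * (0.84 * u)). apply Rmult_le_compat_r; lra. nra. }
      assert (H2 : exp (- (2 * l)) = / (x * x)). { rewrite exp_Ropp. f_equal. replace (2 * l) with (l + l) by ring. rewrite exp_plus, Exl. reflexivity. }
      rewrite H2. assert (H3 := exp_pos (2 * B * (Re z - 1))).
      replace (1.86 * x * l * exp (2 * B * (Re z - 1)) * / (x * x) * 1.005) with (1.86 * 1.005 * exp (2 * B * (Re z - 1)) * l * / x) by (field; lra).
      apply (Rmult_le_reg_r x). lra. rewrite Rmult_assoc, Rinv_l, Rmult_1_r by lra. nra. }
    destruct Hbd as [Hb1|[Hb1|[Hb1|Hb1]]].
    (* On the left edge exp (2 B (Re z - 1)) is exp (B u) / (b x), which cancels the factor x of the
       crude bound. What remains is 1.86 * 1.005 * 2.72 <= 5.44 * 0.95. *)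
    + apply (Key z Hz1 (1.86 * x * l) 0). lra. exact Hc. unfold eta. nra.
      rewrite Hb1, Ropp_0, exp_0.
      replace (2 * B * (1 / 2 + 0.5 * u - 1)) with (B * u + - B) by (replace 0.5 with (1 / 2) by lra; field).
      rewrite exp_plus, exp_Ropp, Ebx.
      assert (H1 : exp (B * u) <= 2.72). { apply Rle_trans with (exp 1). apply exp_le. nra. lra. }
      assert (H3 := exp_pos (B * u)).
      apply (Rmult_le_reg_r (b * x)). nra.
      replace (1.86 * x * l * (exp (B * u) * / (b * x)) * 1 * 1.005 * (b * x)) with (1.86 * 1.005 * exp (B * u) * (x * l)) by (field; nra).
      replace (5.44 * l * (b * x)) with (5.44 * b * (x * l)) by ring.
      apply Rmult_le_compat_r; lra.
    (* On the right edge the Euler product bound is ln (1 + l / 0.84) + 0.01. The tangent of ln at e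
       makes it linear in l. *)
    + assert (Hk : Cmod (L z) <= 0.39 + 0.441 * l).
      { eapply Rle_trans. apply HR. assert (Q := Rmin_r 0.2 (0.84 / l)). unfold Rdiv in Q at 2. fold u in Q. rewrite Hb1. split; [|lra].
        apply Rplus_le_compat_l. exact Q.
        specialize (Him z Hz2). lra.
        rewrite Hb1. replace ((1 + 0.84 * u) / (1 + 0.84 * u - 1)) with (1 + l / 0.84).
        2:{ replace 0.84 with (21 / 25) by lra. unfold u. field. lra. }
        assert (Q := ln_tangent (exp 1) (1 + l / 0.84)). rewrite ln_exp in Q.
        specialize (Q ltac:(lra) ltac:(lra)).
        assert ((1 + l / 0.84) / exp 1 <= (1 + l / 0.84) / 2.7).
        { unfold Rdiv. apply Rmult_le_compat_l. lra. apply Rinv_le_contravar; lra. }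
        lra. }
      apply (Key z Hz1 (0.39 + 0.441 * l) 0). lra. exact Hk. unfold eta. nra.
      rewrite Ropp_0, exp_0, Rmult_1_r.
      assert (H1 : exp (2 * B * (Re z - 1)) <= 7.5).
      { apply Rle_trans with (exp 2). 2: exact E2. apply exp_le. rewrite Hb1.
        replace (2 * B * (1 + 0.84 * u - 1)) with (2 * B * (0.84 * u)) by ring.
        apply Rle_trans with (2 * l * (0.84 * u)). apply Rmult_le_compat_r; lra. nra. }
      assert (H3 := exp_pos (2 * B * (Re z - 1))).
      apply Rle_trans with ((0.39 + 0.441 * l) * 7.5 * 1.005).
      apply Rmult_le_compat_r. lra. apply Rmult_le_compat_l; lra. lra.
    + apply Horiz. rewrite Hb1. ring.
    + apply Horiz. rewrite Hb1. ring.
  - split; [exact Hs|]. lra.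
Qed.
End Range.

(** * The Euler product *)

Definition is_primeb (p : nat) : bool := if prime_dec (Z.of_nat p) then true else false.

Lemma is_primeb_true (p : nat) : is_primeb p = true <-> prime (Z.of_nat p).
Proof. unfold is_primeb. destruct (prime_dec _); split; intros; auto; discriminate. Qed.

Lemma is_primeb_ge_2 (p : nat) : is_primeb p = true -> (2 <= p)%nat.
Proof. intros H. apply is_primeb_true in H. apply prime_ge_2 in H. lia. Qed.

Lemma nat_Zdivide (a b : nat) : Nat.divide a b <-> (Z.of_nat a | Z.of_nat b)%Z.
Proof.
  split.
  - intros [k ->]. exists (Z.of_nat k). lia.
  - intros [k Hk]. destruct a as [|a].
    + exists 0%nat. rewrite Z.mul_0_r in Hk. lia.
    + exists (Z.to_nat k). nia.
Qed.

Fixpoint no_prime_upto (N n : nat) : bool :=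
  match N with
  | O => true
  | S N' => if (is_primeb N && (n mod N =? 0)%nat)%bool then false else no_prime_upto N' n
  end.

Lemma mod_0_divide (n p : nat) : (0 < p)%nat -> ((n mod p =? 0)%nat = true <-> Nat.divide p n).
Proof. intros Hp. rewrite Nat.eqb_eq. apply Nat.Lcm0.mod_divide. Qed.

(** By Euclid's lemma, a prime q <= N < p dividing p m divides m. *)
Lemma no_prime_upto_mul (N p m : nat) : is_primeb p = true -> (N < p)%nat -> no_prime_upto N (p * m) = no_prime_upto N m.
Proof.
  intros Hp. induction N as [|N IH]; intros HN. reflexivity.
  cbn [no_prime_upto]. rewrite IH by lia.
  destruct (is_primeb (S N)) eqn:E; [|reflexivity]. cbn [andb].
  replace ((p * m) mod S N =? 0)%nat with (m mod S N =? 0)%nat. reflexivity.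
  apply Bool.eq_true_iff_eq. rewrite !mod_0_divide by lia.
  split. intros H. apply Nat.divide_mul_r, H.
  intros H. apply nat_Zdivide in H. rewrite Nat2Z.inj_mul in H.
  apply is_primeb_true in E. apply is_primeb_true in Hp.
  apply prime_mult in H; [|exact E]. destruct H as [H|H].
  - apply prime_div_prime in H; [|exact E|exact Hp]. lia.
  - apply nat_Zdivide, H.
Qed.

Lemma exists_prime_divisor (n : nat) : (2 <= n)%nat -> exists p, is_primeb p = true /\ Nat.divide p n.
Proof.
  induction n as [n IH] using (well_founded_induction lt_wf). intros Hn.
  destruct (is_primeb n) eqn:E. exists n. split; [exact E|apply Nat.divide_refl].
  assert (N : ~ prime (Z.of_nat n)). { intros H. apply is_primeb_true in H. congruence. }
  destruct (not_prime_divide (Z.of_nat n) ltac:(lia) N) as [q [Hq Hd]].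
  assert (Eq : q = Z.of_nat (Z.to_nat q)) by lia. rewrite Eq in Hd. apply nat_Zdivide in Hd.
  destruct (IH (Z.to_nat q)) as [p [H1 H2]]; [lia|lia|].
  exists p. split; [exact H1|]. eapply Nat.divide_trans; eassumption.
Qed.

Lemma no_prime_upto_false (N n p : nat) : is_primeb p = true -> Nat.divide p n -> (p <= N)%nat -> no_prime_upto N n = false.
Proof.
  intros Hp Hd. assert (H2 := is_primeb_ge_2 p Hp). induction N as [|N IH]; intros HN. lia.
  cbn [no_prime_upto]. destruct (Nat.eq_dec p (S N)) as [E|E].
  - rewrite <- E, Hp. rewrite (proj2 (mod_0_divide n p ltac:(lia)) Hd). reflexivity.
  - rewrite IH by lia. destruct (_ && _)%bool; reflexivity.
Qed.

Lemma no_prime_upto_1 (N : nat) : no_prime_upto N 1 = true.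
Proof.
  induction N as [|N IH]. reflexivity. cbn [no_prime_upto]. rewrite IH.
  destruct (is_primeb (S N)) eqn:E; [|reflexivity].
  apply is_primeb_ge_2 in E. rewrite Nat.mod_1_l by lia. reflexivity.
Qed.

Definition Cconv (u : nat -> C) (l : C) : Prop :=
  forall e, 0 < e -> exists N, forall n, (N <= n)%nat -> Cmod (u n - l) < e.

Lemma Cconv_le (u : nat -> C) (l w : C) (K : R) (N : nat) : Cconv u l ->
  (forall n, (N <= n)%nat -> Cmod (u n - w) <= K) -> Cmod (l - w) <= K.
Proof.
  intros H HK. apply le_epsilon. intros e He. destruct (H e He) as [M HM].
  specialize (HM (N + M)%nat ltac:(lia)). specialize (HK (N + M)%nat ltac:(lia)).
  replace (l - w)%C with ((u (N + M)%nat - w) + - (u (N + M)%nat - l))%C by ring.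
  eapply Rle_trans. apply Cmod_triangle. rewrite Cmod_opp. lra.
Qed.

Lemma Cconv_div (u : nat -> C) (l : C) (p : nat) : (0 < p)%nat -> Cconv u l -> Cconv (fun n => u (n / p)%nat) l.
Proof.
  intros Hp H e He. destruct (H e He) as [N HN]. exists (p * N)%nat. intros n Hn. apply HN.
  apply Nat.div_le_lower_bound; lia.
Qed.

Lemma Cconv_lin (u v : nat -> C) (l m c : C) : Cconv u l -> Cconv v m -> Cconv (fun n => u n - c * v n)%C (l - c * m)%C.
Proof.
  intros Hu Hv e He. assert (Hc := Cmod_ge_0 c).
  destruct (Hu (e / 2) ltac:(lra)) as [N1 H1].
  destruct (Hv (e / 2 / (Cmod c + 1))) as [N2 H2]. apply Rdiv_lt_0_compat; lra.
  exists (N1 + N2)%nat. intros n Hn. specialize (H1 n ltac:(lia)). specialize (H2 n ltac:(lia)).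
  replace (u n - c * v n - (l - c * m))%C with ((u n - l) + - (c * (v n - m)))%C by ring.
  eapply Rle_lt_trans. apply Cmod_triangle. rewrite Cmod_opp, Cmod_mult.
  assert (Cmod c * Cmod (v n - m) <= (Cmod c + 1) * (e / 2 / (Cmod c + 1))).
  { apply Rmult_le_compat; try lra. apply Cmod_ge_0. }
  replace ((Cmod c + 1) * (e / 2 / (Cmod c + 1))) with (e / 2) in H by (field; lra). lra.
Qed.

Lemma Cconv_ext (u v : nat -> C) (l : C) : (forall n, u n = v n) -> Cconv u l -> Cconv v l.
Proof. intros E H e He. destruct (H e He) as [N HN]. exists N. intros n Hn. rewrite <- E. apply HN, Hn. Qed.

(** The product of 1 - p^(-s) over primes p <= N: the truncated Euler product of 1 / zeta. *)
Fixpoint euler (N : nat) (s : C) : C :=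
  match N with
  | O => RtoC 1
  | S N' => if is_primeb N then (euler N' s * (1 - npow N s))%C else euler N' s
  end.

Lemma npow_mul (m n : nat) (s : C) : (0 < m)%nat -> (0 < n)%nat -> npow (m * n) s = (npow m s * npow n s)%C.
Proof.
  intros Hm Hn. rewrite !npow_Cexp, <- Cexp_plus. f_equal.
  rewrite mult_INR, ln_mult by (apply lt_0_INR; assumption). rewrite RtoC_plus. ring.
Qed.

Lemma npow_1 (s : C) : npow 1 s = 1.
Proof. rewrite npow_Cexp. simpl INR. rewrite ln_1. replace (- s * 0)%C with (RtoC 0) by ring. apply Cexp_0. Qed.

(** Index k stands for the integer k + 1, as in the series for zeta. *)
Definition sieved (N : nat) (s : C) (k : nat) : C := if no_prime_upto N (S k) then npow (S k) s else 0.

Lemma div_succ (M p : nat) : (0 < p)%nat ->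
  (S M / p = if (S M mod p =? 0)%nat then S (M / p) else M / p)%nat.
Proof.
  intros Hp. assert (A := Nat.div_mod_eq M p). assert (B := Nat.mod_upper_bound M p ltac:(lia)).
  destruct (Nat.eqb_spec (S M mod p) 0) as [E|E].
  - assert (A' := Nat.div_mod_eq (S M) p). rewrite E in A'. nia.
  - assert (A' := Nat.div_mod_eq (S M) p). assert (B' := Nat.mod_upper_bound (S M) p ltac:(lia)). nia.
Qed.

(** With p = N + 1 prime, the terms that disappear are the multiples of p, and they are p^(-s) times
    the first M / p sieved terms. The identity is exact for partial sums, so that no series has to
    be rearranged. *)
Lemma Csum_sieved_succ (N : nat) (s : C) (M : nat) : is_primeb (S N) = true ->
  (Csum (sieved (S N) s) M = Csum (sieved N s) M - npow (S N) s * Csum (sieved N s) (M / S N))%C.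
Proof.
  intros Hp. induction M as [|M IH].
  - rewrite Nat.Div0.div_0_l. simpl. ring.
  - cbn [Csum]. rewrite IH. rewrite (div_succ M (S N)) by lia.
    assert (Z : sieved (S N) s M = if (S M mod S N =? 0)%nat then RtoC 0 else sieved N s M).
    { unfold sieved. cbn [no_prime_upto]. rewrite Hp. cbn [andb]. destruct (S M mod S N =? 0)%nat; reflexivity. }
    rewrite Z. destruct (S M mod S N =? 0)%nat eqn:E.
    + cbn [Csum].
      assert (D : S M = (S N * S (M / S N))%nat).
      { assert (Q := div_succ M (S N) ltac:(lia)). rewrite E in Q.
        assert (A' := Nat.div_mod_eq (S M) (S N)). apply Nat.eqb_eq in E. lia. }
      assert (F : sieved N s M = (npow (S N) s * sieved N s (M / S N))%C).
      { unfold sieved. rewrite D, no_prime_upto_mul by (try assumption; lia).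
        destruct (no_prime_upto N _). apply npow_mul; lia. ring. }
      rewrite F. ring.
    + ring.
Qed.

Section Euler.
Variable zeta : C -> C.
Hypothesis Hzeta : is_riemann_zeta zeta.

Lemma sieved_conv (N : nat) (s : C) : 1 < Re s -> Cconv (Csum (sieved N s)) (zeta s * euler N s)%C.
Proof.
  intros Hs. induction N as [|N IH].
  - cbn [euler]. rewrite Cmult_1_r. intros e He. apply (is_series_Csum _ _ (zeta_series zeta Hzeta s Hs) e He).
  - cbn [euler]. destruct (is_primeb (S N)) eqn:E.
    + replace (zeta s * (euler N s * (1 - npow (S N) s)))%C with (zeta s * euler N s - npow (S N) s * (zeta s * euler N s))%C by ring.
      eapply Cconv_ext. intros n. symmetry. apply Csum_sieved_succ, E.
      apply (Cconv_lin (Csum (sieved N s)) (fun n => Csum (sieved N s) (n / S N)%nat)). exact IH.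
      apply Cconv_div. lia. exact IH.
    + eapply Cconv_ext. 2: exact IH. intros n. apply f_equal2; [|reflexivity].
      apply functional_extensionality. intros k. unfold sieved. cbn [no_prime_upto]. rewrite E. reflexivity.
Qed.

(** The right-hand side is the integral of x^(-sigma) over [k, k+1]. Two uses of 1 + y <= exp y
    replace the integration. *)
Lemma power_telescope (k : nat) (sigma : R) : (1 <= k)%nat -> 1 < sigma ->
  exp (- sigma * ln (INR (S k))) <= (exp ((1 - sigma) * ln (INR k)) - exp ((1 - sigma) * ln (INR (S k)))) / (sigma - 1).
Proof.
  intros Hk Hs. assert (Hk1 : 1 <= INR k) by (apply (le_INR 1); exact Hk).
  rewrite S_INR. set (n := INR k) in *.
  set (a := ln n). set (b := ln (n + 1)).
  assert (Eb : exp b = n + 1) by (apply exp_ln; lra).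
  assert (Hab : / (n + 1) <= b - a).
  { assert (Q := exp_ineq1_le (a - b)). unfold Rminus in Q. rewrite exp_plus, exp_Ropp, Eb in Q.
    unfold a at 2 in Q. rewrite exp_ln in Q by lra.
    replace (n * / (n + 1)) with (1 - / (n + 1)) in Q by (field; lra). lra. }
  assert (P : exp (- sigma * b) = exp ((1 - sigma) * b) * / (n + 1)).
  { rewrite <- Eb, <- exp_Ropp, <- exp_plus. f_equal. ring. }
  rewrite P.
  assert (Q : exp ((1 - sigma) * a) = exp ((1 - sigma) * b) * exp ((sigma - 1) * (b - a))).
  { rewrite <- exp_plus. f_equal. ring. }
  rewrite Q. assert (Q2 := exp_ineq1_le ((sigma - 1) * (b - a))).
  assert (E := exp_pos ((1 - sigma) * b)). set (c := exp ((1 - sigma) * b)) in *.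
  apply (Rmult_le_reg_r (sigma - 1)). lra. unfold Rdiv. rewrite (Rmult_assoc (_ - _)), Rinv_l, Rmult_1_r by lra.
  apply Rle_trans with (c * ((sigma - 1) * (b - a))). 
  replace (c * / (n + 1) * (sigma - 1)) with (c * ((sigma - 1) * / (n + 1))) by ring.
  apply Rmult_le_compat_l. lra. apply Rmult_le_compat_l; lra.
  replace (c * exp ((sigma - 1) * (b - a)) - c) with (c * (exp ((sigma - 1) * (b - a)) - 1)) by ring.
  apply Rmult_le_compat_l; lra.
Qed.

(** Every integer from 2 to N has a prime factor at most N, so among the first N terms only 1
    survives. The later terms are dominated by the telescoping bounds for n^(- Re s). *)
Lemma sieve_tail (N : nat) (s : C) : (1 <= N)%nat -> 1 < Re s ->
  Cmod (zeta s * euler N s - 1) <= exp ((1 - Re s) * ln (INR N)) / (Re s - 1).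
Proof.
  intros HN Hs. apply (Cconv_le (Csum (sieved N s)) _ _ _ N). apply sieved_conv, Hs.
  intros n Hn. 
  assert (B0 : forall m, (1 <= m <= N)%nat -> Csum (sieved N s) m = 1).
  { induction m as [|m IH]; intros Hm. lia. cbn [Csum]. destruct m as [|m].
    - unfold sieved. rewrite no_prime_upto_1, npow_1. simpl. ring.
    - rewrite IH by lia. unfold sieved.
      destruct (exists_prime_divisor (S (S m)) ltac:(lia)) as [p [Hp Hd]].
      rewrite (no_prime_upto_false N _ p Hp Hd). ring.
      apply Nat.divide_pos_le in Hd; lia. }
  assert (B : forall j, Cmod (Csum (sieved N s) (N + j) - 1) <=
     (exp ((1 - Re s) * ln (INR N)) - exp ((1 - Re s) * ln (INR (N + j)))) / (Re s - 1)).
  { induction j as [|j IH].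
    - rewrite Nat.add_0_r, B0 by lia. replace (1 - 1)%C with (RtoC 0) by ring. rewrite Cmod_0. unfold Rdiv. lra.
    - rewrite Nat.add_succ_r. cbn [Csum].
      replace (Csum (sieved N s) (N + j) + sieved N s (N + j) - 1)%C with ((Csum (sieved N s) (N + j) - 1) + sieved N s (N + j))%C by ring.
      eapply Rle_trans. apply Cmod_triangle.
      assert (T := power_telescope (N + j) (Re s) ltac:(lia) Hs).
      assert (K : Cmod (sieved N s (N + j)) <= exp (- Re s * ln (INR (S (N + j))))).
      { unfold sieved. destruct (no_prime_upto _ _). rewrite Cmod_npow. lra. rewrite Cmod_0. left; apply exp_pos. }
      unfold Rdiv in *. lra. }
  replace n with (N + (n - N))%nat by lia. eapply Rle_trans. apply B.
  unfold Rdiv. apply Rmult_le_compat_r. left; apply Rinv_0_lt_compat; lra.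
  assert (Q := exp_pos ((1 - Re s) * ln (INR (N + (n - N))))). lra.
Qed.

Lemma tail_small (kappa e : R) : 0 < kappa -> 0 < e -> exists N, (1 <= N)%nat /\
  forall sigma, 1 + kappa <= sigma -> exp ((1 - sigma) * ln (INR N)) / (sigma - 1) <= e.
Proof.
  intros Hk He.
  destruct (nfloor_ex (exp (Rabs (ln (kappa * e)) / kappa))) as [N0 [_ HN]]. left; apply exp_pos.
  exists (S N0). split. lia. intros sigma Hs. rewrite S_INR. set (n := INR N0 + 1) in *.
  assert (Hn : Rabs (ln (kappa * e)) / kappa <= ln n). { apply ln_ge. lra. }
  assert (Hln : 0 <= ln n). { eapply Rle_trans. 2: exact Hn. apply Rmult_le_pos. apply Rabs_pos. left; apply Rinv_0_lt_compat, Hk. }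
  apply (Rmult_le_reg_r (sigma - 1)). lra. unfold Rdiv. rewrite Rmult_assoc, Rinv_l, Rmult_1_r by lra.
  apply Rle_trans with (kappa * e). 2: nra.
  assert (Hke : 0 < kappa * e) by (apply Rmult_lt_0_compat; lra).
  rewrite <- (exp_ln (kappa * e)) by exact Hke. apply exp_le.
  apply (Rmult_le_compat_l kappa) in Hn; [|lra].
  replace (kappa * (Rabs (ln (kappa * e)) / kappa)) with (Rabs (ln (kappa * e))) in Hn by (field; lra).
  assert (Q := Rabs_maj2 (ln (kappa * e))). nra.
Qed.

(** The logarithm of the truncated Euler product at a real point: the common majorant of the prime
    power sums and of [plog]. *)
Fixpoint esum (N : nat) (sigma : R) : R :=
  match N with
  | O => 0
  | S N' => esum N' sigma + (if is_primeb N then - ln (1 - exp (- sigma * ln (INR N))) else 0)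
  end.

Lemma prime_power_lt_1 (p : nat) (sigma : R) : (2 <= p)%nat -> 1 < sigma -> 0 < exp (- sigma * ln (INR p)) < 1.
Proof.
  intros Hp Hs. split. apply exp_pos. rewrite <- exp_0. apply exp_increasing.
  assert (2 <= INR p) by (apply (le_INR 2); exact Hp).
  assert (0 < ln (INR p)). { rewrite <- ln_1. apply ln_increasing; lra. } nra.
Qed.

Lemma esum_incr (N j : nat) (sigma : R) : 1 < sigma -> esum N sigma <= esum (N + j) sigma.
Proof.
  intros Hs. induction j as [|j IH]. rewrite Nat.add_0_r; lra.
  rewrite Nat.add_succ_r. cbn [esum]. destruct (is_primeb (S (N + j))) eqn:E.
  - apply is_primeb_ge_2 in E. assert (Q := prime_power_lt_1 _ sigma E Hs).
    assert (ln (1 - exp (- sigma * ln (INR (S (N + j))))) <= 0). { rewrite <- ln_1. apply ln_le; lra. } lra.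
  - lra.
Qed.

Lemma euler_real (N : nat) (sigma : R) : 1 < sigma -> Cmod (euler N (RtoC sigma)) = exp (- esum N sigma).
Proof.
  intros Hs. induction N as [|N IH]. simpl. rewrite Cmod_1, Ropp_0, exp_0. reflexivity.
  cbn [euler esum]. destruct (is_primeb (S N)) eqn:E.
  - apply is_primeb_ge_2 in E. assert (Q := prime_power_lt_1 _ sigma E Hs).
    rewrite Cmod_mult, IH.
    replace (1 - npow (S N) (RtoC sigma))%C with (RtoC (1 - exp (- sigma * ln (INR (S N))))).
    rewrite Cmod_R, Rabs_pos_eq by lra.
    rewrite Ropp_plus_distr, Ropp_involutive, exp_plus, exp_ln by lra. reflexivity.
    rewrite RtoC_minus. f_equal. f_equal. rewrite npow_Cexp. rewrite <- RtoC_opp, <- RtoC_mult.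
    unfold Cexp. rewrite re_RtoC, im_RtoC, cos_0, sin_0. unfold RtoC. f_equal; ring.
  - rewrite IH, Rplus_0_r. reflexivity.
Qed.

(** The moduli |zeta(sigma)| exp (- esum N sigma) decrease with N and tend to 1, hence are at least
    1, while |zeta(sigma)| <= sigma / (sigma - 1). *)
Lemma esum_le (N : nat) (sigma : R) : 1 < sigma -> esum N sigma <= ln (sigma / (sigma - 1)).
Proof.
  intros Hs.
  set (Z := Cmod (zeta (RtoC sigma))).
  assert (HZ : Z <= sigma / (sigma - 1)).
  (* At N = 1 nothing is sieved out, and the estimate reads |zeta(sigma) - 1| <= 1 / (sigma - 1). *)
  { assert (T := sieve_tail 1 (RtoC sigma) (Nat.le_refl 1) ltac:(rewrite re_RtoC; exact Hs)).
    assert (E1 : euler 1 (RtoC sigma) = 1).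
    { cbn [euler]. destruct (is_primeb 1) eqn:E; [|reflexivity]. apply is_primeb_ge_2 in E. lia. }
    rewrite E1, Cmult_1_r, re_RtoC in T. change (INR 1) with 1 in T. rewrite ln_1, Rmult_0_r, exp_0 in T.
    assert (Q := Cmod_minus_le (zeta (RtoC sigma)) 1). rewrite Cmod_1 in Q. fold Z in Q.
    replace (sigma / (sigma - 1)) with (1 + 1 / (sigma - 1)) by (field; lra). lra. }
  assert (HZN : 1 <= Z * exp (- esum N sigma)).
  { apply le_epsilon. intros e He.
    destruct (tail_small (sigma - 1) e ltac:(lra) He) as [M [HM1 HM]].
    specialize (HM sigma ltac:(lra)).
    assert (T := sieve_tail (N + M) (RtoC sigma) ltac:(lia) ltac:(rewrite re_RtoC; exact Hs)).
    rewrite re_RtoC in T.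
    assert (Q := Cmod_minus_le 1 (zeta (RtoC sigma) * euler (N + M) (RtoC sigma))).
    rewrite Cmod_sym, Cmod_1, Cmod_mult, euler_real in Q by exact Hs. fold Z in Q.
    assert (D : exp ((1 - sigma) * ln (INR (N + M))) / (sigma - 1) <= exp ((1 - sigma) * ln (INR M)) / (sigma - 1)).
    { unfold Rdiv. apply Rmult_le_compat_r. left; apply Rinv_0_lt_compat; lra. apply exp_le.
      assert (ln (INR M) <= ln (INR (N + M))). { apply ln_le. apply lt_0_INR; lia. apply le_INR; lia. } nra. }
    assert (I : Z * exp (- esum (N + M) sigma) <= Z * exp (- esum N sigma)).
    { apply Rmult_le_compat_l. apply Cmod_ge_0. apply exp_le. assert (J := esum_incr N M sigma Hs). lra. }
    lra. }
  apply ln_ge. eapply Rle_trans. 2: exact HZ.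
  rewrite exp_Ropp in HZN. assert (P := exp_pos (esum N sigma)).
  apply (Rmult_le_compat_r (exp (esum N sigma))) in HZN; [|lra].
  rewrite Rmult_assoc, Rinv_l in HZN by lra. lra.
Qed.

(** * The sum over prime powers *)

Fixpoint log_poly (n : nat) (q : R) : R :=
  match n with O => 0 | S n' => log_poly n' q + q ^ n / INR n end.

(** The difference of the two sides vanishes at 0 and has derivative y^n / (1 - y), the tail of the
    geometric series. *)
Lemma log_poly_le (n : nat) (q : R) : 0 <= q < 1 -> log_poly n q <= - ln (1 - q).
Proof.
  intros Hq.
  assert (D : forall y, is_derive (log_poly n) y (sum_f_R0 (fun k => y ^ k) n - y ^ n)).
  { intros y. induction n as [|n IH].
    - simpl. replace (1 - 1) with 0 by ring. apply (@is_derive_const R_AbsRing R_NormedModule).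
    - cbn [log_poly].
      replace (sum_f_R0 (fun k => y ^ k) (S n) - y ^ S n) with ((sum_f_R0 (fun k => y ^ k) n - y ^ n) + y ^ n) by (simpl; ring).
      apply (@is_derive_plus R_AbsRing R_NormedModule). exact IH.
      assert (HN := pos_INR n).
      assert (Hc := S_INR n). set (c := INR (S n)) in *.
      apply (is_derive_ext (fun y => / c * y ^ S n)). intros z. apply Rmult_comm.
      evar_last. apply is_derive_scal. apply (is_derive_pow (fun y => y)). apply (@is_derive_id R_AbsRing).
      fold c. change (pred (S n)) with n. change (/ c * (c * 1 * y ^ n) = y ^ n). field. lra. }
  assert (0 <= - ln (1 - q) - log_poly n q); [|lra].
  apply (nonneg_of_derive (fun q => - ln (1 - q) - log_poly n q) (fun y => / (1 - y) - (sum_f_R0 (fun k => y ^ k) n - y ^ n))).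
  - lra.
  - rewrite Rminus_0_r, ln_1. assert (log_poly n 0 = 0); [|lra].
    clear. induction n as [|n IH]. reflexivity. cbn [log_poly]. rewrite IH. simpl. unfold Rdiv. ring.
  - intros y Hy. apply (@is_derive_minus R_AbsRing R_NormedModule). 2: apply D.
    auto_derive. lra. field. lra.
  - intros y Hy. assert (G := tech3 y n ltac:(lra)). unfold Rdiv in G. 
    assert (P : 0 <= y ^ n) by (apply pow_le; lra).
    rewrite G. replace (/ (1 - y) - ((1 - y ^ S n) * / (1 - y) - y ^ n)) with (y ^ n * / (1 - y)) by (simpl; field; lra).
    apply Rmult_le_pos. exact P. left; apply Rinv_0_lt_compat; lra.
Qed.

(** Each inner sum is dominated termwise by the Taylor series of - ln (1 - p^(- Re s)), and the sum
    over primes by [esum]. The bound passes to the limits directly, without relating l to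
    zeta(s). *)
Lemma prime_power_sum_bound (s l : C) : 1 < Re s -> is_prime_power_sum s l ->
  Cmod l <= ln (Re s / (Re s - 1)).
Proof.
  intros Hs [inner [H1 [H2 H3]]].
  assert (Hin : forall p, is_primeb p = true -> Cmod (inner p) <= - ln (1 - exp (- Re s * ln (INR p)))).
  { intros p Hp. assert (H := H1 p (proj1 (is_primeb_true p) Hp)).
    apply is_primeb_ge_2 in Hp. assert (Q := prime_power_lt_1 p (Re s) Hp Hs).
    set (q := exp (- Re s * ln (INR p))) in *.
    set (term := fun j => (/ (RtoC (INR (S j)) * Rcpow (INR p) (RtoC (INR (S j)) * s)))%C) in *.
    assert (B : forall n, Cmod (Csum term n) <= log_poly n q).
    { induction n as [|n IH]. simpl. rewrite Cmod_0; lra.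
      cbn [Csum log_poly]. eapply Rle_trans. apply Cmod_triangle. apply Rplus_le_compat. exact IH.
      unfold term. assert (Hn : 0 < INR (S n)) by (apply lt_0_INR; lia).
      assert (HnC : RtoC (INR (S n)) <> 0). { intros E. apply RtoC_inj in E. lra. }
      assert (Hrc : Rcpow (INR p) (RtoC (INR (S n)) * s) <> 0) by apply Cexp_neq_0.
      rewrite Cmod_inv by (apply Cmult_neq_0; assumption).
      rewrite Cmod_mult, Cmod_R, (Rabs_pos_eq (INR (S n))) by lra.
      unfold Rcpow. rewrite Cmod_Cexp, re_scal_r, re_scal_l.
      right. rewrite Rinv_mult, <- exp_Ropp. unfold Rdiv. rewrite Rmult_comm. f_equal.
      unfold q. rewrite <- Rpower_pow by apply exp_pos. unfold Rpower. rewrite ln_exp. f_equal. ring. }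
    replace (inner p) with (inner p - 0)%C by ring.
    apply (Cconv_le (Csum term) _ _ _ 0). exact (is_series_Csum term _ H).
    intros n _. replace (Csum term n - 0)%C with (Csum term n) by ring.
    eapply Rle_trans. apply B. apply log_poly_le. lra. }
  replace l with (l - 0)%C by ring.
  apply (Cconv_le (Csum inner) _ _ _ 1). exact (is_series_Csum inner _ H3).
  intros n Hn. replace (Csum inner n - 0)%C with (Csum inner n) by ring.
  destruct n as [|n]. lia.
  (* The first n + 1 inner sums are those for p = 0, ..., n, so they match [esum] at n. *)
  eapply Rle_trans. 2: apply (esum_le n (Re s) Hs). clear Hn.
  assert (NP : forall p, is_primeb p = false -> inner p = 0).
  { intros p Hp. apply H2. intros K. apply is_primeb_true in K. congruence. }
  induction n as [|n IH].
  - simpl. rewrite NP. replace (0 + 0)%C with (RtoC 0) by ring. rewrite Cmod_0. lra.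
    destruct (is_primeb 0) eqn:E; [|reflexivity]. apply is_primeb_ge_2 in E. lia.
  - change (Csum inner (S (S n))) with (Csum inner (S n) + inner (S n))%C. cbn [esum].
    eapply Rle_trans. apply Cmod_triangle. apply Rplus_le_compat. exact IH.
    destruct (is_primeb (S n)) eqn:E. apply Hin, E. rewrite NP by exact E. rewrite Cmod_0. lra.
Qed.

(** * Construction of the logarithm from the Euler product *)

Fixpoint plog (N : nat) (s : C) : C :=
  match N with
  | O => RtoC 0
  | S N' => if is_primeb N then (plog N' s - Clog (1 - npow N s))%C else plog N' s
  end.

Lemma one_minus_prime_power (p : nat) (s : C) : (2 <= p)%nat -> 1 < Re s -> Cmod (npow p s) < 1 /\ 0 < Re (1 - npow p s)%C.
Proof.
  intros Hp Hs. assert (Q := prime_power_lt_1 p (Re s) Hp Hs). rewrite <- Cmod_npow in Q. split. lra.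
  rewrite <- (Cmult_1_l (npow p s)). apply Re_ge_1_minus; lra.
Qed.

Lemma plog_spec (N : nat) (s : C) : 1 < Re s ->
  Chol (plog N) s /\ (Cexp (plog N s) * euler N s = 1)%C /\ Cmod (plog N s) <= esum N (Re s).
Proof.
  intros Hs. induction N as [|N [I1 [I2 I3]]].
  - split. apply (Chol_const 0). split. simpl. rewrite Cexp_0. ring. simpl. rewrite Cmod_0; lra.
  - unfold plog; fold plog. cbn [euler esum]. destruct (is_primeb (S N)) eqn:E.
    + apply is_primeb_ge_2 in E. destruct (one_minus_prime_power (S N) s E Hs) as [Q1 Q2].
      split; [|split].
      * apply (Chol_minus (plog N) (fun s => Clog (1 - npow (S N) s))). exact I1.
        apply (Chol_comp Clog (fun s => 1 - npow (S N) s)%C).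
        apply (Chol_minus (fun _ => RtoC 1)). apply Chol_const. apply Chol_npow.
        eexists. apply Cderiv_Clog, Q2.
      * unfold Cminus at 1. rewrite Cexp_plus, Cexp_opp, Cexp_Clog by exact Q2.
        set (w := (1 - npow (S N) s)%C) in *.
        assert (Hw : w <> 0). { intros Z. rewrite Z, re_RtoC in Q2. lra. }
        rewrite <- I2. field. exact Hw.
      * unfold Cminus at 1. eapply Rle_trans. apply Cmod_triangle. rewrite Cmod_opp.
        apply Rplus_le_compat. exact I3. rewrite <- Cmod_npow. apply Clog_1_minus, Q1.
    + rewrite Rplus_0_r. tauto.
Qed.

Lemma Chol_euler (N : nat) (s : C) : Chol (euler N) s.
Proof.
  induction N as [|N IH]. apply (Chol_const 1).
  unfold euler; fold euler. destruct (is_primeb (S N)).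
  - apply (Chol_mult (euler N) (fun s => 1 - npow (S N) s)%C). exact IH.
    apply (Chol_minus (fun _ => RtoC 1)). apply Chol_const. apply Chol_npow.
  - exact IH.
Qed.

(** One fixed N suffices: zeta times the truncated product is within 0.009 of 1 on the whole
    half-plane, so its principal logarithm is holomorphic and at most 0.01. Adding it to [plog]
    gives an exact logarithm of zeta without a limit of holomorphic functions. *)
Lemma log_right (kappa : R) : 0 < kappa -> exists L1, forall s, 1 + kappa <= Re s ->
  Chol L1 s /\ Cexp (L1 s) = zeta s /\ Cmod (L1 s) <= ln (Re s / (Re s - 1)) + 0.01.
Proof.
  intros Hk. destruct (tail_small kappa 0.009 Hk ltac:(lra)) as [N [HN1 HN]].
  exists (fun s => plog N s + Clog (zeta s * euler N s))%C. intros s Hs.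
  assert (Hs1 : 1 < Re s) by lra.
  assert (T := sieve_tail N s HN1 Hs1). specialize (HN (Re s) Hs).
  set (w := (zeta s * euler N s)%C) in *.
  assert (Hw : Cmod (1 - w) <= 0.009) by (rewrite Cmod_sym; lra).
  assert (Rw : 0 < Re w).
  { assert (Q := re_le_Cmod (1 - w)). replace (Re (1 - w)%C) with (1 - Re w) in Q by (destruct w; unfold Re, Cminus, Cplus, Copp, RtoC; simpl; ring).
    apply Rabs_le_between in Q. lra. }
  assert (Hz1 : s <> 1). { intros E. rewrite E, re_RtoC in Hs1. lra. }
  destruct (plog_spec N s Hs1) as [P1 [P2 P3]].
  split; [|split].
  - apply (Chol_plus (plog N) (fun s => Clog (zeta s * euler N s))). exact P1.
    apply (Chol_comp Clog (fun s => zeta s * euler N s)%C).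
    apply (Chol_mult zeta). apply zeta_Chol; assumption. apply Chol_euler.
    eexists. apply Cderiv_Clog, Rw.
  - rewrite Cexp_plus, Cexp_Clog by exact Rw. unfold w.
    rewrite <- (Cmult_1_l (zeta s)) at 2. rewrite <- P2. ring.
  - eapply Rle_trans. apply Cmod_triangle. apply Rplus_le_compat.
    eapply Rle_trans. exact P3. apply esum_le, Hs1.
    assert (Q := Clog_1_minus (1 - w) ltac:(lra)). replace (1 - (1 - w))%C with w in Q by ring.
    eapply Rle_trans. exact Q.
    assert (Ropp 0.01 <= ln (1 - Cmod (1 - w))); [|lra].
    apply ln_ge. assert (Q2 := exp_ineq1_le 0.01). rewrite exp_Ropp.
    apply Rle_trans with (/ 1.01). apply Rinv_le_contravar; lra. lra.
Qed.

(** A logarithm L0 on the box and the logarithm L1 on the right are matched at the corner (b, c) by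
    subtracting their difference there, whose exponential is 1. The part of the box with Re z >= 1 +
    kappa is convex, so they agree along the segments from that corner. *)
Lemma log_zeta_on_box (a b c d kappa : R) : a <= b -> c <= d -> 0 < kappa -> 1 + kappa <= b ->
  (forall z, box a b c d z -> z <> 1 /\ zeta z <> 0) ->
  exists L, forall z, box a b c d z -> Chol L z /\ Cexp (L z) = zeta z /\
    (1 + kappa <= Re z -> Cmod (L z) <= ln (Re z / (Re z - 1)) + 0.01).
Proof.
  intros Hab Hcd Hk Hb Hz.
  destruct (log_on_box zeta a b c d Hab Hcd) as [L0 HL0].
  { intros z Hzb. destruct (Hz z Hzb). split. apply zeta_Chol; assumption. assumption. }
  destruct (log_right kappa Hk) as [L1 HL1].
  set (z0 := (b, c) : C).
  assert (Hz0 : box a b c d z0) by (split; simpl; lra).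
  destruct (HL1 z0 ltac:(exact Hb)) as [A1 [A2 _]]. destruct (HL0 z0 Hz0) as [B1 B2].
  set (k := (L0 z0 - L1 z0)%C).
  assert (Ek : Cexp k = 1). { unfold k, Cminus. rewrite Cexp_plus, Cexp_opp, A2, B2. field. apply Hz, Hz0. }
  exists (fun z => L0 z - k)%C. intros z Hzb. destruct (HL0 z Hzb) as [C1 C2].
  split; [|split].
  - apply (Chol_minus L0). exact C1. apply Chol_const.
  - unfold Cminus. rewrite Cexp_plus, Cexp_opp, Ek, C2. field.
  - intros Hre.
    assert (Hseg : forall x, 0 <= x <= 1 -> box a b c d (z0 + RtoC x * (z - z0))%C /\ 1 + kappa <= Re (z0 + RtoC x * (z - z0))%C).
    { intros x Hx. destruct Hzb as [Z1 Z2]. destruct z as [u v]. unfold z0. unfold Re, Im in *. simpl in Z1, Z2, Hre.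
      replace ((b, c) + RtoC x * ((u, v) - (b, c)))%C with (b + x * (u - b), c + x * (v - c)).
      2:{ unfold Cminus, Cplus, Copp, Cmult, RtoC; simpl; f_equal; ring. }
      unfold box, Re, Im; simpl. nra. }
    assert (D0 : (L0 z - k - L1 z)%C = 0).
    { apply (log_unique_on_segment (fun z => L0 z - k - L1 z)%C z0 z).
      - intros x Hx. destruct (Hseg x Hx) as [S1 S2].
        apply (Chol_minus (fun z => L0 z - k)%C L1). apply (Chol_minus L0). apply HL0, S1. apply Chol_const. apply HL1, S2.
      - intros x Hx. destruct (Hseg x Hx) as [S1 S2].
        unfold Cminus at 1 2. rewrite !Cexp_plus, !Cexp_opp, Ek.
        destruct (HL1 _ S2) as [_ [F1 _]]. destruct (HL0 _ S1) as [_ F2]. rewrite F1, F2. field.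
        apply Hz, S1.
      - unfold k. ring. }
    replace (L0 z - k)%C with (L1 z). apply HL1, Hre.
    replace (L0 z - k)%C with ((L0 z - k - L1 z) + L1 z)%C by ring. rewrite D0. ring.
Qed.
End Euler.

(** * Conclusion *)

(** With d > 0 this puts z in the interior of the region; with d = 0 it gives membership alone. *)
Lemma region_contains (t d : R) (z : C) : 10 ^ 4 <= Rabs t -> 0 <= d <= 0.5 ->
  1 / 2 + d < Re z -> Rabs (Im z - t) <= 10 * ln (ln (Rabs t)) + 2 ->
  forall w, Cmod (w - z) <= d -> region_R (10 ^ 3) 1 t w.
Proof.
  intros Ht Hd H1 H2 w Hw. assert (Hl := lnln_T_ge t Ht). assert (Hx := ln_T_ge t Ht).
  destruct (in_box_disc z w d Hw) as [B1 B2]. split. lra.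
  assert (E : ln (ln (Rabs t)) <= ln (ln (1 * (Rabs t + 1)))).
  { rewrite Rmult_1_l. apply ln_le. lra. apply ln_le; lra. }
  replace (Im w - t) with ((Im z - t) + (Im w - Im z)) by ring.
  eapply Rle_trans. apply Rabs_triang.
  assert (Rabs (Im w - Im z) <= 0.5) by (apply Rabs_le; lra). lra.
Qed.

(** Near s zeta is exp L, so its derivative is zeta(s) l by uniqueness of the derivative. *)
Lemma Cderiv_log_zeta (zeta L : C -> C) (s l : C) :
  (exists d, 0 < d /\ forall w, Cmod (w - s) < d -> Cexp (L w) = zeta w) ->
  Cderiv L s l -> (C_derive zeta s / zeta s)%C = l.
Proof.
  intros He Hl.
  assert (E : C_derive zeta s = (Cexp (L s) * l)%C).
  { apply is_C_derive_unique. apply is_derive_Cderiv.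
    apply (Cderiv_ext_loc (fun w => Cexp (L w))). exact He. apply Cderiv_exp, Hl. }
  destruct He as [d [Hd He]].
  rewrite E, <- (He s). field. apply Cexp_neq_0.
  replace (s - s)%C with (RtoC 0) by ring. rewrite Cmod_0. exact Hd.
Qed.

Theorem corollary1 :
  exists b1 b2 : R,
    0.95 < b1 < 0.951 /\ 0.97 < b2 < 0.971 /\
    forall zeta : C -> C, is_riemann_zeta zeta ->
    forall sigma t : R,
      1 / 2 < sigma ->
      10 ^ 4 <= Rabs t ->
      (forall z : C, region_R (10 ^ 3) 1 t z -> zeta z <> RtoC 0) ->
      (interval_S 0.5 0.5 1 t sigma ->
       forall L : C -> C,
         is_log_zeta_on zeta (interior_of (region_R (10 ^ 3) 1 t)) L ->
         Cmod (L (sigma, t)) <=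
           5.44 * Rpower (b1 * ln (Rabs t)) (2 * (1 - sigma))
             * ln (ln (Rabs t))) /\
      (interval_S 1.0051 0.3349 1 t sigma ->
       Cmod (C_derive zeta (sigma, t) / zeta (sigma, t))%C <=
         33.281 * Rpower (b2 * ln (Rabs t)) (2 * (1 - sigma))
           * (ln (ln (Rabs t))) ^ 2).
Proof.
  (* The midpoints of the two admissible intervals; [L_three_lines] accepts both. *)
  exists 0.9505, 0.9705. split; [lra|]. split; [lra|].
  intros zeta Hzeta sigma t Hsigma Ht Hnz.
  assert (Hl := lnln_T_ge t Ht). assert (Hx := ln_T_ge t Ht). assert (Hlx := lnln_T_le t Ht).
  assert (Hxt := ln_T_le t Ht). assert (Exl := exp_lnln_T t Ht).
  unfold interval_S. rewrite !Rmult_1_l.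
  set (x := ln (Rabs t)) in *. set (l := ln x) in *.
  set (u := / l). assert (Hu : 0 < u) by (apply Rinv_0_lt_compat; lra).
  assert (Hul : u * l = 1) by (apply Rinv_l; lra).
  assert (Hu2 : u <= 0.4546). { apply (Rmult_le_reg_r l). lra. rewrite Hul. lra. }
  unfold Rdiv. fold u.
  set (s := (sigma, t) : C).
  assert (Hst : Rabs (Im s - t) <= 1).
  { unfold s, Im; simpl. rewrite Rminus_diag, Rabs_R0. lra. }
  split.
  - intros Hs L [HL1 [HL2 HL3]].
    (* A disc of radius 0.005 / l about such a point still lies to the right of the critical line,
       hence in the region. *)
    assert (Hint : forall z, 1 / 2 + 0.01 / l <= Re z -> Rabs (Im z - t) <= 10 * l + 2 ->
      interior_of (region_R (10 ^ 3) 1 t) z).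
    { intros z H1 H2. unfold Rdiv in H1. fold u in H1. refine (proj2 (locally_Cmod (region_R (10 ^ 3) 1 t) z) _).
      exists (0.005 * u). split. lra. intros w Hw.
      apply (region_contains t (0.005 * u) z Ht); try lra. exact H2. }
    apply (L_three_lines t Ht zeta L Hzeta) with (b := 0.9505) (s := s).
    + intros z H1 H2. assert (Hz := Hint z (proj1 H1) H2). split.
      apply ex_derive_Chol. apply HL1, Hz. apply HL2, Hz.
    + fold x l. intros z H1 H2. fold x l in H2.
      assert (Hmin : 0 < Rmin 0.2 (0.84 / l)). { apply Rmin_pos. lra. unfold Rdiv. fold u. lra. }
      assert (Hz : interior_of (region_R (10 ^ 3) 1 t) z).
      { apply Hint. unfold Rdiv. fold u. lra. exact H2. }
      assert (Q := prime_power_sum_bound zeta Hzeta z (L z) ltac:(lra) (HL3 z Hz ltac:(lra))). lra.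
    + lra.
    + fold x l. unfold Rdiv. fold u. unfold s, Re; simpl. lra.
    + exact Hst.
  - intros Hs.
    assert (Hmin : 0 < Rmin 0.2 (0.84 / l)). { apply Rmin_pos. lra. unfold Rdiv. fold u. lra. }
    assert (Hmin2 := Rmin_l 0.2 (0.84 / l)).
    destruct (log_zeta_on_box zeta Hzeta (1 / 2 + 0.01 / l) 1.9 (t - (10 * l + 2)) (t + (10 * l + 2)) (Rmin 0.2 (0.84 / l))) as [L HL];
      try lra. unfold Rdiv; fold u; lra.
    { intros z [Z1 Z2]. unfold Rdiv in Z1. fold u in Z1. split.
      (* The box avoids the pole because |t| exceeds 10 l + 2. *)
      - intros E. rewrite E, im_RtoC in Z2. assert (Rabs t <= 10 * l + 2) by (apply Rabs_le; lra). lra.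
      - apply Hnz. apply (region_contains t 0 z Ht). lra. lra. fold x l. apply Rabs_le. lra.
        replace (z - z)%C with (RtoC 0) by ring. rewrite Cmod_0. lra. }
    assert (HLb : forall z, 1 / 2 + 0.01 / l <= Re z <= 1.9 -> Rabs (Im z - t) <= 10 * l + 2 ->
      box (1 / 2 + 0.01 / l) 1.9 (t - (10 * l + 2)) (t + (10 * l + 2)) z).
    { intros z H1 H2. apply Rabs_le_between in H2. split; lra. }
    set (B := ln (0.9705 * x)).
    assert (HB0 : 0 < B). { unfold B. rewrite <- ln_1. apply ln_increasing; lra. }
    assert (HB : B <= l). { unfold B, l. apply ln_le; lra. }
    (* The bound at s, enlarged by 2.72 >= e: moving Re z by 0.5 / l changes the power by at most
       exp (B / l) <= e. *)
    set (M := 5.44 * Rpower (0.9705 * x) (2 * (1 - sigma)) * 2.72 * l).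
    (* The disc stays between the two lines because 1.0051 - 0.5 > 0.5 and 0.3349 + 0.5 < 0.84. *)
    assert (Hdisc : forall z, Cmod (z - s) <= 0.5 * u -> Chol L z /\ Cexp (L z) = zeta z /\ Cmod (L z) <= M).
    { intros z Hz. destruct (in_box_disc s z _ Hz) as [B1 B2]. change (Re s) with sigma in B1. change (Im s) with t in B2.
      assert (Hi : Rabs (Im z - t) <= 1) by (apply Rabs_le; lra).
      assert (Hb : box (1 / 2 + 0.01 / l) 1.9 (t - (10 * l + 2)) (t + (10 * l + 2)) z).
      { apply HLb. unfold Rdiv; fold u; lra. lra. }
      destruct (HL z Hb) as [C1 [C2 _]]. split; [exact C1|]. split; [exact C2|].
      assert (T := L_three_lines t Ht zeta L Hzeta).
      assert (T2 : Cmod (L z) <= 5.44 * Rpower (0.9705 * x) (2 * (1 - Re z)) * l).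
      { apply T.
        - intros w W1 W2. destruct (HL w (HLb w W1 W2)) as [D1 [D2 _]]. split; assumption.
        - intros w W1 W2. fold x l in W1, W2. apply HL. apply HLb. unfold Rdiv; fold u; lra. exact W2. lra.
        - lra.
        - fold x l. unfold Rdiv. fold u. lra.
        - exact Hi. }
      eapply Rle_trans. exact T2. unfold M. apply Rmult_le_compat_r. lra. rewrite Rmult_assoc. apply Rmult_le_compat_l. lra.
      unfold Rpower. fold B. apply Rle_trans with (exp (2 * (1 - sigma) * B) * exp 1).
      rewrite <- exp_plus. apply exp_le. nra.
      apply Rmult_le_compat_l. left; apply exp_pos. apply exp_1_bounds. }
    assert (Hss : Cmod (s - s) = 0). { replace (s - s)%C with (RtoC 0) by ring. apply Cmod_0. }
    destruct (Hdisc s ltac:(lra)) as [[l' Hl'] _].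
    rewrite (Cderiv_log_zeta zeta L s l').
    2:{ exists (0.5 * u). split. lra. intros w Hw. apply Hdisc. lra. }
    2: exact Hl'.
    eapply Rle_trans. apply (Cauchy_deriv_bound L s l' (0.5 * u) M).
    lra. intros z Hz. apply Hdisc, Hz. intros z Hz. apply Hdisc. lra. exact Hl'.
    assert (P : 0 < Rpower (0.9705 * x) (2 * (1 - sigma))) by apply exp_pos.
    set (p := Rpower (0.9705 * x) (2 * (1 - sigma))) in *.
    (* Division by the radius 0.5 / l gives the second factor l, and 2 * 5.44 * 2.72 < 29.6. *)
    replace (M / (0.5 * u)) with (2 * 5.44 * 2.72 * (p * l ^ 2)).
    2:{ unfold M, u. replace 0.5 with (1 / 2) by lra. field. lra. }
    replace (33.281 * p * l ^ 2) with (33.281 * (p * l ^ 2)) by ring.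
    apply Rmult_le_compat_r. apply Rmult_le_pos. lra. apply pow2_ge_0. lra.
Qed.
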